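(* Let $G$ be a second-countable locally compact Hausdorff groupoid with a Haar system. Let $\Gamma$ be a discrete group with identity $e$ and let $c\colon G\to\Gamma$ be a continuous homomorphism. For $\gamma\in\Gamma$, set $G_\gamma:=c^{-1}(\{\gamma\})$, let $A_\gamma$ be the closure of $\{f\in C_c(G):\operatorname{supp} f\subset G_\gamma\}$ in $C^*_{\mathrm r}(G)$, and let $B_\gamma$ be the closure of $\{f\in C_c(G):\operatorname{supp} f\subset G_\gamma\}$ in $C^*(G)$. Then the $C^*$-algebras $C^*_{\mathrm r}(G)$ and $C^*(G)$ are topologically graded over $\Gamma$ with grading subspaces $\{A_\gamma:\gamma\in\Gamma\}$ and $\{B_\gamma:\gamma\in\Gamma\}$, respectively. In both cases, the conditional expectation implementing the topological grading is induced by restriction of functions; that is, it sends $f\in C_c(G)$ to the function in $C_c(G)$ that equals $f$ on $G_e$ and $0$ off $G_e$.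
   Context: For a groupoid $G$ with Haar system $\lambda=\{\lambda^u\}$, $C_c(G)$ is a $*$-algebra under convolution $(a*b)(x)=\int_G a(y)\,b(y^{-1}x)\,d\lambda^{r(x)}(y)$ and involution $a^*(x)=\overline{a(x^{-1})}$. Let $\lambda_u$ be the push-forward of $\lambda^u$ under inversion, and $\|a\|_I=\max\{\sup_u\int|a|\,d\lambda^u,\ \sup_u\int|a|\,d\lambda_u\}$. $C^*(G)$ is the completion of $C_c(G)$ in the norm given by the supremum of $\|\pi(a)\|$ over $I$-norm-decreasing $*$-representations $\pi$ on Hilbert spaces; $C^*_{\mathrm r}(G)$ is the completion in the norm $\|a\|_{\mathrm r}=\sup_{u}\|\pi_u(a)\|$, where $\pi_u$ is the regular representation on $L^2(Gu,\lambda_u)$, $Gu=\{x: s(x)=u\}$, given by $\pi_u(a)h=a*h$. Definition. A $C^*$-algebra $A$ is topologically graded over $\Gamma$ with grading subspaces $\{A_\gamma:\gamma\in\Gamma\}$ if the $A_\gamma$ are closed subspaces of $A$ such that (i) $A_\beta A_\gamma\subset A_{\beta\gamma}$ and $A_\gamma^*=A_{\gamma^{-1}}$ for all $\beta,\gamma\in\Gamma$; (ii) $\operatorname{span}\{A_\gamma:\gamma\in\Gamma\}$ is dense in $A$; and there is a bounded linear map $P\colon A\to A$ with $P=\mathrm{id}$ on $A_e$ and $P=0$ on $A_\gamma$ for $\gamma\neq e$. (In that case it is known that the subspaces $A_\gamma$ are linearly independent and that $P$ is a conditional expectation onto $A_e$.) *)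

(* Defs.v *)
From HB Require Import structures.
From mathcomp Require Import all_boot all_order all_algebra complex.
From mathcomp Require Import all_classical all_reals all_analysis.

Set Implicit Arguments.
Unset Strict Implicit.
Unset Printing Implicit Defensive.

Import Order.TTheory GRing.Theory Num.Theory.
Import numFieldNormedType.Exports.

Local Open Scope classical_set_scope.
Local Open Scope ring_scope.

(* The norm of a normed space over R[i] takes its values in R[i]; this is the
   same norm read in R. *)
Definition rnorm (R : realType) (V : normedModType R[i]) (x : V) : R :=
  complex.Re `|x|.

(* The scalar field itself, whose canonical normed structure is carried by the
   alias R[i]^o. *)
Definition cabs (R : realType) (z : R[i]) : R := complex.Re `|z|.

(* The algebraic operations are total functions on G: [gmul x y] is meaningful
   only if [gsrc x = grng y]. The unit space G^(0) is a subset of G. *)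
Record topGroupoid (G : topologicalType) := TopGroupoid {
  gsrc : G -> G;
  grng : G -> G;
  gmul : G -> G -> G;
  ginv : G -> G;
  grng_rng : forall x, grng (grng x) = grng x;
  gsrc_rng : forall x, gsrc (grng x) = grng x;
  grng_src : forall x, grng (gsrc x) = gsrc x;
  gsrc_src : forall x, gsrc (gsrc x) = gsrc x;
  grng_mul : forall x y, gsrc x = grng y -> grng (gmul x y) = grng x;
  gsrc_mul : forall x y, gsrc x = grng y -> gsrc (gmul x y) = gsrc y;
  gmulA : forall x y z, gsrc x = grng y -> gsrc y = grng z ->
    gmul x (gmul y z) = gmul (gmul x y) z;
  gmul_rng : forall x, gmul (grng x) x = x;
  gmul_src : forall x, gmul x (gsrc x) = x;
  grng_inv : forall x, grng (ginv x) = gsrc x;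
  gsrc_inv : forall x, gsrc (ginv x) = grng x;
  gmulV : forall x, gmul x (ginv x) = grng x;
  gmulVx : forall x, gmul (ginv x) x = gsrc x;
  gmul_continuous : {within [set p : G * G | gsrc p.1 = grng p.2],
    continuous (fun p : G * G => gmul p.1 p.2)};
  ginv_continuous : continuous ginv }.

Definition gunits (G : topologicalType) (gr : topGroupoid G) : set G :=
  [set u | grng gr u = u].

(* G^u and G_u *)
Definition rfib (G : topologicalType) (gr : topGroupoid G) (u : G) : set G :=
  [set x | grng gr x = u].

Definition sfib (G : topologicalType) (gr : topGroupoid G) (u : G) : set G :=
  [set x | gsrc gr x = u].

Notation borel G := (g_sigma_algebraType (@open G)).

Definition fsupp (R : realType) (G : topologicalType) (f : G -> R[i]) : set G :=
  closure [set x | f x != 0].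

Definition Cc (R : realType) (G : topologicalType) : set (G -> R[i]) :=
  [set f | continuous (f : G -> R[i]^o) /\ compact (fsupp f)].

Definition cint (R : realType) (G : ptopologicalType)
    (mu : {measure set (borel G) -> \bar R}) (D : set G) (f : G -> R[i]) : R[i] :=
  Complex (Rintegral mu D (fun x => complex.Re (f x)))
          (Rintegral mu D (fun x => complex.Im (f x))).

(* lambda u is lambda^u; only the values at units matter. A Borel measure that
   is finite on compact sets is a Radon measure, since the groupoids considered
   are second countable, locally compact and Hausdorff. *)
Record haar_system (R : realType) (G : ptopologicalType) (gr : topGroupoid G)
    (lambda : G -> {measure set (borel G) -> \bar R}) : Prop := HaarSystem {
  haar_finite : forall u, gunits gr u ->
    forall K : set G, compact K -> (lambda u K < +oo)%E;
  haar_support : forall u, gunits gr u ->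
    [set x | forall U : set G, open U -> U x -> (0 < lambda u U)%E] = rfib gr u;
  haar_continuous : forall f : G -> R[i], Cc f ->
    {within gunits gr,
      continuous (fun u => cint (lambda u) (rfib gr u) f : R[i]^o)};
  haar_invariant : forall (f : G -> R[i]) (x : G), Cc f ->
    cint (lambda (gsrc gr x)) (rfib gr (gsrc gr x)) (fun y => f (gmul gr x y)) =
    cint (lambda (grng gr x)) (rfib gr (grng gr x)) f }.

Definition conv (R : realType) (G : ptopologicalType) (gr : topGroupoid G)
    (lambda : G -> {measure set (borel G) -> \bar R}) (a b : G -> R[i]) :
    G -> R[i] :=
  fun x => cint (lambda (grng gr x)) (rfib gr (grng gr x))
             (fun y => a y * b (gmul gr (ginv gr y) x)).

Definition invol (R : realType) (G : topologicalType) (gr : topGroupoid G)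
    (a : G -> R[i]) : G -> R[i] :=
  fun x => Num.conj (a (ginv gr x)).

(* lambda_u *)
Definition haar_src (R : realType) (G : ptopologicalType) (gr : topGroupoid G)
    (lambda : G -> {measure set (borel G) -> \bar R}) (u : G) :
    set (borel G) -> \bar R :=
  pushforward (lambda u) (ginv gr : borel G -> borel G).

Definition I_norm (R : realType) (G : ptopologicalType) (gr : topGroupoid G)
    (lambda : G -> {measure set (borel G) -> \bar R}) (a : G -> R[i]) : \bar R :=
  maxe
    (ereal_sup [set integral (lambda u) (rfib gr u)
                      (fun x => (cabs (a x))%:E) | u in gunits gr])
    (ereal_sup [set integral (haar_src gr lambda u) (sfib gr u)
                      (fun x => (cabs (a x))%:E) | u in gunits gr]).

(* The inner product is linear in its first argument. *)
Record hilbertType (R : realType) := HilbertType {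
  hcarrier :> completeNormedModType R[i];
  hinner : {dot hcarrier for (@Num.conj R[i])};
  hnormE : forall x : hcarrier, `|x| ^+ 2 = hinner x x }.

Definition opnorm (R : realType) (H : normedModType R[i]) (T : H -> H) : \bar R :=
  ereal_sup [set (rnorm (T x))%:E | x in [set x | rnorm x <= 1]].

(* An I-norm-decreasing *-representation of C_c(G) by bounded operators on H;
   the values of [pi] outside C_c(G) are irrelevant. *)
Record I_star_rep (R : realType) (G : ptopologicalType) (gr : topGroupoid G)
    (lambda : G -> {measure set (borel G) -> \bar R}) (H : hilbertType R)
    (pi : (G -> R[i]) -> H -> H) : Prop := IStarRep {
  rep_linear : forall a, Cc a -> linear (pi a);
  rep_bounded : forall a, Cc a -> (opnorm (pi a) < +oo)%E;
  rep_add : forall a b (k : R[i]) xi, Cc a -> Cc b ->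
    pi (fun x => k * a x + b x) xi = k *: pi a xi + pi b xi;
  rep_mul : forall a b xi, Cc a -> Cc b ->
    pi (conv gr lambda a b) xi = pi a (pi b xi);
  rep_star : forall a xi eta, Cc a ->
    hinner H (pi a xi) eta = hinner H xi (pi (invol gr a) eta);
  rep_I_decr : forall a, Cc a -> (opnorm (pi a) <= I_norm gr lambda a)%E }.

Definition full_norm (R : realType) (G : ptopologicalType) (gr : topGroupoid G)
    (lambda : G -> {measure set (borel G) -> \bar R}) (a : G -> R[i]) : \bar R :=
  ereal_sup [set z | exists (H : hilbertType R) (pi : (G -> R[i]) -> H -> H),
    I_star_rep gr lambda pi /\ z = opnorm (pi a)].

(* Elements of L^2(G_u, lambda_u) are handled through representatives. *)
Definition L2norm (R : realType) (G : ptopologicalType) (gr : topGroupoid G)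
    (lambda : G -> {measure set (borel G) -> \bar R}) (u : G) (h : G -> R[i]) :
    \bar R :=
  sqrte (integral (haar_src gr lambda u) (sfib gr u)
           (fun x => (cabs (h x) ^+ 2)%:E)).

Definition L2 (R : realType) (G : ptopologicalType) (gr : topGroupoid G)
    (lambda : G -> {measure set (borel G) -> \bar R}) (u : G) :
    set (G -> R[i]) :=
  [set h | [/\ measurable_fun (sfib gr u : set (borel G))
                 (fun x : borel G => complex.Re (h x)),
               measurable_fun (sfib gr u : set (borel G))
                 (fun x : borel G => complex.Im (h x)) &
               (L2norm gr lambda u h < +oo)%E]].

(* The operator norm of pi_u(a) : h |-> a * h on L^2(G_u, lambda_u). *)
Definition regular_norm (R : realType) (G : ptopologicalType)
    (gr : topGroupoid G) (lambda : G -> {measure set (borel G) -> \bar R})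
    (u : G) (a : G -> R[i]) : \bar R :=
  ereal_sup [set L2norm gr lambda u (conv gr lambda a h) |
    h in [set h | L2 gr lambda u h /\ (L2norm gr lambda u h <= 1)%E]].

Definition red_norm (R : realType) (G : ptopologicalType) (gr : topGroupoid G)
    (lambda : G -> {measure set (borel G) -> \bar R}) (a : G -> R[i]) : \bar R :=
  ereal_sup [set regular_norm gr lambda u a | u in gunits gr].

(* C*-algebras need not be unital. *)
Record cstarType (R : realType) := CstarType {
  ccarrier :> completeNormedModType R[i];
  cmul : ccarrier -> ccarrier -> ccarrier;
  cstar : ccarrier -> ccarrier;
  cmulA : associative cmul;
  cmulDl : forall (k : R[i]) a b c,
    cmul (k *: a + b) c = k *: cmul a c + cmul b c;
  cmulDr : forall (k : R[i]) a b c,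
    cmul a (k *: b + c) = k *: cmul a b + cmul a c;
  cstarK : involutive cstar;
  cstarD : forall (k : R[i]) a b,
    cstar (k *: a + b) = Num.conj k *: cstar a + cstar b;
  cstarM : forall a b, cstar (cmul a b) = cmul (cstar b) (cstar a);
  cnormM : forall a b, `|cmul a b| <= `|a| * `|b|;
  cnorm_star : forall a, `|cmul (cstar a) a| = `|a| ^+ 2 }.

(* (A, iota) is a completion of the *-algebra C_c(G) in the norm N: the
   C*-algebra A together with an isometric *-homomorphism of C_c(G) onto a
   dense *-subalgebra. It is determined by N up to a unique isomorphism
   compatible with iota; the values of iota outside C_c(G) are irrelevant. *)
Record Cc_completion (R : realType) (G : ptopologicalType) (gr : topGroupoid G)
    (lambda : G -> {measure set (borel G) -> \bar R})
    (N : (G -> R[i]) -> \bar R) (A : cstarType R) (iota : (G -> R[i]) -> A) :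
    Prop := CcCompletion {
  compl_add : forall a b (k : R[i]), Cc a -> Cc b ->
    iota (fun x => k * a x + b x) = k *: iota a + iota b;
  compl_mul : forall a b, Cc a -> Cc b ->
    iota (conv gr lambda a b) = cmul (iota a) (iota b);
  compl_star : forall a, Cc a -> iota (invol gr a) = cstar (iota a);
  compl_norm : forall a, Cc a -> (rnorm (iota a))%:E = N a;
  compl_dense : dense (iota @` @Cc R G) }.

Definition reduced_cstar (R : realType) (G : ptopologicalType)
    (gr : topGroupoid G) (lambda : G -> {measure set (borel G) -> \bar R})
    (A : cstarType R) (iota : (G -> R[i]) -> A) : Prop :=
  Cc_completion gr lambda (red_norm gr lambda) iota.

Definition full_cstar (R : realType) (G : ptopologicalType)
    (gr : topGroupoid G) (lambda : G -> {measure set (borel G) -> \bar R})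
    (A : cstarType R) (iota : (G -> R[i]) -> A) : Prop :=
  Cc_completion gr lambda (full_norm gr lambda) iota.

Definition lsubspace (R : realType) (V : normedModType R[i]) (S : set V) : Prop :=
  S 0 /\ forall (k : R[i]) x y, S x -> S y -> S (k *: x + y).

Definition lspan (R : realType) (V : normedModType R[i]) (S : set V) : set V :=
  [set v | exists (n : nat) (k : 'I_n -> R[i]) (x : 'I_n -> V),
    (forall i, S (x i)) /\ v = \sum_(i < n) k i *: x i].

Definition implements_grading (R : realType) (A : cstarType R) (Gam : groupType)
    (Agr : Gam -> set A) (P : {linear A -> A}) : Prop :=
  [/\ exists M : R, forall a, rnorm (P a) <= M * rnorm a,
      forall a, Agr 1%g a -> P a = a &
      forall gam, gam != 1%g -> forall a, Agr gam a -> P a = 0].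

Record topologically_graded (R : realType) (A : cstarType R) (Gam : groupType)
    (Agr : Gam -> set A) : Prop := TopologicallyGraded {
  graded_closed : forall gam, closed (Agr gam);
  graded_subspace : forall gam, lsubspace (Agr gam);
  graded_mul : forall bet gam a b, Agr bet a -> Agr gam b ->
    Agr (bet * gam)%g (cmul a b);
  graded_star : forall gam, @cstar R A @` Agr gam = Agr (gam^-1)%g;
  graded_dense : dense (lspan (\bigcup_gam Agr gam));
  graded_expectation : exists P : {linear A -> A}, implements_grading Agr P }.

(* A contractive projection of A onto the C*-subalgebra B that is B-bilinear;
   such a map is automatically completely positive (Tomiyama). *)
Definition conditional_expectation (R : realType) (A : cstarType R) (B : set A)
    (P : {linear A -> A}) : Prop :=
  [/\ forall a, B (P a),
      forall b, B b -> P b = b,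
      forall a, rnorm (P a) <= rnorm a &
      forall a b, B b -> P (cmul b a) = cmul b (P a) /\ P (cmul a b) = cmul (P a) b].

Definition grading_subspace (R : realType) (G : ptopologicalType)
    (Gam : groupType) (c : G -> Gam) (A : cstarType R)
    (iota : (G -> R[i]) -> A) (gam : Gam) : set A :=
  closure (iota @` [set f | Cc f /\ fsupp f `<=` c @^-1` [set gam]]).

Definition restrict_fun (R : realType) (G : topologicalType) (D : set G)
    (f : G -> R[i]) : G -> R[i] :=
  patch (fun=> 0) D f.

(* Main.v *)
(* Restriction to G_e is contractive on C_c(G) for both norms; everything else
   follows by density, P being the continuous extension of f |-> f_e.
   Reduced norm: on G_g the function f_e * h coincides with f * (1_{G_g} h),
   and c takes countably many values, so that
   |f_e * h|^2 <= sum_g |f * (1_{G_g} h)|^2 <= |f|_r^2 |h|^2.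
   Full norm: an I-norm-decreasing representation pi on H induces another one
   on l^2(Gam, H), in which a function f supported on G_g acts as pi(f) tensored
   with left translation by g. Its compression to the vectors supported at the
   identity of Gam sends f to pi(f_e), whence |pi(f_e)| <= |f|. The induced
   representation is I-norm decreasing by a Schur test for matrices over
   C_c(G). *)

Require Import Defs.
From HB Require Import structures.
From mathcomp Require Import all_boot all_order all_algebra complex.
From mathcomp Require Import all_classical all_reals all_analysis.
From mathcomp Require Import measurable_realfun ring lra.

Set Implicit Arguments.
Unset Strict Implicit.
Unset Printing Implicit Defensive.

Import Order.TTheory GRing.Theory Num.Theory.
Import numFieldNormedType.Exports.

Local Open Scope classical_set_scope.
Local Open Scope ring_scope.

(* MathComp-Analysis's [convex] also exports a [conv]. *)
Local Notation conv := Defs.conv.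

(** * Norms over the complex numbers *)

(** Two obstacles shape the argument. In the regular representation the square integral of $f*h$ has
    to be cut along the grades, but $f*h$ is not known to be measurable for $h$ in $L^2$, so its
    integral is only a supremum over simple functions. Those can be cut, which gives the inequality
    in the direction wanted; exact countable additivity is used for $h$ alone. For the full norm,
    the size of an operator $\pi(a)$ is controlled only through the I-norm of the single function
    $a$, so a matrix over $C_c(G)$ is at first estimated entry by entry, with a factor depending on
    its size. That size grows with the finite set of grades considered. The remedy is that the
    largest row sum of fibre $L^1$ norms is submultiplicative under matrix convolution, by Tonelli's
    theorem and left invariance, while $\|A\xi\|^2\le\|A^*A\xi\|\,\|\xi\|$ can be iterated. Since
    [Gam] may be uncountable, $\ell^2$ over it is built on unordered sums. *)

Section rnorm_theory.
Context {R : realType} {V : normedModType R[i]}.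
Implicit Types (x y z : V).

Lemma rnormE x : `|x| = real_complex R (rnorm x).
Proof. by rewrite /rnorm RRe_real// ger0_real. Qed.

Lemma rnorm_ge0 x : 0 <= rnorm x.
Proof. by rewrite -ler0c -rnormE. Qed.

Lemma rnormD x y : rnorm (x + y) <= rnorm x + rnorm y.
Proof. by rewrite -lecR rmorphD /= -!rnormE ler_normD. Qed.

Lemma rnormN x : rnorm (- x) = rnorm x.
Proof. by rewrite /rnorm normrN. Qed.

Lemma rnormC x y : rnorm (x - y) = rnorm (y - x).
Proof. by rewrite -rnormN opprB. Qed.

Lemma rnorm0 : rnorm (0 : V) = 0.
Proof. by rewrite /rnorm normr0. Qed.

Lemma rnorm0_eq0 x : rnorm x = 0 -> x = 0.
Proof. by move=> x0; apply/eqP; rewrite -normr_eq0 rnormE x0. Qed.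

Lemma rnormB_le y x z : rnorm (x - z) <= rnorm (x - y) + rnorm (y - z).
Proof. by apply: le_trans (rnormD _ _); rewrite addrA subrK. Qed.

Lemma cabsE (k : R[i]) : `|k| = real_complex R (cabs k).
Proof. by rewrite /cabs RRe_real// ger0_real. Qed.

Lemma rnormZ (k : R[i]) x : rnorm (k *: x) = cabs k * rnorm x.
Proof. by apply: (@complexI R); rewrite rmorphM /= -!rnormE normrZ cabsE. Qed.

(** A positive element of [R[i]] is real, so balls of complex radius are balls of real radius. *)
Lemma nbhs_rnormP x (A : set V) :
  nbhs x A <-> exists2 e : R, 0 < e & forall y, rnorm (x - y) < e -> A y.
Proof.
split.
  move=> /nbhs_ballP[e /= e0 eA]; exists (complex.Re e).
    by move: e0; rewrite ltcE => /andP[].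
  move=> y xy; apply: eA; rewrite -ball_normE /=.
  rewrite rnormE -(RRe_real (gtr0_real e0)).
  by rewrite ltcR.
move=> [e e0 eA]; apply/nbhs_ballP; exists (real_complex R e) => /=.
  by rewrite ltcR.
by move=> y; rewrite -ball_normE /= rnormE ltcR; exact: eA.
Qed.

Lemma closure_rnormP (S : set V) x :
  closure S x <-> forall e : R, 0 < e -> exists2 y, S y & rnorm (x - y) < e.
Proof.
split=> [cSx e e0|H B /nbhs_rnormP[e e0 eB]].
  have /cSx[y [Sy /= xy]] : nbhs x [set y | rnorm (x - y) < e].
    by apply/nbhs_rnormP; exists e.
  by exists y.
by have [y Sy xy] := H _ e0; exists y; split=> //; exact: eB.
Qed.

Lemma dense_rnormP (S : set V) :
  dense S <-> forall x (e : R), 0 < e -> exists2 y, S y & rnorm (x - y) < e.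
Proof.
split=> [dS x e e0|H O [x Ox] oO].
  have nx : nbhs x [set y | rnorm (x - y) < e] by apply/nbhs_rnormP; exists e.
  have [|y [/interior_subset Oy Sy]] := dS _ _ (@open_interior _ [set y | rnorm (x - y) < e]).
    by exists x.
  by exists y.
have /nbhs_rnormP[e e0 eO] : nbhs x O by exact: open_nbhs_nbhs.
by have [y Sy /eO Oy] := H x e e0; exists y.
Qed.

End rnorm_theory.

Lemma cabs_ge0 (R : realType) (k : R[i]) : 0 <= cabs k.
Proof. by rewrite -ler0c -cabsE. Qed.

Lemma cabs1_gt0 (R : realType) (k : R[i]) : 0 < cabs k + 1.
Proof. by apply: ltr_wpDl; [exact: cabs_ge0|exact: ltr01]. Qed.

Lemma cabsM (R : realType) (k l : R[i]) : cabs (k * l) = cabs k * cabs l.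
Proof. by apply: (@complexI R); rewrite rmorphM /= -!cabsE normrM. Qed.

Lemma cabsD (R : realType) (k l : R[i]) : cabs (k + l) <= cabs k + cabs l.
Proof. by rewrite -lecR rmorphD /= -!cabsE ler_normD. Qed.

Lemma cabs_real (R : realType) (k : R) : cabs (real_complex R k) = `|k|.
Proof. by rewrite /cabs normc_def /= expr0n addr0 sqrtr_sqr. Qed.

Lemma cabs0 (R : realType) : cabs (0 : R[i]) = 0.
Proof. by rewrite /cabs normr0. Qed.

Lemma cabs_conj (R : realType) (k : R[i]) : cabs (Num.conj k) = cabs k.
Proof. by rewrite /cabs norm_conjC. Qed.

Lemma Re_cabs_le (R : realType) (k : R[i]) : `|complex.Re k| <= cabs k.
Proof. by rewrite -lecR -cabsE normc_ge_Re. Qed.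

Lemma Im_cabs_le (R : realType) (k : R[i]) : `|complex.Im k| <= cabs k.
Proof.
rewrite /cabs normc_def /= -sqrtr_sqr ler_wsqrtr// lerDr; exact: sqr_ge0.
Qed.

Lemma cabs_le_ReIm (R : realType) (k : R[i]) :
  cabs k <= `|complex.Re k| + `|complex.Im k|.
Proof.
rewrite /cabs normc_def /= -[leRHS]ger0_norm ?addr_ge0// -sqrtr_sqr ler_wsqrtr//.
rewrite sqrrD !real_normK ?num_real// -addrA lerD2l lerDr.
by rewrite mulrn_wge0// mulr_ge0.
Qed.

Lemma rnorm_cauchy_cvg (R : realType) (V : completeNormedModType R[i]) (u : nat -> V) :
  (forall e : R, 0 < e -> exists N, forall n m, (N <= n)%N -> (N <= m)%N ->
     rnorm (u n - u m) < e) ->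
  exists l, forall e : R, 0 < e ->
    exists N, forall n, (N <= n)%N -> rnorm (l - u n) < e.
Proof.
move=> H; have : cvg (u @ \oo).
  apply/cauchy_cvgP/cauchy_ballP => e e0; near_simpl.
  have [N HN] := H (complex.Re e) (proj2 (andP (etrans (esym (ltcE _ _)) e0))).
  exists ([set n | (N <= n)%N], [set n | (N <= n)%N]) => /=; first by split; exists N.
  move=> [n m] [/= Nn Nm]; rewrite -ball_normE /=.
  by rewrite rnormE -(RRe_real (gtr0_real e0)) ltcR HN.
move=> /cvg_ex[l ul]; exists l => e e0.
have /ul[N _ HN] : nbhs l [set y | rnorm (l - y) < e].
  by apply/nbhs_rnormP; exists e.
by exists N => n Nn; exact: HN.
Unshelve. all: by end_near. Qed.

Lemma le_eps (R : realType) (x y : R) : (forall e, 0 < e -> x <= y + e) -> x <= y.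
Proof. by move=> H; apply/ler_addgt0Pr. Qed.

Lemma rnorm_eq (R : realType) (V : normedModType R[i]) (x y : V) :
  (forall e : R, 0 < e -> rnorm (x - y) <= e) -> x = y.
Proof.
move=> H; apply/eqP; rewrite -subr_eq0; apply/eqP; apply: rnorm0_eq0.
apply/eqP; rewrite eq_le rnorm_ge0 andbT; apply: le_eps => e e0.
by rewrite add0r H.
Qed.

Lemma cabsC (R : realType) (k l : R[i]) : cabs (k - l) = cabs (l - k).
Proof. by rewrite /cabs distrC. Qed.

(** * Compactly supported functions and their grades *)

Lemma complex_cvgP (R : realType) (T : topologicalType) (f : T -> R[i]) (F : set_system T)
    (l : R[i]) : Filter F ->
  ((f : T -> R[i]^o) @ F --> (l : R[i]^o)) <->
  forall e : R, 0 < e -> \forall y \near F, cabs (l - f y) < e.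
Proof.
move=> FF; split=> [fx e e0|H A /nbhs_rnormP[e e0 eA]].
  apply: (fx [set z | cabs (l - z) < e]).
  by apply/(@nbhs_rnormP R R[i]^o); exists e.
by have := H e e0; apply: filterS => y; exact: eA.
Qed.

Lemma complex_continuousP (R : realType) (T : topologicalType) (f : T -> R[i]) :
  continuous (f : T -> R[i]^o) <->
  forall x (e : R), 0 < e -> \forall y \near x, cabs (f x - f y) < e.
Proof. by split=> H x; apply/complex_cvgP; exact: H. Qed.

Section fsupp.
Variables (R : realType) (T : topologicalType).
Implicit Types f g : T -> R[i].

Lemma fsupp_sub f (F : set T) : closed F -> (forall x, f x != 0 -> F x) ->
  fsupp f `<=` F.
Proof. by move=> cF fF; rewrite (closure_id F).1//; exact: closure_subset. Qed.

Lemma fsupp_neq0 f x : f x != 0 -> fsupp f x.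
Proof. by move=> fx; apply: subset_closure. Qed.

Lemma fsupp_eq0 f x : ~ fsupp f x -> f x = 0.
Proof. by move=> fx; apply: contrapT => /eqP/fsupp_neq0. Qed.

Lemma Cc_sub f (K : set T) : continuous (f : T -> R[i]^o) -> closed K -> compact K ->
  (forall x, f x != 0 -> K x) -> Cc f.
Proof.
move=> cf clK cK fK; split=> //.
by apply: (subclosed_compact _ cK); [exact: closed_closure|exact: fsupp_sub].
Qed.

(** The support lies in the union of two compact supports; this one criterion serves linear
    combinations, restrictions and absolute values. *)
Lemma Cc_comb f (a b : T -> R[i]) :
  continuous (f : T -> R[i]^o) -> Cc a -> Cc b ->
  (forall x, a x = 0 -> b x = 0 -> f x = 0) -> Cc f.
Proof.
move=> cf [ca Ka] [cb Kb] H.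
apply: (@Cc_sub _ (fsupp a `|` fsupp b)) => //.
- by apply: closedU; exact: closed_closure.
- exact: compactU.
- move=> x; have [ax0|/eqP/fsupp_neq0] := pselect (a x = 0); last by left.
  have [bx0|/eqP/fsupp_neq0] := pselect (b x = 0); last by right.
  by rewrite H// eqxx.
Qed.

Lemma Cc_lin (k : R[i]) f g : Cc f -> Cc g -> Cc (fun x => k * f x + g x).
Proof.
move=> Cf Cg; apply: (@Cc_comb _ _ _ _ Cf Cg).
  move=> x; apply: (@cvgD R[i] R[i]^o _ _ _ (fun x => k * f x)); last exact: Cg.1.
  by apply: (@cvgZl_tmp R[i] R[i]^o _ _ _ k f); exact: Cf.1.
by move=> x -> ->; rewrite mulr0 addr0.
Qed.

Lemma Cc0 : Cc (fun=> 0 : R[i]) (G := T).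
Proof.
apply: (@Cc_sub _ set0); first by move=> x; exact: cvg_cst.
- exact: closed0.
- exact: compact0.
- by move=> x; rewrite eqxx.
Qed.

Lemma CcD f g : Cc f -> Cc g -> Cc (fun x => f x + g x).
Proof.
move=> Cf Cg; have := Cc_lin 1 Cf Cg.
by under eq_fun do rewrite mul1r.
Qed.

Lemma CcZ (k : R[i]) f : Cc f -> Cc (fun x => k * f x).
Proof.
move=> Cf; have := Cc_lin k Cf Cc0.
by under eq_fun do rewrite addr0.
Qed.

Lemma Cc_sum (I : Type) (s : seq I) (F : I -> T -> R[i]) :
  (forall i, Cc (F i)) -> Cc (fun x => \sum_(i <- s) F i x).
Proof.
move=> CF; elim: s => [|i s IH].
  by under eq_fun do rewrite big_nil; exact: Cc0.
under eq_fun do rewrite big_cons.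
exact: CcD.
Qed.

End fsupp.

Section restrict.
Variables (R : realType) (T : ptopologicalType) (Gam : groupType) (c : T -> Gam).
Hypothesis c_continuous : continuous (c : T -> discrete_topology Gam).
Implicit Types (f g : T -> R[i]) (S : set Gam).

Lemma near_grade x : \forall y \near x, c y = c x.
Proof.
have /c_continuous : nbhs (c x : discrete_topology Gam) [set c x].
  by rewrite nbhs_principalE.
exact.
Qed.

Lemma open_grade S : open (c @^-1` S).
Proof.
rewrite openE => x Sx; have := near_grade x; apply: filterS => y /= cy.
by rewrite /preimage /= cy.
Qed.

Lemma closed_grade S : closed (c @^-1` S).
Proof. by rewrite -openC preimage_setC; exact: open_grade. Qed.

Lemma restrict_funE f (D : set T) x :
  restrict_fun D f x = if x \in D then f x else 0.
Proof. by []. Qed.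

Lemma restrict_fun_in f (D : set T) x : D x -> restrict_fun D f x = f x.
Proof. by move=> Dx; rewrite restrict_funE mem_set. Qed.

Lemma restrict_fun_out f (D : set T) x : ~ D x -> restrict_fun D f x = 0.
Proof. by move=> Dx; rewrite restrict_funE memNset. Qed.

Lemma restrict_lin (D : set T) (k : R[i]) f g :
  restrict_fun D (fun x => k * f x + g x) =
  (fun x => k * restrict_fun D f x + restrict_fun D g x).
Proof.
by apply/funext => x; rewrite !restrict_funE; case: ifP; rewrite ?mulr0 ?addr0.
Qed.

(** The grade is locally constant, so near each point the restriction is either [f] or zero. *)
Lemma Cc_restrict f S : Cc f -> Cc (restrict_fun (c @^-1` S) f).
Proof.
move=> Cf; apply: (@Cc_comb R T _ _ _ _ Cf Cf); last first.
  by move=> x + _; rewrite restrict_funE => ->; case: ifP.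
apply/complex_continuousP => x e e0.
have := (complex_continuousP _).1 Cf.1 x e e0.
apply: filterS2 (near_grade x) => y cy fxy.
have [Sx|Sx] := pselect (S (c x)).
  by rewrite !restrict_fun_in//= cy.
by rewrite !restrict_fun_out ?subrr ?cabs0//= cy.
Qed.

Lemma fsupp_restrict f S : fsupp (restrict_fun (c @^-1` S) f) `<=` c @^-1` S.
Proof.
apply: fsupp_sub; first exact: closed_grade.
move=> x; have [//|Sx] := pselect ((c @^-1` S) x).
by rewrite restrict_fun_out// eqxx.
Qed.

Lemma restrict_id f S : fsupp f `<=` c @^-1` S ->
  restrict_fun (c @^-1` S) f = f.
Proof.
move=> fS; apply/funext => x; have [Sx|Sx] := pselect ((c @^-1` S) x).
  by rewrite restrict_fun_in.
by rewrite restrict_fun_out//; apply/esym/fsupp_eq0 => /fS.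
Qed.

Lemma restrict_eq0 f S : fsupp f `<=` c @^-1` (~` S) ->
  restrict_fun (c @^-1` S) f = fun=> 0.
Proof.
move=> fS; apply/funext => x; have [Sx|Sx] := pselect ((c @^-1` S) x).
  by rewrite restrict_fun_in//; apply/fsupp_eq0 => /fS.
by rewrite restrict_fun_out.
Qed.

(** The open sets $c^{-1}\{h\}$ cover the compact support, so finitely many of them suffice. This
    makes every decomposition into homogeneous parts a finite sum. *)
Lemma grade_support f : Cc f ->
  exists2 s : seq Gam, uniq s & forall x, f x != 0 -> c x \in s.
Proof.
move=> [_]; rewrite compact_cover => /(_ Gam setT (fun h : Gam => c @^-1` [set h])).
move=> [g _|x _|s _ fs]; first exact: open_grade.
  by exists (c x).
exists (finmap.enum_fset s); first exact: finmap.fset_uniq.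
by move=> x /fsupp_neq0/fs[g /= gs ->].
Qed.

Lemma restrict_decomp f (s : seq Gam) : uniq s ->
  (forall x, f x != 0 -> c x \in s) ->
  f = fun x => \sum_(h <- s) restrict_fun (c @^-1` [set h]) f x.
Proof.
move=> us fs; apply/funext => x.
have [cxs|cxs] := boolP (c x \in s).
  rewrite (bigD1_seq (c x))//= restrict_fun_in// big1 ?addr0// => g gcx.
  by rewrite restrict_fun_out//= => cxg; rewrite cxg eqxx in gcx.
have fx0 : f x = 0.
  by apply/eqP; apply: contraNT cxs; exact: fs.
by rewrite big1// => g _; rewrite restrict_funE fx0; case: ifP.
Qed.

End restrict.

(** * Groupoid identities, and grades of convolutions and adjoints *)

Section conv_support.
Variables (R : realType) (G : ptopologicalType) (gr : topGroupoid G)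
  (lambda : G -> {measure set (borel G) -> \bar R}) (Gam : groupType) (c : G -> Gam).
Hypothesis c_continuous : continuous (c : G -> discrete_topology Gam).
Hypothesis c_hom : forall x y, gsrc gr x = grng gr y ->
  c (gmul gr x y) = (c x * c y)%g.

Lemma gmulKV x y : grng gr x = grng gr y -> gmul gr x (gmul gr (ginv gr x) y) = y.
Proof.
by move=> xy; rewrite gmulA ?grng_inv ?gsrc_inv// gmulV xy gmul_rng.
Qed.

Lemma gmulVK x y : gsrc gr x = grng gr y -> gmul gr (ginv gr x) (gmul gr x y) = y.
Proof.
by move=> xy; rewrite gmulA ?grng_inv ?gsrc_inv// gmulVx xy gmul_rng.
Qed.

Lemma ginv_unique x z : gsrc gr x = grng gr z -> gmul gr x z = grng gr x ->
  z = ginv gr x.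
Proof.
move=> xz xz1; rewrite -[LHS](gmulVK xz) xz1.
by rewrite -(gsrc_inv gr x) gmul_src.
Qed.

Lemma ginvK x : ginv gr (ginv gr x) = x.
Proof. by apply/esym/ginv_unique; rewrite ?gsrc_inv// gmulVx grng_inv. Qed.

Lemma ginv_mul x y : gsrc gr x = grng gr y ->
  ginv gr (gmul gr x y) = gmul gr (ginv gr y) (ginv gr x).
Proof.
move=> xy; have yx : gsrc gr (ginv gr y) = grng gr (ginv gr x).
  by rewrite gsrc_inv grng_inv.
apply/esym/ginv_unique; first by rewrite gsrc_mul// grng_mul// grng_inv.
have yx2 : gsrc gr y = grng gr (gmul gr (ginv gr y) (ginv gr x)).
  by rewrite grng_mul// grng_inv.
rewrite -(gmulA xy yx2) gmulKV ?grng_inv// grng_mul//.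
exact: gmulV.
Qed.

Lemma c_unit u : grng gr u = u -> c u = 1%g.
Proof.
move=> u1; have su : gsrc gr u = u by rewrite -u1 gsrc_rng.
have := @c_hom u u; rewrite su u1 => /(_ erefl).
have -> : gmul gr u u = u by rewrite -{1}u1 gmul_rng.
by move=> H; apply: (mulgI (c u)); rewrite mulg1.
Qed.

Lemma c_inv x : c (ginv gr x) = (c x)^-1%g.
Proof.
apply: (mulgI (c x)); rewrite mulgV -c_hom ?grng_inv// gmulV c_unit//.
exact: grng_rng.
Qed.

Lemma c_div x y : grng gr x = grng gr y ->
  c (gmul gr (ginv gr x) y) = ((c x)^-1 * c y)%g.
Proof. by move=> xy; rewrite c_hom ?c_inv// gsrc_inv. Qed.

Lemma cint0 (mu : {measure set (borel G) -> \bar R}) D :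
  cint mu D (fun=> 0) = 0.
Proof. by rewrite /cint /=; rewrite /Rintegral integral0. Qed.

Lemma eq_cint (mu : {measure set (borel G) -> \bar R}) (D : set G) (f g : G -> R[i]) :
  (forall x, D x -> f x = g x) -> cint mu D f = cint mu D g.
Proof.
move=> fg; rewrite /cint.
by congr Complex; apply: eq_Rintegral => x; rewrite inE => /fg ->.
Qed.

(** An integrand vanishing on the whole fibre has integral zero. Both the grade and the compactness
    of the support of a convolution are read off from the witness [y]. *)
Lemma conv_neq0 (a b : G -> R[i]) x : conv gr lambda a b x != 0 ->
  exists y, [/\ grng gr y = grng gr x, a y != 0 & b (gmul gr (ginv gr y) x) != 0].
Proof.
apply: contraPP => H; apply/negP; rewrite negbK; apply/eqP.
rewrite /conv -[RHS](cint0 (lambda (grng gr x)) (rfib gr (grng gr x))).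
apply: eq_cint => y yx; apply/eqP; rewrite mulf_eq0.
apply/negP => /negP; rewrite negb_or => /andP[ay bxy]; apply: H.
by exists y.
Qed.

Lemma fsupp_conv (a b : G -> R[i]) (g h : Gam) :
  fsupp a `<=` c @^-1` [set g] -> fsupp b `<=` c @^-1` [set h] ->
  fsupp (conv gr lambda a b) `<=` c @^-1` [set (g * h)%g].
Proof.
move=> ag bh; apply: fsupp_sub; first exact: closed_grade.
move=> x /conv_neq0[y [yx /fsupp_neq0/ag /= cy /fsupp_neq0/bh /=]].
by rewrite c_div// cy => <-; rewrite mulgA mulgV mul1g.
Qed.

Lemma Cc_invol (a : G -> R[i]) : hausdorff_space G -> Cc a -> Cc (invol gr a).
Proof.
move=> hG [ca Ka]; have ci := @ginv_continuous _ gr.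
have cK : compact (ginv gr @` fsupp a).
  by apply: continuous_compact => //; exact: continuous_subspaceT.
apply: (@Cc_sub R G _ (ginv gr @` fsupp a)).
- apply/complex_continuousP => x e e0.
  have /ci : \forall y \near ginv gr x, cabs (a (ginv gr x) - a y) < e.
    exact: (complex_continuousP _).1 ca (ginv gr x) e e0.
  move=> H; apply: (@filterS _ (nbhs x) _ _ _ _ H) => y /=.
  by rewrite /invol -rmorphB cabs_conj.
- exact: compact_closed.
- exact: cK.
- move=> x; rewrite conjC_eq0 => /fsupp_neq0 ax.
  by exists (ginv gr x) => //; rewrite ginvK.
Qed.

Lemma involK (a : G -> R[i]) : invol gr (invol gr a) = a.
Proof. by apply/funext => x; rewrite /invol ginvK conjCK. Qed.

Lemma fsupp_invol (a : G -> R[i]) (g : Gam) : fsupp a `<=` c @^-1` [set g] ->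
  fsupp (invol gr a) `<=` c @^-1` [set g^-1%g].
Proof.
move=> ag; apply: fsupp_sub; first exact: closed_grade.
move=> x; rewrite /invol conjC_eq0 => /fsupp_neq0/ag /=.
by rewrite c_inv => <-; rewrite invgK.
Qed.

End conv_support.

(** * The grading, given that restriction is contractive *)

Section cstar_theory.
Variables (R : realType) (A : cstarType R).
Implicit Types a b : A.

Lemma cmulBl a b d : cmul (a - b) d = cmul a d - cmul b d.
Proof. by rewrite addrC -scaleN1r cmulDl scaleN1r addrC. Qed.

Lemma cmulBr a b d : cmul d (a - b) = cmul d a - cmul d b.
Proof. by rewrite addrC -scaleN1r cmulDr scaleN1r addrC. Qed.

Lemma cstarB a b : cstar (a - b) = cstar a - cstar b.
Proof. by rewrite addrC -scaleN1r cstarD rmorphN1 scaleN1r addrC. Qed.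

Lemma cmul0r a : cmul 0 a = 0.
Proof. by have := cmulBl 0 0 a; rewrite !subrr. Qed.

Lemma cmulr0 a : cmul a 0 = 0.
Proof. by have := cmulBr 0 0 a; rewrite !subrr. Qed.

Lemma rnorm_cmul a b : rnorm (cmul a b) <= rnorm a * rnorm b.
Proof. by rewrite -lecR rmorphM /= -!rnormE cnormM. Qed.

(** By the C*-identity $\|x\|^2=\|x^*x\|\le\|x^*\|\,\|x\|$; cancel $\|x\|$ and apply this to $x$ and
    to $x^*$. *)
Lemma rnorm_cstar a : rnorm (cstar a) = rnorm a.
Proof.
have H (x : A) : rnorm x <= rnorm (cstar x).
  have [->|x0] := eqVneq (rnorm x) 0; first exact: rnorm_ge0.
  have xp : 0 < rnorm x by rewrite lt_def x0 rnorm_ge0.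
  rewrite -(ler_pM2r xp).
apply: le_trans (rnorm_cmul (cstar x) x).
  by rewrite -lecR rmorphM /= -!rnormE cnorm_star expr2.
by apply/eqP; rewrite eq_le H andbT -{2}(cstarK a) H.
Qed.

Lemma cmul_sub_le a b x y :
  rnorm (cmul a b - cmul x y) <=
  rnorm (a - x) * rnorm b + rnorm x * rnorm (b - y).
Proof.
have -> : cmul a b - cmul x y = cmul (a - x) b + cmul x (b - y).
  by rewrite cmulBl cmulBr addrA subrK.
by apply: le_trans (rnormD _ _) _; rewrite lerD// rnorm_cmul.
Qed.

Lemma cmul_approx a b (e : R) : 0 < e -> exists2 d : R, 0 < d &
  forall x y, rnorm (a - x) < d -> rnorm (b - y) < d ->
  rnorm (cmul a b - cmul x y) < e.
Proof.
move=> e0; pose M := rnorm a + rnorm b + 1.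
have M0 : 0 < M.
  by rewrite /M; apply: ltr_wpDl; [apply: addr_ge0; exact: rnorm_ge0|exact: ltr01].
(* The bound 1 on the radius keeps [rnorm x] below [M]; the other bound makes each of the two error
   terms at most [e / 2]. *)
exists (Num.min 1 (e / (2 * M))).
  by rewrite lt_min ltr01 divr_gt0// mulr_gt0.
move=> x y; rewrite !lt_min => /andP[ax1 ax] /andP[by1 by_].
apply: le_lt_trans (cmul_sub_le _ _ _ _) _.
have xM : rnorm x <= M.
  have -> : x = a - (a - x) by rewrite opprB addrC subrK.
  apply: le_trans (rnormD _ _) _; rewrite rnormN /M -addrA lerD2l.
  by apply: ler_wpDl; [exact: rnorm_ge0|exact: ltW].
have bM : rnorm b <= M by rewrite /M -addrA addrCA lerDl; apply: addr_ge0 => //; exact: rnorm_ge0.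
rewrite [e]splitr; apply: ltr_leD.
  apply: le_lt_trans (_ : rnorm (a - x) * M < _); first by apply: ler_wpM2l => //; exact: rnorm_ge0.
  by rewrite -ltr_pdivlMr// -mulrA -invfM.
apply: le_trans (_ : M * rnorm (b - y) <= _); first by apply: ler_wpM2r => //; exact: rnorm_ge0.
by rewrite mulrC -ler_pdivlMr// -mulrA -invfM ltW.
Qed.

End cstar_theory.

Section bounded_linear.
Variables (R : realType) (V : normedModType R[i]) (P : {linear V -> V}) (M : R).
Hypothesis PM : forall a, rnorm (P a) <= M * rnorm a.

Lemma bounded_approx a (e : R) : 0 < e -> exists2 d : R, 0 < d &
  forall x, rnorm (a - x) < d -> rnorm (P a - P x) < e.
Proof.
move=> e0; have M0 : 0 < Num.max M 1 by rewrite lt_max ltr01 orbT.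
exists (e / Num.max M 1); first by rewrite divr_gt0.
move=> x ax; rewrite -linearB; apply: le_lt_trans (PM _) _.
apply: le_lt_trans (_ : Num.max M 1 * rnorm (a - x) < _).
  by apply: ler_wpM2r; [exact: rnorm_ge0|rewrite le_max lexx].
by rewrite mulrC -ltr_pdivlMr.
Qed.

End bounded_linear.

(** * The grading of a completion in any norm for which restriction to $G_e$ is contractive *)

Section graded.
Variables (R : realType) (G : ptopologicalType) (gr : topGroupoid G)
  (lambda : G -> {measure set (borel G) -> \bar R}) (Gam : groupType) (c : G -> Gam).
Hypothesis G_hausdorff : hausdorff_space G.
Hypothesis c_continuous : continuous (c : G -> discrete_topology Gam).
Hypothesis c_hom : forall x y, gsrc gr x = grng gr y ->
  c (gmul gr x y) = (c x * c y)%g.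
Hypothesis Cc_conv : forall a b, Cc a -> Cc b -> Cc (conv gr lambda a b).
Variables (N : (G -> R[i]) -> \bar R) (A : cstarType R) (iota : (G -> R[i]) -> A).
Hypothesis compl : Cc_completion gr lambda N iota.

Local Notation E := (restrict_fun (c @^-1` [set 1%g])).
Local Notation gs := (grading_subspace c iota).

Hypothesis contraction : forall f, Cc f -> (N (E f) <= N f)%E.

Lemma iota_lin k a b : Cc a -> Cc b ->
  iota (fun x => k * a x + b x) = k *: iota a + iota b.
Proof. by move=> ca cb; exact: (compl_add compl). Qed.

Lemma iota0 : iota (fun=> 0) = 0.
Proof.
have := iota_lin 1 (@Cc0 R G) (@Cc0 R G).
under eq_fun do rewrite mulr0 addr0.
by rewrite scale1r -{1}[iota _]addr0 => /addrI.
Qed.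

Lemma iotaD a b : Cc a -> Cc b -> iota (fun x => a x + b x) = iota a + iota b.
Proof.
move=> ca cb; have := iota_lin 1 ca cb.
by under eq_fun do rewrite mul1r; rewrite scale1r.
Qed.

Lemma iotaB a b : Cc a -> Cc b -> iota (fun x => -1 * b x + a x) = iota a - iota b.
Proof. by move=> ca cb; rewrite iota_lin// scaleN1r addrC. Qed.

Lemma iota_sum (I : Type) (s : seq I) (F : I -> G -> R[i]) :
  (forall i, Cc (F i)) ->
  iota (fun x => \sum_(i <- s) F i x) = \sum_(i <- s) iota (F i).
Proof.
move=> CF; elim: s => [|i s IH].
  by rewrite big_nil -iota0; congr iota; apply/funext => x; rewrite big_nil.
under eq_fun do rewrite big_cons.
by rewrite big_cons iotaD// ?IH//; exact: Cc_sum.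
Qed.

Lemma iota_contr f g : Cc f -> Cc g ->
  rnorm (iota (E f) - iota (E g)) <= rnorm (iota f - iota g).
Proof.
move=> cf cg; rewrite -!iotaB//; [|exact: Cc_restrict|exact: Cc_restrict].
rewrite -restrict_lin -lee_fin !(compl_norm compl).
- by apply: contraction; exact: Cc_lin.
- exact: Cc_lin.
- by apply: Cc_restrict => //; exact: Cc_lin.
Qed.

Lemma iota_dense a (e : R) : 0 < e -> exists2 f, Cc f & rnorm (a - iota f) < e.
Proof.
by move=> e0; have /dense_rnormP/(_ a e e0)[_ [f cf <-] ?] := compl_dense compl; exists f.
Qed.

Lemma gsP gam a : gs gam a <-> forall e : R, 0 < e -> exists f,
  [/\ Cc f, fsupp f `<=` c @^-1` [set gam] & rnorm (a - iota f) < e].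
Proof.
rewrite /grading_subspace closure_rnormP; split=> H e e0.
  by have [_ [f [cf fg] <-] af] := H e e0; exists f.
by have [f [cf fg af]] := H e e0; exists (iota f) => //; exists f.
Qed.

Lemma gs_iota gam f : Cc f -> fsupp f `<=` c @^-1` [set gam] -> gs gam (iota f).
Proof. by move=> cf fg; apply/gsP => e e0; exists f; rewrite subrr rnorm0; split. Qed.

Lemma gs_restrict gam f : Cc f -> gs gam (iota (restrict_fun (c @^-1` [set gam]) f)).
Proof.
move=> cf; apply: gs_iota; first exact: Cc_restrict.
exact: fsupp_restrict.
Qed.

Lemma gs_subspace gam : lsubspace (gs gam).
Proof.
split.
  rewrite -iota0; apply: gs_iota; first exact: Cc0.
  by apply: fsupp_sub; [exact: closed_grade|move=> x; rewrite eqxx].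
move=> k x y /gsP Hx /gsP Hy; apply/gsP => e e0.
have e2 : 0 < e / 2 by rewrite divr_gt0.
have ek : 0 < e / 2 / (cabs k + 1) by apply: divr_gt0 => //; exact: cabs1_gt0.
have [f [cf fg xf]] := Hx _ ek; have [g [cg gg yg]] := Hy _ e2.
exists (fun x => k * f x + g x); split.
- exact: Cc_lin.
- apply: fsupp_sub; first exact: closed_grade.
  move=> z; have [fz|/eqP/fsupp_neq0/fg//] := pselect (f z = 0).
  by rewrite fz mulr0 add0r => /fsupp_neq0/gg.
- rewrite iota_lin// opprD addrACA -scalerBr.
  apply: le_lt_trans (rnormD _ _) _; rewrite [e]splitr ler_ltD// rnormZ.
  apply: le_trans (_ : (cabs k + 1) * rnorm (x - iota f) <= _).
    by apply: ler_wpM2r; [exact: rnorm_ge0|rewrite lerDl].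
  by rewrite mulrC -ler_pdivlMr ?ltW//; exact: cabs1_gt0.
Qed.

Lemma gs_mul bet gam a b : gs bet a -> gs gam b -> gs (bet * gam)%g (cmul a b).
Proof.
move=> /gsP Ha /gsP Hb; apply/gsP => e e0.
have [d d0 H] := cmul_approx a b e0.
have [f [cf fg af]] := Ha d d0; have [g [cg gg bg]] := Hb d d0.
exists (conv gr lambda f g); split; [exact: Cc_conv|exact: fsupp_conv|].
by rewrite (compl_mul compl)// H.
Qed.

Lemma gs_star_sub gam a : gs gam a -> gs (gam^-1)%g (cstar a).
Proof.
move=> /gsP Ha; apply/gsP => e e0; have [f [cf fg af]] := Ha e e0.
exists (invol gr f); split; [exact: Cc_invol|exact: fsupp_invol|].
by rewrite (compl_star compl)// -cstarB rnorm_cstar.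
Qed.

Lemma gs_star gam : @cstar R A @` gs gam = gs (gam^-1)%g.
Proof.
apply/seteqP; split=> [_ [a Ha <-]|b Hb]; first exact: gs_star_sub.
by exists (cstar b); rewrite ?cstarK// -(invgK gam); exact: gs_star_sub.
Qed.

Lemma lspan_iota f : Cc f -> lspan (\bigcup_gam gs gam) (iota f).
Proof.
move=> cf; have [s us fs] := grade_support c_continuous cf.
exists (size s), (fun=> 1),
  (fun i => iota (restrict_fun (c @^-1` [set tnth (in_tuple s) i]) f)); split.
  by move=> i; exists (tnth (in_tuple s) i) => //; exact: gs_restrict.
under eq_bigr do rewrite scale1r.
rewrite {1}(restrict_decomp us fs) iota_sum; last by move=> g; exact: Cc_restrict.
by rewrite (big_tnth _ _ s).
Qed.

Lemma gs_dense : dense (lspan (\bigcup_gam gs gam)).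
Proof.
apply/dense_rnormP => x e e0; have [f cf xf] := iota_dense x e0.
by exists (iota f) => //; exact: lspan_iota.
Qed.

(** The value at [a] is the limit of [iota (E f)] as [iota f] tends to [a], which exists by
    contractivity. The inequality against every [f] at once encodes independence of the
    approximating sequence, and it alone yields that [p] extends restriction, is linear and is
    bounded. *)
Lemma expectation_ex : exists p : A -> A,
  forall a f, Cc f -> rnorm (p a - iota (E f)) <= rnorm (a - iota f).
Proof.
have invn0 n : 0 < n.+1%:R^-1 :> R by rewrite invr_gt0.
have /choice[F HF] : forall an : A * nat, exists f,
    Cc f /\ rnorm (an.1 - iota f) < an.2.+1%:R^-1.
  by move=> [a n]; have [f cf af] := iota_dense a (invn0 n); exists f.
have small (e : R) : 0 < e -> exists M, forall n, (M <= n)%N -> n.+1%:R^-1 < e.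
  move=> e0; exists (Num.truncn e^-1) => n Mn.
  rewrite invf_plt ?posrE//; apply: lt_le_trans (truncnS_gt _) _.
  by rewrite ler_nat ltnS.
suff /choice[p Hp] : forall a, exists l,
    forall f, Cc f -> rnorm (l - iota (E f)) <= rnorm (a - iota f).
  by exists p.
move=> a; have [e e0|l Hl] := @rnorm_cauchy_cvg R A (fun n => iota (E (F (a, n)))).
  have [M HM] := small (e / 2) (divr_gt0 e0 (ltr0Sn R 1)).
  exists M => n m Mn Mm.
  have [cn an] := HF (a, n); have [cm am] := HF (a, m).
  apply: le_lt_trans (iota_contr cn cm) _.
  apply: le_lt_trans (rnormB_le a _ _) _; rewrite [e]splitr ltrD//.
    by rewrite rnormC; apply: lt_trans an _; exact: HM.
  by apply: lt_trans am _; exact: HM.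
exists l => f cf; apply: le_eps => e e0.
have e2 : 0 < e / 2 by rewrite divr_gt0.
have [M HM] := small _ e2; have [M' HM'] := Hl _ e2.
pose n := maxn M M'; have [cn an] := HF (a, n).
apply: le_trans (rnormB_le (iota (E (F (a, n)))) _ _) _.
rewrite [e]splitr addrCA; apply: lerD; first by apply/ltW/HM'; rewrite leq_maxr.
apply: le_trans (iota_contr cn cf) _.
apply: le_trans (rnormB_le a _ _) _; rewrite [leLHS]addrC lerD2l rnormC.
by apply/ltW/(lt_trans an)/HM; rewrite leq_maxl.
Qed.

Lemma gs_expectation : exists P : {linear A -> A}, implements_grading gs P.
Proof.
have [p Hp] := expectation_ex.
have p_iota f : Cc f -> p (iota f) = iota (E f).
  move=> cf; apply: rnorm_eq => e e0; apply: le_trans (Hp _ _ cf) _.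
  by rewrite subrr rnorm0 ltW.
have p_lin : linear p.
  move=> k a b; apply: rnorm_eq => e e0.
  (* The errors of the two approximations are counted twice: in the argument of [p], and in its
     values. *)
  have e4 : 0 < e / 4 by rewrite divr_gt0.
  have ek : 0 < e / 4 / (cabs k + 1) by apply: divr_gt0 => //; exact: cabs1_gt0.
  have [f cf af] := iota_dense a ek; have [g cg bg] := iota_dense b e4.
  have kf : cabs k * rnorm (a - iota f) <= e / 4.
    apply: le_trans (_ : (cabs k + 1) * rnorm (a - iota f) <= _).
      by apply: ler_wpM2r; [exact: rnorm_ge0|rewrite lerDl].
    by rewrite mulrC -ler_pdivlMr ?ltW//; exact: cabs1_gt0.
  have kfg : rnorm (k *: a + b - (k *: iota f + iota g)) <= e / 4 + e / 4.
    rewrite opprD addrACA -scalerBr; apply: le_trans (rnormD _ _) _.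
    by rewrite rnormZ lerD// ltW.
  have pfg : rnorm (k *: p a + p b - (k *: iota (E f) + iota (E g))) <= e / 4 + e / 4.
    rewrite opprD addrACA -scalerBr; apply: le_trans (rnormD _ _) _.
    rewrite rnormZ; apply: lerD; last by apply: le_trans (Hp _ _ cg) (ltW bg).
    by apply: le_trans kf; apply: ler_wpM2l; [exact: cabs_ge0|exact: Hp].
  apply: le_trans (rnormB_le (k *: iota (E f) + iota (E g)) _ _) _.
  have -> : e = (e / 4 + e / 4) + (e / 4 + e / 4).
    by lra.
  apply: lerD; last by rewrite rnormC.
  rewrite -iota_lin//; [|exact: Cc_restrict|exact: Cc_restrict].
  rewrite -restrict_lin; apply: le_trans (Hp _ _ _) _; first exact: Cc_lin.
  by rewrite iota_lin.
pose P0 := GRing.isLinear.Build R[i] A A *:%R p p_lin.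
pose P : {linear A -> A} := HB.pack p P0.
(* The defining inequality of [p] at the zero function. *)
have p1 a : rnorm (P a) <= 1 * rnorm a.
  rewrite mul1r; have := Hp a _ (@Cc0 R G).
  rewrite restrict_eq0; last first.
    by apply: fsupp_sub; [exact: closed_grade|move=> x; rewrite eqxx].
  by rewrite iota0 !subr0.
exists P; split; first by exists 1.
  move=> a /gsP Ha; apply: rnorm_eq => e e0; have [f [cf fg af]] := Ha _ (divr_gt0 e0 (ltr0Sn R 1)).
  apply: le_trans (rnormB_le (iota f) _ _) _; rewrite [e]splitr.
  apply: lerD; last by rewrite rnormC ltW.
  by rewrite -{1}(restrict_id fg); apply: le_trans (Hp _ _ cf) (ltW af).
move=> gam gam1 a /gsP Ha; apply: rnorm_eq => e e0.
have [f [cf fg af]] := Ha _ e0; apply/ltW/(le_lt_trans _ af).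
have <- : iota (E f) = 0.
  rewrite restrict_eq0 ?iota0// => x /fg /= ->; exact/eqP.
exact: Hp.
Qed.

Lemma gs_graded : topologically_graded gs.
Proof.
split.
- by move=> gam; exact: closed_closure.
- exact: gs_subspace.
- exact: gs_mul.
- exact: gs_star.
- exact: gs_dense.
- exact: gs_expectation.
Qed.

(** Each [f] is a finite sum of homogeneous functions, on which the values of [P] are prescribed, so
    [P] is restriction on a dense subspace. Boundedness of [P] carries the remaining properties over
    to the closure. *)
Lemma gs_implements (P : {linear A -> A}) : implements_grading gs P ->
  conditional_expectation (gs 1%g) P /\
  forall f : G -> R[i], Cc f -> Cc (E f) /\ P (iota f) = iota (E f).
Proof.
move=> [[M PM] P1 P0].
have P_iota f : Cc f -> P (iota f) = iota (E f).
  move=> cf; have [s us fs] := grade_support c_continuous cf.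
  have cr g : Cc (restrict_fun (c @^-1` [set g]) f) by exact: Cc_restrict.
  rewrite {1}(restrict_decomp us fs) iota_sum// linear_sum.
  have Pr g : P (iota (restrict_fun (c @^-1` [set g]) f)) =
      if g == 1%g then iota (E f) else 0.
    have [->|g1] := eqVneq g 1%g; first by apply: P1; exact: gs_restrict.
    by apply: (P0 g) => //; exact: gs_restrict.
  under eq_bigr do rewrite Pr.
  have [s1|s1] := boolP (1%g \in s).
    rewrite (bigD1_seq 1%g)//= eqxx big1 ?addr0// => g g1.
    by rewrite (negbTE g1).
  rewrite big_seq big1 => [|g gs_].
    rewrite -iota0; congr iota; apply/esym/restrict_eq0.
    apply: fsupp_sub; first exact: closed_grade.
    by move=> x /fs cs /= cx1; rewrite -cx1 cs in s1.
  by case: eqP => // g1; rewrite -g1 gs_ in s1.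
have Papp a (e : R) : 0 < e -> exists f, [/\ Cc f, rnorm (a - iota f) < e &
    rnorm (P a - iota (E f)) < e].
  move=> e0; have [d d0 H] := bounded_approx PM a e0.
  have [|f cf af] := @iota_dense a (Num.min e d); first by rewrite lt_min e0.
  move: af; rewrite lt_min => /andP[af ad].
  by exists f; split=> //; rewrite -P_iota// H.
have gsP1 a : gs 1%g (P a).
  apply/gsP => e e0; have [f [cf _ af]] := Papp a e e0.
  by exists (E f); split=> //; [exact: Cc_restrict|exact: fsupp_restrict].
split; last by move=> f cf; split; [exact: Cc_restrict|exact: P_iota].
split=> //.
- move=> a; apply: le_eps => e e0.
  have [f [cf af Paf]] := Papp a _ (divr_gt0 e0 (ltr0Sn R 1)).
  rewrite -[P a](subrK (iota (E f))); apply: le_trans (rnormD _ _) _.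
  have Ef : rnorm (iota (E f)) <= rnorm (iota f).
    by rewrite -lee_fin !(compl_norm compl)//; [exact: contraction|exact: Cc_restrict].
  have fa : rnorm (iota f) <= rnorm a + e / 2.
    have -> : iota f = a - (a - iota f) by rewrite opprB addrC subrK.
    by apply: le_trans (rnormD _ _) _; rewrite rnormN lerD2l ltW.
  rewrite addrC [e]splitr addrA; apply: lerD; last exact: ltW.
  exact: le_trans fa.
(* Multiplying by an element of degree $e$ preserves the degree [g] of [d], so [P] fixes both the
   factor and the product when $g=e$, and kills both otherwise. *)
- have homog b g d : gs 1%g b -> gs g d ->
      P (cmul b d) = cmul b (P d) /\ P (cmul d b) = cmul (P d) b.
    move=> b1 dg; have := gs_mul b1 dg; have := gs_mul dg b1.
    rewrite mul1g mulg1; have [g1|g1] := eqVneq g 1%g.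
      rewrite g1 => db bd; rewrite (P1 _ bd) (P1 _ db) (P1 d)// -g1; exact: dg.
    move=> db bd; rewrite (P0 _ g1 _ db) (P0 _ g1 _ bd) (P0 _ g1 _ dg).
    by rewrite cmulr0 cmul0r.
  have cmul_sumr (I : Type) (s : seq I) b (F : I -> A) :
      cmul b (\sum_(i <- s) F i) = \sum_(i <- s) cmul b (F i).
    elim: s => [|i s IH]; first by rewrite !big_nil cmulr0.
    by rewrite !big_cons -IH -[F i]scale1r cmulDr !scale1r.
  have cmul_suml (I : Type) (s : seq I) b (F : I -> A) :
      cmul (\sum_(i <- s) F i) b = \sum_(i <- s) cmul (F i) b.
    elim: s => [|i s IH]; first by rewrite !big_nil cmul0r.
    by rewrite !big_cons -IH -[F i]scale1r cmulDl !scale1r.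
  have onCc b f : gs 1%g b -> Cc f ->
      P (cmul b (iota f)) = cmul b (P (iota f)) /\
      P (cmul (iota f) b) = cmul (P (iota f)) b.
    move=> b1 cf; have [s us fs] := grade_support c_continuous cf.
    have cr g : Cc (restrict_fun (c @^-1` [set g]) f) by exact: Cc_restrict.
    rewrite (restrict_decomp us fs) iota_sum// !linear_sum cmul_sumr cmul_suml.
    rewrite cmul_sumr cmul_suml !linear_sum.
    by split; apply: eq_bigr => g _; have [] := homog b g _ b1 (@gs_restrict g f cf).
  (* With [a] approximated by [iota f], the radius [d] brings the products within the tolerance [d2]
     of [P], and [d1] controls the product with [P a]. *)
  move=> a b b1; split; apply: rnorm_eq => e e0.
    have e2 : 0 < e / 2 by rewrite divr_gt0.
    have [d2 d20 H2] := bounded_approx PM (cmul b a) e2.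
    have [d d0 H] := cmul_approx b a d20.
    have [d1 d10 H1] := cmul_approx b (P a) e2.
    have [|f [cf af Paf]] := Papp a (Num.min d d1); first by rewrite lt_min d0.
    move: af Paf; rewrite !lt_min => /andP[ad _] /andP[_ Pad].
    apply: le_trans (rnormB_le (P (cmul b (iota f))) _ _) _; rewrite [e]splitr.
    apply: lerD; first by apply/ltW/H2/H; rewrite ?subrr ?rnorm0.
    rewrite (onCc b f b1 cf).1 P_iota// rnormC.
    by apply/ltW/H1; rewrite ?subrr ?rnorm0.
  have e2 : 0 < e / 2 by rewrite divr_gt0.
  have [d2 d20 H2] := bounded_approx PM (cmul a b) e2.
  have [d d0 H] := cmul_approx a b d20.
  have [d1 d10 H1] := cmul_approx (P a) b e2.
  have [|f [cf af Paf]] := Papp a (Num.min d d1); first by rewrite lt_min d0.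
  move: af Paf; rewrite !lt_min => /andP[ad _] /andP[_ Pad].
  apply: le_trans (rnormB_le (P (cmul (iota f) b)) _ _) _; rewrite [e]splitr.
  apply: lerD; first by apply/ltW/H2/H; rewrite ?subrr ?rnorm0.
  rewrite (onCc b f b1 cf).2 P_iota// rnormC.
  by apply/ltW/H1; rewrite ?subrr ?rnorm0.
Qed.

End graded.

(** * Extension of continuous functions *)

Section locally_compact_functions.
Variables (R : realType) (T : ptopologicalType).
Hypothesis T_hausdorff : hausdorff_space T.
Hypothesis T_locally_compact : locally_compact [set: T].

Lemma compact_nbhs (x : T) : exists K : set T, [/\ nbhs x K, compact K & closed K].
Proof.
have [K] := T_locally_compact (I : [set: T] x).
by rewrite withinET => xK [cK clK]; exists K.
Qed.

Lemma bump_function (x : T) (U : set T) : open U -> U x ->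
  exists f : T -> R, [/\ continuous f, (forall y, 0 <= f y <= 1), f x = 1,
    (forall y, f y != 0 -> U y) &
    exists K, [/\ compact K, closed K & forall y, f y != 0 -> K y]].
Proof.
move=> oU Ux; have [K [xK cK clK]] := compact_nbhs x.
(* Separating [x] from this closed set places the support of the bump inside [U] and inside the
   compact [K] simultaneously. *)
pose B := ~` (U `&` K°).
have clB : closed B.
  by rewrite /B closedC; apply: openI => //; exact: open_interior.
have nBx : ~ B x by move=> /not_andP[].
have /(@uniform_separatorP _ R)[f [cf f01 fx fB]] :=
  locally_compact_completely_regular (R := R) T_locally_compact T_hausdorff clB nBx.
exists (fun y => 1 - f y); split.
- by move=> y; apply: (@continuousB R R^o); [exact: cvg_cst|exact: cf].
- move=> y; have /f01 : range f (f y) by exists y.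
  by rewrite /= in_itv /= => /andP[? ?]; rewrite subr_ge0 lerBlDr lerDl; apply/andP.
- by have /fx /= -> : (f @` [set x]) (f x) by [exists x]; rewrite subr0.
- move=> y; apply: contraPP => nUy.
  have /fB /= -> : (f @` B) (f y) by exists y => // -[].
  by rewrite subrr eqxx.
- exists K; split=> // y; apply: contraPP => nKy.
  have /fB /= -> : (f @` B) (f y) by exists y => // -[_ /interior_subset].
  by rewrite subrr eqxx.
Qed.

Lemma cutoff (K : set T) : compact K -> exists f : T -> R,
  [/\ continuous f, (forall y, 0 <= f y <= 1), (forall y, K y -> f y = 1) &
    exists L, [/\ compact L, closed L & forall y, f y != 0 -> L y]].
Proof.
move=> cK.
have /choice[b Hb] : forall x : T, exists f : T -> R,
    [/\ continuous f, (forall y, 0 <= f y <= 1), f x = 1 &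
    exists L, [/\ compact L, closed L & forall y, f y != 0 -> L y]].
  by move=> x; have [f [? ? ? _ ?]] := bump_function openT (I : setT x); exists f.
pose U x := [set y | 2^-1 < b x y].
have oU x : open (U x).
  have [cb _ _ _] := Hb x.
  by apply: (@open_comp _ _ (b x) [set z | 2^-1 < z]) => [y _|]; [exact: cb|exact: open_gt].
have : cover_compact K by rewrite -compact_cover.
move=> /(_ T setT U)[||s _ Ks].
- by move=> x _; exact: oU.
- move=> x _; exists x => //; have [_ _ bx _] := Hb x.
  by rewrite /U /= bx invf_lt1// ltr1n.
pose S := finmap.enum_fset s.
pose f y := \sum_(x <- S) b x y.
have cf : continuous f.
  move=> y; rewrite /f; elim: (S) => [|x S' IH].
    by under eq_fun do rewrite big_nil; exact: cvg_cst.
  under eq_fun do rewrite big_cons.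
  by apply: (@continuousD R R^o); [have [cb _ _ _] := Hb x; exact: cb|exact: IH].
have b0 x y : 0 <= b x y by have [_ /(_ y)/andP[]] := Hb x.
have f0 y : 0 <= f y by apply: sumr_ge0.
(* On [K] some summand exceeds one half, so twice the sum is at least 1 there and the truncation
   equals 1. *)
exists (fun y => Num.min 1 (2 * f y)); split.
- move=> y; apply: (@continuous_min R T (cst 1) (fun y => 2 * f y)).
    exact: cvg_cst.
  by apply: (@continuousM R T (cst 2) f); [exact: cvg_cst|exact: cf].
- by move=> y; rewrite le_min ler01 mulr_ge0//= ge_min lexx.
- move=> y /Ks[x /= xs Uy]; apply/min_idPl.
  rewrite mulrC -ler_pdivrMr// mul1r; apply/ltW/(lt_le_trans Uy).
  by rewrite /f (bigD1_seq x)//= ?lerDl ?sumr_ge0// finmap.fset_uniq.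
- have /choice[L HL] : forall x : T, exists L,
      [/\ compact L, closed L & forall y, b x y != 0 -> L y].
    by move=> x; have [_ _ _] := Hb x.
  exists (\big[setU/set0]_(x <- S) L x); split.
  + apply: (big_ind compact) => [|A B cA cB|x _]; [exact: compact0|exact: compactU|].
    by have [] := HL x.
  + by apply: closed_bigsetU => x _; have [] := HL x.
  + move=> y; apply: contraPP => nLy.
    suff -> : f y = 0 by rewrite mulr0 (min_idPr _) ?ler01// eqxx.
    rewrite /f big_seq big1// => x xS; apply: contrapT => /eqP bxy; apply: nLy.
    rewrite -bigcup_seq; exists x => //.
    by have [_ _ H] := HL x; exact: H.
Qed.

(** The one-point compactification is compact Hausdorff, hence normal. Since [f] vanishes on [F] off
    the compact [K], it extends continuously by 0 at infinity; Tietze's theorem applies there, and a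
    cutoff equal to 1 on [K] restores compact support. *)
Lemma tietze_compact_support (F K : set T) (f : T -> R) :
  closed F -> compact K -> {within F, continuous f} ->
  (forall y, F y -> ~ K y -> f y = 0) ->
  exists h : T -> R, [/\ continuous h, (forall y, F y -> h y = f y) &
    exists L, [/\ compact L, closed L & forall y, h y != 0 -> L y]].
Proof.
move=> clF cK /subspace_continuousP cf fK.
pose X := one_point_compactification T.
have normX : normal_space X.
  apply: compact_normal; last exact: one_point_compactification_compact.
  exact: one_point_compactification_hausdorff.
(* [A] is [F] together with the point at infinity, written as the complement of an open set. *)
pose A : set X := ~` (Some @` (~` F)).
have clA : closed A.
  rewrite /A closedC; apply: one_point_compactification_open_some.
  by rewrite openC.
have AS y : A (Some y) <-> F y.
  split=> [AS|Fy [z nFz [zy]]]; last by apply: nFz; rewrite zy.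
  by apply: contrapT => nFy; apply: AS; exists y.
pose g (o : X) : R := if o is Some y then f y else 0.
have clK : closed K by exact: compact_closed.
have cg : {within A, continuous g}.
  apply/subspace_continuousP => -[y /AS Fy|_].
    move=> B /(cf _ Fy) H.
    have H' : nbhs y [set z | F z -> B (f z)] by exact: H.
    rewrite /within /= nbhs_simpl /=.
    apply: (@filterS _ (nbhs y) _ _ _ _ H') => z Hz.
    by move=> /AS Fz; exact: Hz.
  move=> B /nbhs_singleton B0.
  (* The complement of [K] is a neighbourhood of infinity on which [g] vanishes within [A]. *)
  exists K; first by split.
  move=> o [[z nKz <-]|->] Az; last exact: B0.
  by change (B (f z)); rewrite fK//; exact/AS.
have [M M0 gM] : exists2 M, 0 < M & forall o, A o -> `|g o| <= M.
  have cA : compact A.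
    by apply: (subclosed_compact clA one_point_compactification_compact).
  have /(@compact_bounded R R^o)[M [Mr HM]] := continuous_compact cg cA.
  exists (`|M| + 1); first by rewrite ltr_wpDl.
  move=> o Ao; apply: HM; first by rewrite ltr_pwDr// ler_norm.
  by exists o.
have [h [hg ch _]] := continuous_bounded_extension normX clA M0 cg gM.
have [phi [cphi phi01 phiK [L [cL clL HL]]]] := cutoff cK.
exists (fun y => h (Some y) * phi y); split.
- move=> y; apply: (@continuousM R T (fun y => h (Some y)) phi); last exact: cphi.
  apply: (@continuous_comp T X R Some h); last exact: ch.
  exact: one_point_compactification_some_continuous.
- move=> y Fy; have <- : g (Some y) = h (Some y) by apply: hg; rewrite inE; exact/AS.
  rewrite /g; have [/phiK ->|nKy] := pselect (K y); first by rewrite mulr1.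
  by rewrite fK// mul0r.
- exists L; split=> // y hphi; apply: HL; apply: contraNneq hphi => ->.
  by rewrite mulr0.
Qed.

Lemma Re_within (F : set T) (f : T -> R[i]) : {within F, continuous (f : T -> R[i]^o)} ->
  {within F, continuous (fun x => complex.Re (f x))}.
Proof.
move=> /subspace_continuousP H; apply/subspace_continuousP => x Fx.
apply/(@cvgrPdist_lt R R^o) => e e0.
have /complex_cvgP/(_ e e0) := H x Fx.
apply: filterS => y; apply: le_lt_trans.
by apply: le_trans (Re_cabs_le _); rewrite raddfB.
Qed.

Lemma Im_within (F : set T) (f : T -> R[i]) : {within F, continuous (f : T -> R[i]^o)} ->
  {within F, continuous (fun x => complex.Im (f x))}.
Proof.
move=> /subspace_continuousP H; apply/subspace_continuousP => x Fx.
apply/(@cvgrPdist_lt R R^o) => e e0.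
have /complex_cvgP/(_ e e0) := H x Fx.
apply: filterS => y; apply: le_lt_trans.
by apply: le_trans (Im_cabs_le _); rewrite raddfB.
Qed.

Lemma Cc_ReIm (f g : T -> R) (K L : set T) : continuous f -> continuous g ->
  compact K -> closed K -> (forall y, f y != 0 -> K y) ->
  compact L -> closed L -> (forall y, g y != 0 -> L y) ->
  Cc (fun y => Complex (f y) (g y)).
Proof.
move=> cf cg cK clK fK cL clL gL.
apply: (@Cc_sub _ _ _ (K `|` L)); last first.
- move=> x fgx; apply: contrapT => /not_orP[nK nL]; move/eqP: fgx; apply.
  have -> : f x = 0 by apply: contrapT => /eqP/fK.
  by have -> : g x = 0 by apply: contrapT => /eqP/gL.
- exact: compactU.
- exact: closedU.
apply/complex_continuousP => x e e0.
have e2 : 0 < e / 2 by rewrite divr_gt0.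
have /(@cvgrPdist_lt R R^o)/(_ _ e2) Hf := cf x.
have /(@cvgrPdist_lt R R^o)/(_ _ e2) Hg := cg x.
apply: filterS2 Hf Hg => y fxy gxy.
by apply: le_lt_trans (cabs_le_ReIm _) _; rewrite [e]splitr /=; apply: ltrD.
Qed.

Lemma Cc_real (f : T -> R) (K : set T) : continuous f ->
  compact K -> closed K -> (forall y, f y != 0 -> K y) ->
  Cc (fun y => real_complex R (f y)).
Proof.
move=> cf cK clK fK; apply: (@Cc_ReIm _ (fun=> 0) _ _ cf _ cK clK fK cK clK) => //.
  by move=> x; exact: cvg_cst.
by move=> y; rewrite eqxx.
Qed.

Lemma Cc_extension (F K : set T) (f : T -> R[i]) :
  closed F -> compact K -> {within F, continuous (f : T -> R[i]^o)} ->
  (forall y, F y -> ~ K y -> f y = 0) ->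
  exists2 h : T -> R[i], Cc h & forall y, F y -> h y = f y.
Proof.
move=> clF cK cf fK.
have [|h [ch hf [L [cL clL hL]]]] := tietze_compact_support clF cK (Re_within cf).
  by move=> y Fy nKy; rewrite fK.
have [|h' [ch' hf' [L' [cL' clL' hL']]]] := tietze_compact_support clF cK (Im_within cf).
  by move=> y Fy nKy; rewrite fK.
exists (fun y => Complex (h y) (h' y)); first exact: (Cc_ReIm ch ch' cL clL hL cL').
by move=> y Fy; rewrite hf// hf'//; case: (f y).
Qed.

End locally_compact_functions.

(** * Borel measurability *)

Lemma countable_bigcup_measurable d (X : sigmaRingType d) (I : Type) (D : set I)
    (F : I -> set X) : countable D -> (forall i, D i -> measurable (F i)) ->
  measurable (\bigcup_(i in D) F i).
Proof.
move=> /countable_injP[e inj_e] mF.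
have -> : \bigcup_(i in D) F i = \bigcup_k \bigcup_(i in [set i | D i /\ e i = k]) F i.
  apply/seteqP; split=> [x [i Di Fix]|x [k _ [i [Di _] Fix]]]; last by exists i.
  by exists (e i) => //; exists i.
apply: bigcup_measurable => k _.
have [[i [Di ek]]|nex] := pselect (exists i, D i /\ e i = k); last first.
  rewrite (_ : \bigcup_(i in _) _ = set0) => [|]; first exact: measurable0.
  by rewrite -subset0 => x [i Hi _]; apply: nex; exists i.
rewrite (_ : \bigcup_(i in _) _ = F i); first exact: mF.
apply/seteqP; split=> [x [j [Dj ej] Fjx]|x Fix]; last by exists i.
by have <- : j = i by apply: inj_e; rewrite ?inE// ek.
Qed.

Section borel_measurability.
Variables (R : realType) (T : ptopologicalType).

Lemma open_borel (A : set T) : open A -> measurable (A : set (borel T)).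
Proof. by move=> oA; apply: sub_sigma_algebra. Qed.

Lemma closed_borel (A : set T) : closed A -> measurable (A : set (borel T)).
Proof.
move=> cA; rewrite -[A]setCK; apply: measurableC.
by apply: open_borel; rewrite openC.
Qed.

Lemma within_open_preimage (S : topologicalType) (D : set T) (f : T -> S) (U : set S) :
  {within D, continuous f} -> open U ->
  exists2 V : set T, open V & D `&` f @^-1` U = D `&` V.
Proof.
move=> /continuousP cf oU; have /open_subspaceP[V oV VU] := cf U oU.
by exists V => //; rewrite [RHS]setIC VU setIC.
Qed.

Lemma within_measurable (D : set T) (f : T -> R) : closed D ->
  {within D, continuous f} -> measurable_fun (D : set (borel T)) (f : borel T -> R).
Proof.
move=> cD cf; apply: (measurability _ (RGenOInfty.measurableE R)).
move=> _ [_ [x ->] <-]; rewrite set_itvE.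
have [V oV ->] := within_open_preimage cf (@open_gt R x).
by apply: measurableI; [exact: closed_borel|exact: open_borel].
Qed.

Hypothesis T_second_countable : @second_countable T.

(** An open set of the product is a countable union of rectangles from a countable base. Tonelli's
    theorem lives on the product sigma-algebra, so continuity on the product has to be linked to
    it. *)
Lemma open_borelX (W : set (T * T)) : open W ->
  measurable (W : set (borel T * borel T)).
Proof.
have [B cB [oB Bx]] := T_second_countable.
move=> oW; pose D := [set UV : set T * set T | [/\ B UV.1, B UV.2 & UV.1 `*` UV.2 `<=` W]].
have -> : W = \bigcup_(UV in D) (UV.1 `*` UV.2).
  apply/seteqP; split=> [[x y] Wxy|p [UV [_ _ H] /H//]].
  have [[U V] /= [xU yV] UVW] : nbhs (x, y) W by exact: open_nbhs_nbhs.
  have [U' [BU' U'x] U'U] := Bx x U xU; have [V' [BV' V'y] V'V] := Bx y V yV.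
  exists (U', V') => //=; split=> // -[a b] [/U'U /= Ua /V'V Vb].
  exact: UVW.
apply: countable_bigcup_measurable.
  apply: (@sub_countable _ _ _ (B `*` B)); last exact: countableX.
  by apply: subset_card_le => -[U V] [].
move=> [U V] [/oB oU /oB oV _]; apply: measurableX; exact: open_borel.
Qed.

Lemma within_measurableX (D : set (T * T)) (f : T * T -> R) :
  measurable (D : set (borel T * borel T)) ->
  {within D, continuous f} ->
  measurable_fun (D : set (borel T * borel T)) (f : borel T * borel T -> R).
Proof.
move=> mD /continuousP cf; apply: (measurability _ (RGenOInfty.measurableE R)).
move=> _ [_ [x ->] <-]; rewrite set_itvE.
have /open_subspaceP[V oV VU] := cf _ (@open_gt R x).
have -> : D `&` f @^-1` [set y | x < y] = D `&` V by rewrite [RHS]setIC VU setIC.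
by apply: measurableI => //; exact: open_borelX.
Qed.

Hypothesis T_hausdorff : hausdorff_space T.
Hypothesis T_locally_compact : locally_compact [set: T].

(** By local compactness the members of the countable base that lie in some compact set still cover
    the space, and each has finite measure. *)
Lemma radon_sigma_finite (mu : {measure set (borel T) -> \bar R}) :
  (forall K : set T, compact K -> (mu K < +oo)%E) -> sigma_finite setT mu.
Proof.
move=> fmu; have [B /countable_injP[e inj_e] [oB Bx]] := T_second_countable.
(* At most one set belongs to [D k], because [e] is injective on the base. *)
pose D k := [set V | [/\ B V, e V = k & exists2 K, compact K & V `<=` K]].
have oD k : open (\bigcup_(V in D k) V).
  by apply: bigcup_open => V [/oB].
exists (fun k => \bigcup_(V in D k) V).
  apply/seteqP; split=> // x _; have [K [xK cK _]] := compact_nbhs T_locally_compact x.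
  have [V [BV Vx] VK] := Bx x K xK.
  by exists (e V) => //; exists V => //; split=> //; exists K.
move=> k; split; first exact: open_borel.
have [[V DV]|nex] := pselect (exists V, D k V); last first.
  rewrite (_ : \bigcup_(V in D k) V = set0) ?measure0//.
  by rewrite -subset0 => x [V DV _]; apply: nex; exists V.
have [BV eV [K cK VK]] := DV; apply: le_lt_trans (fmu K cK).
apply: le_measure; rewrite ?inE; [exact: open_borel| |].
  by apply: closed_borel; exact: compact_closed.
move=> x [V' [BV' eV' _] V'x]; apply: VK.
by have <- : V' = V by apply: inj_e; rewrite ?inE// eV.
Qed.

End borel_measurability.

(** * Complex integrals *)

Section complex_integral.
Variables (R : realType) (T : ptopologicalType).
Variables (mu : {measure set (borel T) -> \bar R}) (D : set T).
Hypothesis mD : measurable (D : set (borel T)).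
Implicit Types f g : T -> R[i].

Definition cintegrable f :=
  mu.-integrable (D : set (borel T)) (fun x => (complex.Re (f x))%:E) /\
  mu.-integrable (D : set (borel T)) (fun x => (complex.Im (f x))%:E).

Lemma ReD (z w : R[i]) : complex.Re (z + w) = complex.Re z + complex.Re w.
Proof. by case: z w => [? ?] [? ?]. Qed.
Lemma ImD (z w : R[i]) : complex.Im (z + w) = complex.Im z + complex.Im w.
Proof. by case: z w => [? ?] [? ?]. Qed.
Lemma ReM (z w : R[i]) : complex.Re (z * w) =
  complex.Re z * complex.Re w - complex.Im z * complex.Im w.
Proof. by case: z w => [? ?] [? ?]. Qed.
Lemma ImM (z w : R[i]) : complex.Im (z * w) =
  complex.Re z * complex.Im w + complex.Im z * complex.Re w.
Proof. by case: z w => [? ?] [? ?]. Qed.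

Lemma integrable_comb (k l : R) (f g : T -> R) :
  mu.-integrable (D : set (borel T)) (fun x => (f x)%:E) ->
  mu.-integrable (D : set (borel T)) (fun x => (g x)%:E) ->
  mu.-integrable (D : set (borel T)) (fun x => (k * f x + l * g x)%:E).
Proof.
move=> If Ig.
have := integrableD mD (integrableZl mD k If) (integrableZl mD l Ig).
by apply: eq_integrable.
Qed.

Lemma Rintegral_comb (k l : R) (f g : T -> R) :
  mu.-integrable (D : set (borel T)) (fun x => (f x)%:E) ->
  mu.-integrable (D : set (borel T)) (fun x => (g x)%:E) ->
  Rintegral mu D (fun x => k * f x + l * g x) =
  k * Rintegral mu D f + l * Rintegral mu D g.
Proof.
move=> If Ig; rewrite RintegralD//; last 2 first.
- by have := integrableZl mD k If; apply: eq_integrable.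
- by have := integrableZl mD l Ig; apply: eq_integrable.
by rewrite !RintegralZl.
Qed.

Lemma cintegrable_lin (k : R[i]) f g : cintegrable f -> cintegrable g ->
  cintegrable (fun x => k * f x + g x).
Proof.
move=> [fr fi] [gr gi]; split.
  have := integrable_comb 1 1 (integrable_comb (complex.Re k) (- complex.Im k) fr fi) gr.
  by apply: eq_integrable => // x _; rewrite ReD ReM !mul1r mulNr.
have := integrable_comb 1 1 (integrable_comb (complex.Re k) (complex.Im k) fi fr) gi.
by apply: eq_integrable => // x _; rewrite ImD ImM !mul1r.
Qed.

Lemma cint_lin (k : R[i]) f g : cintegrable f -> cintegrable g ->
  cint mu D (fun x => k * f x + g x) = k * cint mu D f + cint mu D g.
Proof.
move=> [fr fi] [gr gi]; rewrite /cint.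
have Er : Rintegral mu D (fun x => complex.Re (k * f x + g x)) =
    complex.Re k * Rintegral mu D (fun x => complex.Re (f x)) -
    complex.Im k * Rintegral mu D (fun x => complex.Im (f x)) +
    Rintegral mu D (fun x => complex.Re (g x)).
  transitivity (Rintegral mu D (fun x => 1 * (complex.Re k * complex.Re (f x) +
      (- complex.Im k) * complex.Im (f x)) + 1 * complex.Re (g x))).
    by apply: eq_Rintegral => x _; rewrite ReD ReM !mul1r mulNr.
  by rewrite Rintegral_comb// ?Rintegral_comb ?mul1r ?mulNr//; exact: integrable_comb.
have Ei : Rintegral mu D (fun x => complex.Im (k * f x + g x)) =
    complex.Re k * Rintegral mu D (fun x => complex.Im (f x)) +
    complex.Im k * Rintegral mu D (fun x => complex.Re (f x)) +
    Rintegral mu D (fun x => complex.Im (g x)).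
  transitivity (Rintegral mu D (fun x => 1 * (complex.Re k * complex.Im (f x) +
      complex.Im k * complex.Re (f x)) + 1 * complex.Im (g x))).
    by apply: eq_Rintegral => x _; rewrite ImD ImM !mul1r.
  by rewrite Rintegral_comb// ?Rintegral_comb ?mul1r//; exact: integrable_comb.
by rewrite Er Ei; case: k {Er Ei} => a b.
Qed.

Lemma cint_real (f : T -> R) :
  cint mu D (fun x => real_complex R (f x)) = real_complex R (Rintegral mu D f).
Proof.
rewrite /cint /=; congr Complex.
by rewrite /Rintegral integral0.
Qed.

Lemma cint_conj f : cintegrable f ->
  cint mu D (fun x => Num.conj (f x)) = Num.conj (cint mu D f).
Proof.
move=> [fr fi]; rewrite /cint.
have -> : Rintegral mu D (fun x => complex.Im (Num.conj (f x))) =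
          - Rintegral mu D (fun x => complex.Im (f x)).
  rewrite -mulN1r -RintegralZl//; apply: eq_Rintegral => x _.
  by case: (f x) => a b /=; rewrite mulN1r.
congr Complex; apply: eq_Rintegral => x _.
by case: (f x).
Qed.

Lemma cintegrable_cabs f : cintegrable f ->
  mu.-integrable (D : set (borel T)) (fun x => (cabs (f x))%:E).
Proof.
move=> [fr fi].
have mfr : measurable_fun (D : set (borel T)) (fun x => complex.Re (f x)).
  by apply/measurable_EFinP; exact: measurable_int fr.
have mfi : measurable_fun (D : set (borel T)) (fun x => complex.Im (f x)).
  by apply/measurable_EFinP; exact: measurable_int fi.
have mabs : measurable_fun (D : set (borel T)) (fun x => cabs (f x)).
  have -> : (fun x => cabs (f x)) = (fun x =>
      Num.sqrt (complex.Re (f x) ^+ 2 + complex.Im (f x) ^+ 2)).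
    by apply/funext => x; rewrite /cabs normc_def.
  apply: (@measurableT_comp _ _ _ _ _ _ (@Num.sqrt R)) => //.
    by apply: continuous_measurable_fun; exact: sqrt_continuous.
  by apply: measurable_funD; exact: measurable_funX.
have H := integrableD mD (integrable_abse fr) (integrable_abse fi).
apply: (le_integrable mD _ _ H); first exact/measurable_EFinP.
move=> x Dx; rewrite /= lee_fin ger0_norm ?cabs_ge0//.
by apply: le_trans (cabs_le_ReIm _) _; rewrite ler_norm.
Qed.

Lemma cabs_cint_le f : cintegrable f ->
  ((cabs (cint mu D f))%:E <= \int[mu]_(x in D) (cabs (f x))%:E)%E.
Proof.
move=> If; set z := cint mu D f.
have [z0|z0] := eqVneq z 0.
  by rewrite z0 cabs0; apply: integral_ge0 => x _; rewrite lee_fin cabs_ge0.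
(* Rotating by this phase makes the integral equal to its own modulus, after which the real part of
   the integrand is bounded pointwise by its modulus. *)
pose t := Num.conj z / `|z|.
have nz0 : `|z| != 0 by rewrite normr_eq0.
have tz : t * z = `|z|.
  by rewrite /t mulrAC mulrC (mulrC _ z) -normCK expr2 mulrA mulVf// mul1r.
have t1 : cabs t = 1.
  apply: (@complexI R); rewrite -cabsE /t normrM norm_conjC normfV normr_id.
  by rewrite mulfV.
have Itf : cintegrable (fun x => t * f x).
  have I0 : cintegrable (fun=> 0).
    by split => /=; exact: integrable0.
  have := cintegrable_lin t If I0.
  by under eq_fun do rewrite addr0.
have E : cint mu D (fun x => t * f x) = t * z.
  have I0 : cintegrable (fun=> 0) by split => /=; exact: integrable0.
  have := cint_lin t If I0.
  under eq_fun do rewrite addr0.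
  by rewrite cint0 addr0.
have -> : cabs z = Rintegral mu D (fun x => complex.Re (t * f x)).
  by rewrite -[RHS]/(complex.Re (cint mu D (fun x => t * f x))) E tz.
rewrite /Rintegral fineK; last exact: integrable_fin_num Itf.1.
apply: le_integral => //; first exact: Itf.1.
  exact: cintegrable_cabs.
move=> x Dx; rewrite lee_fin; apply: le_trans (ler_norm _) _.
by apply: le_trans (Re_cabs_le _) _; rewrite cabsM t1 mul1r.
Qed.

(** On [D] the real and imaginary parts are bounded by multiples of the indicator of [K], which has
    finite measure. *)
Lemma fiber_integrable (K : set T) (f : T -> R[i]) : closed D -> closed K ->
  compact K -> (mu K < +oo)%E ->
  {within D, continuous (f : T -> R[i]^o)} ->
  (forall y, D y -> ~ K y -> f y = 0) -> cintegrable f.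
Proof.
move=> clD clK cK muK cf fK.
have mK : measurable (K : set (borel T)) by exact: closed_borel.
suff H (g : T -> R) : {within D, continuous g} -> (forall y, D y -> ~ K y -> g y = 0) ->
    mu.-integrable (D : set (borel T)) (fun x => (g x)%:E).
  by split; apply: H; rewrite ?fK//; [exact: Re_within| |exact: Im_within|];
    move=> y Dy nKy; rewrite fK.
move=> cg gK; have cKD : compact (K `&` D).
  apply: (subclosed_compact _ cK) => //; exact: closedI.
have cg' : {within K `&` D, continuous g}.
  by apply: continuous_subspaceW cg.
have /(@compact_bounded R R^o)[M [Mr HM]] := continuous_compact cg' cKD.
pose M' := `|M| + 1.
have M'0 : 0 <= M' by rewrite addr_ge0.
have gM y : D y -> `|g y| <= M' * \1_K y.
  move=> Dy; rewrite indicE; have [Ky|nKy] := pselect (K y).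
    rewrite mem_set// mulr1; apply: HM; first by rewrite ltr_pwDr// ler_norm.
    by exists y.
  by rewrite gK// normr0 mulr_ge0.
apply/integrableP; split; first by apply/measurable_EFinP; exact: within_measurable.
have mind : measurable_fun (D : set (borel T)) (fun x : borel T => (\1_K x : R)%:E).
  by apply/measurable_EFinP; exact: measurable_indic.
apply: (@le_lt_trans _ _ (\int[mu]_(x in D) (M'%:E * (\1_K x)%:E))%E).
  apply: ge0_le_integral => //.
  - apply/measurable_EFinP; apply: measurableT_comp => //.
    exact: within_measurable.
  - by apply: measurable_funeM; exact: mind.
rewrite ge0_integralZl//.
rewrite integral_indic//; apply: lte_mul_pinfty => //.
apply: le_lt_trans muK; apply: le_measure; rewrite ?inE//; exact: measurableI.
Qed.

End complex_integral.

(** * Convolution preserves C_c(G) *)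

Section groupoid_topology.
Variables (G : ptopologicalType) (gr : topGroupoid G).

(** Multiplication is continuous only within the composable pairs, so composites are handled within
    a set on which the pairs stay composable. *)
Lemma gmul_within (S : topologicalType) (D : set S) (f g : S -> G) :
  {within D, continuous f} -> {within D, continuous g} ->
  (forall s, D s -> gsrc gr (f s) = grng gr (g s)) ->
  {within D, continuous (fun s => gmul gr (f s) (g s))}.
Proof.
move=> /subspace_continuousP cf /subspace_continuousP cg fg.
apply/subspace_continuousP => s Ds B nB.
have [[U V] /= [nU nV] UV] := (subspace_continuousP _ _).1 (@gmul_continuous _ gr)
  (f s, g s) (fg s Ds) B nB.
have Hf : nbhs s [set t | D t -> U (f t)] := cf s Ds U nU.
have Hg : nbhs s [set t | D t -> V (g t)] := cg s Ds V nV.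
apply: (@filterS2 _ (nbhs s) _ _ _ _ _ Hf Hg) => t Ut Vt Dt.
by apply: (UV (f t, g t)); [split; [exact: Ut|exact: Vt]|exact: fg].
Qed.

Lemma continuous_setT (S U : topologicalType) (f : S -> U) :
  {within [set: S], continuous f} -> continuous f.
Proof.
move=> /subspace_continuousP cf x B nB.
by have : nbhs x [set t | setT t -> B (f t)] := cf x I B nB; apply: filterS => t; exact.
Qed.

(** Continuity comes from multiplication and inversion through $r(x)=xx^{-1}$. *)
Lemma grng_continuous : continuous (grng gr).
Proof.
apply: continuous_setT; rewrite (_ : grng gr = fun x => gmul gr x (ginv gr x)).
  apply: gmul_within => [||x _]; last by rewrite grng_inv.
    by apply: continuous_subspaceT => x; exact: cvg_id.
  by apply: continuous_subspaceT; exact: ginv_continuous.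
by apply/funext => x; rewrite gmulV.
Qed.

Lemma gsrc_continuous : continuous (gsrc gr).
Proof.
rewrite (_ : gsrc gr = grng gr \o ginv gr).
  by move=> x; apply: continuous_comp; [exact: ginv_continuous|exact: grng_continuous].
by apply/funext => x; rewrite /= grng_inv.
Qed.

Lemma fst_continuous_pair : continuous (fst : G * G -> G).
Proof. by move=> p; exact: cvg_fst. Qed.

Lemma snd_continuous_pair : continuous (snd : G * G -> G).
Proof. by move=> p; exact: cvg_snd. Qed.

Lemma continuous_fst_comp (S : topologicalType) (f : G -> S) :
  continuous f -> continuous (fun p : G * G => f p.1).
Proof.
move=> cf p; apply: (@continuous_comp (G * G)%type G S fst f); last exact: cf.
exact: fst_continuous_pair.
Qed.

Lemma continuous_snd_comp (S : topologicalType) (f : G -> S) :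
  continuous f -> continuous (fun p : G * G => f p.2).
Proof.
move=> cf p; apply: (@continuous_comp (G * G)%type G S snd f); last exact: cf.
exact: snd_continuous_pair.
Qed.

Lemma gdiv_within (D : set (G * G)) :
  (forall p, D p -> grng gr p.1 = grng gr p.2) ->
  {within D, continuous (fun p : G * G => gmul gr (ginv gr p.1) p.2)}.
Proof.
move=> H; apply: gmul_within => [||p Dp]; last by rewrite gsrc_inv; exact: H.
  apply: continuous_subspaceT => p.
  by apply: continuous_comp; [exact: fst_continuous_pair|exact: ginv_continuous].
by apply: continuous_subspaceT; exact: snd_continuous_pair.
Qed.

Hypothesis G_hausdorff : hausdorff_space G.

Lemma closed_eq_fun (S : topologicalType) (f g : S -> G) :
  continuous f -> continuous g -> closed [set s | f s = g s].
Proof.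
move=> cf cg s cs; apply: G_hausdorff => A B nA nB.
have nf : nbhs s (f @^-1` A) := cf s A nA.
have ng : nbhs s (g @^-1` B) := cg s B nB.
have [t [fgt [At Bt]]] := cs _ (filterI nf ng).
by exists (f t); split=> //; rewrite fgt.
Qed.

Lemma closed_rfib u : closed (rfib gr u).
Proof. by apply: closed_eq_fun; [exact: grng_continuous|move=> x; exact: cvg_cst]. Qed.

Lemma closed_sfib u : closed (sfib gr u).
Proof. by apply: closed_eq_fun; [exact: gsrc_continuous|move=> x; exact: cvg_cst]. Qed.

Lemma gunits_rng x : gunits gr (grng gr x).
Proof. exact: grng_rng. Qed.

Lemma gunits_src x : gunits gr (gsrc gr x).
Proof. exact: grng_src. Qed.

End groupoid_topology.

(** * Fibre integrals and the continuity of convolutions *)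

Section haar.
Variables (R : realType) (G : ptopologicalType) (gr : topGroupoid G)
  (lambda : G -> {measure set (borel G) -> \bar R}).
Hypothesis G_second_countable : @second_countable G.
Hypothesis G_locally_compact : locally_compact [set: G].
Hypothesis G_hausdorff : hausdorff_space G.
Hypothesis lambda_haar : haar_system gr lambda.
Implicit Types a b f : G -> R[i].

Lemma rfib_borel u : measurable (rfib gr u : set (borel G)).
Proof. by apply: closed_borel; exact: closed_rfib. Qed.

(** The integrand $y\mapsto a(y)b(y^{-1}x)$ of a convolution is meaningful only on the fibre over
    $r(x)$, so it belongs to this class rather than to $C_c(G)$. *)
Definition fiber_Cc u f := {within rfib gr u, continuous (f : G -> R[i]^o)} /\
  exists K, [/\ compact K, closed K & forall y, rfib gr u y -> ~ K y -> f y = 0].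

Lemma Cc_fiber u f : Cc f -> fiber_Cc u f.
Proof.
move=> [cf Kf]; split; first exact: continuous_subspaceT.
exists (fsupp f); split=> //; first exact: closed_closure.
by move=> y _ /fsupp_eq0.
Qed.

Lemma fiber_Cc_integrable u f : gunits gr u -> fiber_Cc u f ->
  cintegrable (lambda u) (rfib gr u) f.
Proof.
move=> u1 [cf [K [cK clK fK]]].
apply: (fiber_integrable (rfib_borel u) _ clK cK _ cf fK); first exact: closed_rfib.
exact: haar_finite lambda_haar _ u1 _ cK.
Qed.

Lemma Cc_integrable u f : gunits gr u -> Cc f -> cintegrable (lambda u) (rfib gr u) f.
Proof. by move=> u1 /(Cc_fiber u); exact: fiber_Cc_integrable. Qed.

Lemma fiber_Cc_ext u f : fiber_Cc u f ->
  exists2 h, Cc h & forall y, rfib gr u y -> h y = f y.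
Proof.
move=> [cf [K [cK clK fK]]].
exact: (@Cc_extension R G G_hausdorff G_locally_compact (rfib gr u) K f
  (closed_rfib G_hausdorff (u := u)) cK cf fK).
Qed.

Lemma complex_within (S : topologicalType) (D : set S) (f : S -> R[i]) :
  {within D, continuous (f : S -> R[i]^o)} <->
  forall x, D x -> forall e : R, 0 < e ->
    nbhs x [set y | D y -> cabs (f x - f y) < e].
Proof.
split=> [/subspace_continuousP H x Dx e e0|H].
  by have /complex_cvgP/(_ e e0) := H x Dx.
by apply/subspace_continuousP => x Dx; apply/complex_cvgP; exact: H.
Qed.

Lemma within_mul (S : topologicalType) (D : set S) (f g : S -> R[i]) :
  {within D, continuous (f : S -> R[i]^o)} ->
  {within D, continuous (g : S -> R[i]^o)} ->
  {within D, continuous ((fun x => f x * g x) : S -> R[i]^o)}.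
Proof.
by move=> cf cg x; apply: (@continuousM R[i] (subspace D) f g); [exact: (cf x)|exact: (cg x)].
Qed.

Lemma within_sub (S : topologicalType) (D : set S) (f g : S -> R[i]) :
  {within D, continuous (f : S -> R[i]^o)} ->
  {within D, continuous (g : S -> R[i]^o)} ->
  {within D, continuous ((fun x => f x - g x) : S -> R[i]^o)}.
Proof.
by move=> cf cg x; apply: (@continuousB R[i] R[i]^o (subspace D) f g); [exact: (cf x)|exact: (cg x)].
Qed.

Lemma within_comp_continuous (S U V : topologicalType) (D : set S) (f : S -> U) (g : U -> V) :
  {within D, continuous f} -> continuous g -> {within D, continuous (g \o f)}.
Proof.
move=> cf cg x; apply: (@continuous_comp (subspace D) U V f g); first exact: (cf x).
exact: cg.
Qed.

Lemma conv_integrand_pair a b : Cc a -> Cc b ->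
  {within [set p : G * G | grng gr p.1 = grng gr p.2],
    continuous ((fun p => a p.1 * b (gmul gr (ginv gr p.1) p.2)) : G * G -> R[i]^o)}.
Proof.
move=> [ca _] [cb _]; apply: within_mul.
  apply: continuous_subspaceT; apply: (@continuous_fst_comp G R[i]^o a); exact: ca.
by apply: (@within_comp_continuous _ G R[i]^o _ _ b); [exact: gdiv_within|exact: cb].
Qed.

Lemma conv_fiber a b x : Cc a -> Cc b ->
  fiber_Cc (grng gr x) (fun y => a y * b (gmul gr (ginv gr y) x)).
Proof.
move=> Ca Cb; split.
  apply/complex_within => y ry e e0.
  have /complex_within/(_ (y, x) ry e e0) := conv_integrand_pair Ca Cb.
  move=> [[U V] /= [nU nV] UV]; apply: filterS nU => z Uz rz.
  by apply: (UV (z, x)) => //; split=> //; exact: nbhs_singleton nV.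
exists (fsupp a); split; [exact: Ca.2|exact: closed_closure|].
by move=> y _ /fsupp_eq0 ->; rewrite mul0r.
Qed.

Lemma haar_within f : Cc f ->
  continuous ((fun x => cint (lambda (grng gr x)) (rfib gr (grng gr x)) f) : G -> R[i]^o).
Proof.
move=> Cf; apply/complex_continuousP => x e e0.
have /complex_within/(_ _ (gunits_rng gr x) e e0) := haar_continuous lambda_haar Cf.
move=> /(grng_continuous); apply: (@filterS _ (nbhs x)) => y; apply.
exact: gunits_rng.
Qed.

Lemma cint_sub_le u f g (h : G -> R) : gunits gr u -> fiber_Cc u f -> fiber_Cc u g ->
  fiber_Cc u (fun x => real_complex R (h x)) ->
  (forall y, rfib gr u y -> cabs (f y - g y) <= h y) ->
  cabs (cint (lambda u) (rfib gr u) f - cint (lambda u) (rfib gr u) g) <=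
  Rintegral (lambda u) (rfib gr u) h.
Proof.
move=> u1 /(fiber_Cc_integrable u1) If /(fiber_Cc_integrable u1) Ig.
move=> /(fiber_Cc_integrable u1)[Ih _] fgh.
have E : cint (lambda u) (rfib gr u) (fun x => -1 * g x + f x) =
    cint (lambda u) (rfib gr u) f - cint (lambda u) (rfib gr u) g.
  by rewrite cint_lin//; [rewrite mulN1r addrC|exact: rfib_borel].
have Ifg : cintegrable (lambda u) (rfib gr u) (fun x => -1 * g x + f x).
  by apply: cintegrable_lin => //; exact: rfib_borel.
rewrite -E -lee_fin; apply: le_trans (cabs_cint_le (rfib_borel u) Ifg) _.
rewrite /Rintegral fineK; last by apply: integrable_fin_num Ih; exact: rfib_borel.
apply: le_integral; first exact: rfib_borel.
- by apply: cintegrable_cabs; [exact: rfib_borel|exact: Ifg].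
- exact: Ih.
move=> y ry; rewrite lee_fin mulN1r [- g y + _]addrC.
by apply: fgh; move: ry; rewrite inE.
Qed.

(* As x approaches x0, the integrand y |-> a y * b (y^-1 x) becomes uniformly
   close on its fibre to a fixed h in C_c(G) that extends the integrand at x0:
   this reduces the claim to the continuity of the Haar system on h. *)
Lemma conv_continuous a b : Cc a -> Cc b ->
  continuous (conv gr lambda a b : G -> R[i]^o).
Proof.
move=> Ca Cb; apply/complex_continuousP => x0 e e0.
pose k x y := a y * b (gmul gr (ginv gr y) x).
have [h Ch hk] := fiber_Cc_ext (conv_fiber x0 Ca Cb).
pose K := fsupp a `|` fsupp h.
have cK : compact K by apply: compactU; [exact: Ca.2|exact: Ch.2].
have [phi [cphi phi01 phiK [L [cL clL phiL]]]] :=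
  @cutoff R G G_hausdorff G_locally_compact K cK.
have Cphi : Cc (fun y => real_complex R (phi y)) by exact: Cc_real cphi cL clL phiL.
pose M x := Rintegral (lambda (grng gr x)) (rfib gr (grng gr x)) phi.
have M0 x : 0 <= M x by apply: Rintegral_ge0 => y _; have /andP[] := phi01 y.
(* Near [x0] the mass [M x] is below [M x0 + 1], so an error of [d * phi] in the integrand costs
   less than [e / 2]. *)
pose d := e / 2 / (M x0 + 1).
have d0 : 0 < d by rewrite divr_gt0 ?divr_gt0// ltr_wpDl.
have nearM : \forall x \near x0, M x < M x0 + 1.
  have := (complex_continuousP _).1 (haar_within Cphi) x0 1 ltr01.
  apply: filterS => x; rewrite !cint_real -rmorphB cabs_real => H.
  by rewrite -ltrBlDl; apply: le_lt_trans H; rewrite distrC ler_norm.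
have nearh : \forall x \near x0, cabs (cint (lambda (grng gr x0)) (rfib gr (grng gr x0)) h -
     cint (lambda (grng gr x)) (rfib gr (grng gr x)) h) < e / 2.
  exact: ((complex_continuousP _).1 (haar_within Ch) x0 (e / 2) (divr_gt0 e0 (ltr0Sn R 1))).
have nearK : \forall x \near x0, K `<=` [set y | grng gr y = grng gr x ->
    cabs (k x y - h y) < d].
  have /compact_near_coveringP := cK.
  apply => y Ky /=.
  (* Pairs with equal ranges form a closed set, so if [y] is off the fibre of [x0] the condition is
     vacuous for all pairs near [(y, x0)]. *)
  have [ry|ry] := pselect (grng gr y = grng gr x0); last first.
    have clE : closed [set p : G * G | grng gr p.1 = grng gr p.2].
      apply: closed_eq_fun => //.
        by apply: continuous_fst_comp; exact: grng_continuous.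
      by apply: continuous_snd_comp; exact: grng_continuous.
    have oE : open (~` [set p : G * G | grng gr p.1 = grng gr p.2]).
      by rewrite openC.
    have nE : nbhs (y, x0) (~` [set p : G * G | grng gr p.1 = grng gr p.2]).
      exact: open_nbhs_nbhs.
    by apply: filterS nE => p /= np /np.
  have cP : {within [set p : G * G | grng gr p.1 = grng gr p.2],
     continuous ((fun p => a p.1 * b (gmul gr (ginv gr p.1) p.2) - h p.1) :
       G * G -> R[i]^o)}.
    apply: within_sub; first exact: conv_integrand_pair.
    apply: continuous_subspaceT.
    by apply: (@continuous_fst_comp G R[i]^o h); exact: Ch.1.
  have /complex_within/(_ (y, x0) ry d d0) := cP.
  apply: (@filterS _ (nbhs (y, x0))) => p /= H rp.
  have := H rp; rewrite hk// subrr sub0r /k.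
  by rewrite /cabs normrN.
apply: filterS3 nearM nearh nearK => x HM Hh HK.
have E0 : conv gr lambda a b x0 = cint (lambda (grng gr x0)) (rfib gr (grng gr x0)) h.
  by rewrite /conv; apply: eq_cint => y ry; rewrite hk.
have H1 : cabs (conv gr lambda a b x - cint (lambda (grng gr x)) (rfib gr (grng gr x)) h) <=
    d * M x.
  apply: (@le_trans _ _ (Rintegral (lambda (grng gr x)) (rfib gr (grng gr x))
      (fun y => d * phi y))).
    apply: cint_sub_le.
    - exact: gunits_rng.
    - exact: conv_fiber.
    - exact: Cc_fiber.
    - apply: Cc_fiber; have := CcZ (real_complex R d) Cphi.
      by under eq_fun do rewrite -rmorphM.
    - move=> y ry; have [Ky|nKy] := pselect (K y).
        by rewrite phiK// mulr1 ltW//; exact: HK.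
      have na : a y = 0 by apply: fsupp_eq0 => ay; apply: nKy; left.
      have nh : h y = 0 by apply: fsupp_eq0 => hy; apply: nKy; right.
      rewrite na nh mul0r subrr cabs0; apply: mulr_ge0; first exact: ltW.
      by have /andP[] := phi01 y.
  rewrite RintegralZl//; first exact: rfib_borel.
  exact: (Cc_integrable (gunits_rng gr x) Cphi).1.
have dM : d * M x < e / 2.
  apply: (@lt_le_trans _ _ (d * (M x0 + 1))); first by rewrite ltr_pM2l.
  by rewrite /d divfK// gt_eqF// ltr_wpDl.
rewrite E0; set z := cint _ _ _ in Hh *; set w := cint _ _ _ in Hh H1.
have -> : z - conv gr lambda a b x = (z - w) + (w - conv gr lambda a b x).
  by rewrite addrA subrK.
apply: le_lt_trans (cabsD _ _) _; rewrite [e]splitr; apply: ltrD => //.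
apply: le_lt_trans dM; apply: le_trans H1.
by rewrite cabsC.
Qed.

(** The points where the convolution is nonzero lie in the product of the two supports: the image
    under multiplication of a compact set of composable pairs. *)
Lemma Cc_conv a b : Cc a -> Cc b -> Cc (conv gr lambda a b).
Proof.
move=> Ca Cb.
pose D := [set p : G * G | gsrc gr p.1 = grng gr p.2].
pose P := (fsupp a `*` fsupp b) `&` D.
have clD : closed D.
  apply: closed_eq_fun => //.
    by apply: continuous_fst_comp; exact: gsrc_continuous.
  by apply: continuous_snd_comp; exact: grng_continuous.
have cP : compact P.
  apply: (subclosed_compact _ (compact_setX Ca.2 Cb.2)); last by move=> p [].
  apply: closedI => //; rewrite (_ : _ `*` _ = fst @^-1` fsupp a `&` snd @^-1` fsupp b)//.
  apply: closedI.
    by apply: (continuous_closedP _).1; [exact: fst_continuous_pair|exact: closed_closure].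
  by apply: (continuous_closedP _).1; [exact: snd_continuous_pair|exact: closed_closure].
have cgP : compact ((fun p : G * G => gmul gr p.1 p.2) @` P).
  apply: continuous_compact => //.
  by apply: continuous_subspaceW (@gmul_continuous _ gr) => p [].
apply: (Cc_sub (conv_continuous Ca Cb) _ cgP); first exact: compact_closed.
move=> x /conv_neq0[y [yx /fsupp_neq0 ay /fsupp_neq0 bx]].
exists (y, gmul gr (ginv gr y) x); last by rewrite /= gmulKV.
by split=> //=; rewrite /D /= grng_mul ?gsrc_inv// grng_inv.
Qed.

End haar.

(** * Algebra and fibre integrals of convolutions *)

Lemma cabs_dist (R : realType) (k l : R[i]) : `|cabs k - cabs l| <= cabs (k - l).
Proof.
have H (z w : R[i]) : cabs z - cabs w <= cabs (z - w).
  by rewrite lerBlDr; apply: le_trans (cabsD _ _); rewrite subrK.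
by rewrite ler_norml H andbT lerNl opprB cabsC H.
Qed.

Section sigma_finite_copy.
Context d (X : measurableType d) (R : realType)
  (mu : {measure set X -> \bar R}) (sf : sigma_finite setT mu).

(* Fubini's theorem needs sigma-finiteness as a structure on the measure, while
   it holds here for [lambda u] only when u is a unit. *)
Definition sigma_finite_copy of sigma_finite setT mu : set X -> \bar R := mu.

HB.instance Definition _ := Measure.copy (sigma_finite_copy sf) mu.
HB.instance Definition _ :=
  Measure_isSigmaFinite.Build d X R (sigma_finite_copy sf) sf.

End sigma_finite_copy.

Import HBNNSimple.

(* No measurability is assumed, because that of a * h is not known for h in L^2;
   the integral is the supremum over the simple functions below. *)
Lemma le_integral_ge0 d (X : measurableType d) (R : realType)
    (mu : {measure set X -> \bar R}) (D : set X) (f g : X -> \bar R) :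
  (forall x, D x -> (0 <= f x)%E) -> (forall x, D x -> (f x <= g x)%E) ->
  (\int[mu]_(x in D) f x <= \int[mu]_(x in D) g x)%E.
Proof.
move=> f0 fg.
have fD0 x : (0 <= (f \_ D) x)%E by apply: erestrict_ge0.
have fgD x : ((f \_ D) x <= (g \_ D) x)%E.
  by rewrite !patchE; case: ifPn => // /set_mem; exact: fg.
rewrite [leLHS]integral_mkcond [leRHS]integral_mkcond.
rewrite !ge0_integralTE//; last by move=> x; exact: le_trans (fD0 x) (fgD x).
apply: ereal_sup_le => _ [h hf <-].
exists h => // x; exact: le_trans (hf x) (fgD x).
Qed.

Section haar_norm.
Variables (R : realType) (G : ptopologicalType) (gr : topGroupoid G)
  (lambda : G -> {measure set (borel G) -> \bar R}).
Hypothesis G_second_countable : @second_countable G.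
Hypothesis G_locally_compact : locally_compact [set: G].
Hypothesis G_hausdorff : hausdorff_space G.
Hypothesis lambda_haar : haar_system gr lambda.
Implicit Types a b f : G -> R[i].

Let mr u : measurable (rfib gr u : set (borel G)).
Proof. exact: rfib_borel. Qed.

Lemma conv_integrable a b x : Cc a -> Cc b ->
  cintegrable (lambda (grng gr x)) (rfib gr (grng gr x))
    (fun y => a y * b (gmul gr (ginv gr y) x)).
Proof.
move=> Ca Cb; apply: (fiber_Cc_integrable G_hausdorff lambda_haar); first exact: gunits_rng.
exact: conv_fiber.
Qed.

Lemma conv_linl k a a' b : Cc a -> Cc a' -> Cc b ->
  conv gr lambda (fun x => k * a x + a' x) b =
  fun x => k * conv gr lambda a b x + conv gr lambda a' b x.
Proof.
move=> Ca Ca' Cb; apply/funext => x; rewrite /conv -cint_lin//.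
- by apply: eq_cint => y _; rewrite mulrDl mulrA.
- exact: conv_integrable.
- exact: conv_integrable.
Qed.

Lemma conv_linr k a b b' : Cc a -> Cc b -> Cc b' ->
  conv gr lambda a (fun x => k * b x + b' x) =
  fun x => k * conv gr lambda a b x + conv gr lambda a b' x.
Proof.
move=> Ca Cb Cb'; apply/funext => x; rewrite /conv -cint_lin//.
- by apply: eq_cint => y _; rewrite mulrDr mulrCA.
- exact: conv_integrable.
- exact: conv_integrable.
Qed.

Lemma conv_sumr (I : Type) (s : seq I) (F : I -> G -> R[i]) a :
  (forall i, Cc (F i)) -> Cc a ->
  conv gr lambda a (fun x => \sum_(i <- s) F i x) =
  fun x => \sum_(i <- s) conv gr lambda a (F i) x.
Proof.
move=> CF Cb; elim: s => [|i s IH].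
  apply/funext => x; rewrite big_nil /conv -[RHS](cint0 (lambda (grng gr x)) (rfib gr (grng gr x))).
  by apply: eq_cint => y _; rewrite big_nil mulr0.
apply/funext => x; rewrite big_cons.
have /= <- := congr1 (fun h => h x) IH.
have := @conv_linr 1 a (F i) (fun x => \sum_(i <- s) F i x) Cb (CF i) (Cc_sum s CF).
move=> /(congr1 (fun h => h x)); rewrite mul1r => <-.
by congr (conv gr lambda a _ x); apply/funext => y; rewrite big_cons mul1r.
Qed.

(* The Haar system is invariant on C_c(G) by definition; a function on a single
   fibre is the restriction of an element of C_c(G). *)
Lemma fiber_invariant (f : G -> R[i]) x : fiber_Cc gr (grng gr x) f ->
  cint (lambda (gsrc gr x)) (rfib gr (gsrc gr x)) (fun y => f (gmul gr x y)) =
  cint (lambda (grng gr x)) (rfib gr (grng gr x)) f.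
Proof.
move=> /(fiber_Cc_ext G_locally_compact G_hausdorff)[h Ch hf].
transitivity (cint (lambda (grng gr x)) (rfib gr (grng gr x)) h); last first.
  by apply: eq_cint => y; exact: hf.
rewrite -(haar_invariant lambda_haar x Ch); apply: eq_cint => y ry.
by rewrite hf// /rfib /= grng_mul//.
Qed.

(** The substitution $z=xy$, allowed by left invariance, carries the fibre over $s(x)$, where $a*b$
    is evaluated at $x^{-1}$, to the fibre over $r(x)$. *)
Lemma invol_conv a b : Cc a -> Cc b ->
  invol gr (conv gr lambda a b) = conv gr lambda (invol gr b) (invol gr a).
Proof.
move=> Ca Cb; apply/funext => x; rewrite /invol.
have Cb' : Cc (invol gr b) by exact: Cc_invol.
have Ca' : Cc (invol gr a) by exact: Cc_invol.
apply: (canLR (@conjCK R[i])); rewrite /conv -cint_conj; last 2 first.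
- exact: mr.
- exact: (conv_integrable x Cb' Ca').
rewrite grng_inv; transitivity (cint (lambda (gsrc gr x)) (rfib gr (gsrc gr x))
   (fun y => Num.conj (invol gr b (gmul gr x y) * invol gr a (gmul gr (ginv gr (gmul gr x y)) x)))).
  apply: eq_cint => y ry.
  have conjM z w : Num.conj (Num.conj z * Num.conj w) = z * w :> R[i].
    by rewrite -rmorphM conjCK.
  rewrite /invol conjM mulrC.
  have ry' : grng gr y = gsrc gr x by [].
  rewrite ginv_mul// -gmulA ?grng_inv ?gsrc_inv//.
  by rewrite gmulVx -ry' -(gsrc_inv gr y) gmul_src ginvK.
apply: (@fiber_invariant (fun z => Num.conj (invol gr b z * invol gr a (gmul gr (ginv gr z) x)))).
have [cf [K [cK clK fK]]] := @conv_fiber R G gr _ _ x Cb' Ca'.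
split; last by exists K; split=> // y ry nKy; rewrite fK// rmorph0.
apply/complex_within => y ry e e0.
have /complex_within/(_ y ry e e0) := cf.
by apply: (@filterS _ (nbhs y)) => z H rz; rewrite -rmorphB cabs_conj; exact: H.
Qed.

(** Kept complex-valued so that absolute values can themselves be convolved within $C_c(G)$. *)
Definition absf f : G -> R[i] := fun x => real_complex R (cabs (f x)).

Lemma Cc_absf f : Cc f -> Cc (absf f).
Proof.
move=> Cf; apply: (@Cc_comb R G _ _ _ _ Cf Cf); last first.
  by move=> x fx _; rewrite /absf fx cabs0.
apply/complex_continuousP => x e e0.
have := (complex_continuousP _).1 Cf.1 x e e0; apply: filterS => y.
apply: le_lt_trans; rewrite /absf -rmorphB cabs_real.
exact: cabs_dist.
Qed.

Definition fiber_L1 u f : R := Rintegral (lambda u) (rfib gr u) (fun x => cabs (f x)).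

Lemma cint_absf u f : cint (lambda u) (rfib gr u) (absf f) = real_complex R (fiber_L1 u f).
Proof. exact: cint_real. Qed.

Lemma cabs_integrable u f : gunits gr u -> Cc f ->
  (lambda u).-integrable (rfib gr u : set (borel G)) (fun x => (cabs (f x))%:E).
Proof.
by move=> u1 Cf; apply: cintegrable_cabs; [exact: mr|exact: Cc_integrable].
Qed.

Lemma fiber_L1E u f : gunits gr u -> Cc f ->
  (fiber_L1 u f)%:E = (\int[lambda u]_(x in rfib gr u) (cabs (f x))%:E)%E.
Proof.
move=> u1 Cf; rewrite /fiber_L1 /Rintegral fineK//.
by apply: integrable_fin_num; [exact: mr|exact: cabs_integrable].
Qed.

Lemma fiber_L1_ge0 u f : 0 <= fiber_L1 u f.
Proof. by apply: Rintegral_ge0 => x _; exact: cabs_ge0. Qed.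

Lemma le_fiber_L1 u f g : gunits gr u -> Cc f -> Cc g ->
  (forall x, rfib gr u x -> cabs (f x) <= cabs (g x)) -> fiber_L1 u f <= fiber_L1 u g.
Proof.
move=> u1 Cf Cg fg; apply: le_Rintegral; [exact: mr|exact: cabs_integrable|exact: cabs_integrable|].
by move=> x; exact: fg.
Qed.

Lemma fiber_L1_sum (I : Type) (s : seq I) (F : I -> G -> R[i]) u : gunits gr u ->
  (forall i, Cc (F i)) ->
  fiber_L1 u (fun x => \sum_(i <- s) absf (F i) x) = \sum_(i <- s) fiber_L1 u (F i).
Proof.
move=> u1 CF; elim: s => [|i s IH].
  rewrite big_nil /fiber_L1 /Rintegral (eq_integral (fun=> 0%E)) ?integral0//.
  by move=> x _; rewrite big_nil cabs0.
have CS : Cc (fun x => \sum_(i <- s) absf (F i) x) by apply: Cc_sum => j; exact: Cc_absf.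
rewrite big_cons -IH -RintegralD; [|exact: mr|exact: cabs_integrable|exact: cabs_integrable].
apply: eq_Rintegral => x _; rewrite big_cons.
suff [r r0 ->] : exists2 r, 0 <= r & \sum_(i <- s) absf (F i) x = real_complex R r.
  by rewrite /absf -rmorphD !cabs_real !ger0_norm// addr_ge0// cabs_ge0.
exists (\sum_(i <- s) cabs (F i x)); last by rewrite rmorph_sum.
by apply: sumr_ge0 => j _; exact: cabs_ge0.
Qed.

Lemma fiber_L1_sum_le (I : Type) (s : seq I) (F : I -> G -> R[i]) u : gunits gr u ->
  (forall i, Cc (F i)) ->
  fiber_L1 u (fun x => \sum_(i <- s) F i x) <= \sum_(i <- s) fiber_L1 u (F i).
Proof.
move=> u1 CF; rewrite -fiber_L1_sum//; apply: le_fiber_L1 => //; first exact: Cc_sum.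
  by apply: Cc_sum => i; exact: Cc_absf.
move=> x _; rewrite /absf -rmorph_sum /= cabs_real ger0_norm; last first.
  by apply: sumr_ge0 => j _; exact: cabs_ge0.
elim: s => [|i s IH]; first by rewrite !big_nil cabs0.
by rewrite !big_cons; apply: le_trans (cabsD _ _) _; rewrite lerD2l.
Qed.

Lemma translate_fiber b y : Cc b ->
  fiber_Cc gr (grng gr y) (fun x => b (gmul gr (ginv gr y) x)).
Proof.
move=> Cb; have cty : {within rfib gr (grng gr y), continuous (gmul gr (ginv gr y))}.
  apply: (@gmul_within G gr G _ (fun=> ginv gr y) id).
  - by apply: continuous_subspaceT => x; exact: cvg_cst.
  - by apply: continuous_subspaceT => x; exact: cvg_id.
  - by move=> x rx; rewrite gsrc_inv.
split; first by apply: (@within_comp_continuous _ G R[i]^o _ _ b); [exact: cty|exact: Cb.1].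
have cK : compact (fsupp b `&` rfib gr (gsrc gr y)).
  apply: (subclosed_compact _ Cb.2); last by move=> z [].
  by apply: closedI; [exact: closed_closure|exact: closed_rfib].
have cyK : compact (gmul gr y @` (fsupp b `&` rfib gr (gsrc gr y))).
  apply: continuous_compact => //; apply: (@gmul_within G gr G _ (fun=> y) id).
  - by apply: continuous_subspaceT => x; exact: cvg_cst.
  - by apply: continuous_subspaceT => x; exact: cvg_id.
  - by move=> x [_ rx].
eexists; split; [exact: cyK|exact: compact_closed|].
move=> x rx nx; apply: fsupp_eq0 => bx; apply: nx.
exists (gmul gr (ginv gr y) x); last by rewrite gmulKV.
by split=> //; rewrite /rfib /= grng_mul ?gsrc_inv// grng_inv.
Qed.

Lemma cabs_conv_le a b x : Cc a -> Cc b ->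
  ((cabs (conv gr lambda a b x))%:E <=
  \int[lambda (grng gr x)]_(y in rfib gr (grng gr x))
     (cabs (a y) * cabs (b (gmul gr (ginv gr y) x)))%:E)%E.
Proof.
move=> Ca Cb; have := cabs_cint_le (@mr (grng gr x)) (conv_integrable x Ca Cb).
by under eq_integral do rewrite cabsM.
Qed.

(** Passing to nonnegative functions lets sums of norms be computed later as the norm of a sum. *)
Lemma cabs_conv_absf a b x : Cc a -> Cc b ->
  cabs (conv gr lambda a b x) <= cabs (conv gr lambda (absf a) (absf b) x).
Proof.
move=> Ca Cb; rewrite -lee_fin; apply: le_trans (cabs_conv_le x Ca Cb) _.
have Cna := Cc_absf Ca; have Cnb := Cc_absf Cb.
have [Ir _] := conv_integrable x Cna Cnb.
have -> : conv gr lambda (absf a) (absf b) x = real_complex R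
   (Rintegral (lambda (grng gr x)) (rfib gr (grng gr x))
     (fun y => cabs (a y) * cabs (b (gmul gr (ginv gr y) x)))).
  by rewrite -cint_real; apply: eq_cint => y _; rewrite /absf -rmorphM.
rewrite cabs_real ger0_norm; last first.
  by apply: Rintegral_ge0 => y _; rewrite mulr_ge0 ?cabs_ge0.
rewrite /Rintegral fineK//; apply: integrable_fin_num; first exact: mr.
by apply: eq_integrable Ir => // y _; rewrite /absf -rmorphM.
Qed.

(** Extension by zero off the square of the fibre reduces this to Tonelli's theorem on the whole
    product; [u] being a unit supplies sigma-finiteness. *)
Lemma fiber_tonelli u (psi : G * G -> R) : gunits gr u ->
  {within rfib gr u `*` rfib gr u, continuous psi} -> (forall p, 0 <= psi p) ->
  (\int[lambda u]_(x in rfib gr u) \int[lambda u]_(y in rfib gr u) (psi (y, x))%:E =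
   \int[lambda u]_(y in rfib gr u) \int[lambda u]_(x in rfib gr u) (psi (y, x))%:E)%E.
Proof.
move=> u1 cpsi psi0.
pose F : set (borel G) := rfib gr u.
have mFF : measurable (F `*` F : set (borel G * borel G)) by apply: measurableX; exact: mr.
have mpsi : measurable_fun (F `*` F) (EFin \o psi : borel G * borel G -> \bar R).
  apply/measurable_EFinP.
  exact: (@within_measurableX R G G_second_countable (F `*` F) psi mFF cpsi).
have mPhi := (measurable_restrictT _ mFF).1 mpsi.
have Phi0 p : (0 <= ((EFin \o psi) \_ (F `*` F)) p)%E.
  by apply: erestrict_ge0 => q _; rewrite lee_fin; exact: psi0.
have sf := radon_sigma_finite G_second_countable G_hausdorff G_locally_compact
  (haar_finite lambda_haar u1).
have := @fubini_tonelli _ _ (borel G) (borel G) R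
  (sigma_finite_copy sf) (sigma_finite_copy sf) _ mPhi Phi0.
clear mPhi mpsi Phi0 => tonelli.
rewrite integral_mkcond [RHS]integral_mkcond.
transitivity (\int[lambda u]_x \int[lambda u]_y ((EFin \o psi) \_ (F `*` F)) (y, x))%E.
  apply: eq_integral => x _; rewrite patchE; case: ifPn => [/set_mem Fx|nFx].
    rewrite integral_mkcond; apply: eq_integral => y _; rewrite !patchE.
    case: ifPn => [/set_mem Fy|nFy]; first by rewrite ifT ?inE.
    by rewrite ifF//; apply/negP => /set_mem[/mem_set Fy _]; rewrite Fy in nFy.
  rewrite (eq_integral (fun=> 0%E)) ?integral0// => y _.
  by rewrite patchE ifF//; apply/negP => /set_mem[_ /mem_set Fx]; rewrite Fx in nFx.
rewrite -[LHS]tonelli; clear tonelli.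
apply: eq_integral => y _; rewrite patchE; case: ifPn => [/set_mem Fy|nFy].
  rewrite [RHS]integral_mkcond; apply: eq_integral => x _; rewrite !patchE.
  case: ifPn => [/set_mem[_ /= Fx]|nF]; first by rewrite mem_set.
  case: ifPn => // /set_mem Fx; exfalso; move/negP: nF; apply.
  by rewrite inE.
rewrite (eq_integral (fun=> 0%E)) ?integral0// => x _.
by rewrite patchE ifF//; apply/negP => /set_mem[/mem_set Fy _]; rewrite Fy in nFy.
Qed.

(** After Tonelli the inner integral of $|b(y^{-1}x)|$ over $x$ becomes, by left invariance, that of
    $|b|$ over the fibre at $s(y)$. Hence [b] must be bounded at all units and [a] only at [u]. *)
Lemma fiber_L1_conv u a b (L : R) : gunits gr u -> Cc a -> Cc b ->
  (forall v, gunits gr v -> fiber_L1 v b <= L) ->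
  fiber_L1 u (conv gr lambda a b) <= L * fiber_L1 u a.
Proof.
move=> u1 Ca Cb bL; have Cab := Cc_conv G_locally_compact G_hausdorff lambda_haar Ca Cb.
have ab0 y x : 0 <= cabs (a y) * cabs (b (gmul gr (ginv gr y) x)).
  by rewrite mulr_ge0 ?cabs_ge0.
rewrite -lee_fin EFinM !fiber_L1E//.
apply: (@le_trans _ _ (\int[lambda u]_(x in rfib gr u) \int[lambda u]_(y in rfib gr u)
    (cabs (a y) * cabs (b (gmul gr (ginv gr y) x)))%:E)%E).
  apply: le_integral_ge0 => x rx; first by rewrite lee_fin cabs_ge0.
  have ru : grng gr x = u by [].
  by have := cabs_conv_le x Ca Cb; rewrite ru.
rewrite (@fiber_tonelli u (fun p => cabs (a p.1) * cabs (b (gmul gr (ginv gr p.1) p.2))))//.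
- have -> : (L%:E * \int[lambda u]_(x in rfib gr u) (cabs (a x))%:E =
      \int[lambda u]_(x in rfib gr u) (L%:E * (cabs (a x))%:E))%E.
    by rewrite integralZl//; exact: cabs_integrable.
  apply: le_integral_ge0 => y ry; first by apply: integral_ge0 => x _; rewrite lee_fin.
  have ru : grng gr y = u by [].
  have Iby : (lambda u).-integrable (rfib gr u : set (borel G))
      (fun x => (cabs (b (gmul gr (ginv gr y) x)))%:E).
    apply: cintegrable_cabs; first exact: mr.
    apply: (fiber_Cc_integrable G_hausdorff lambda_haar u1).
    by rewrite -ru; exact: translate_fiber.
  have inv : (\int[lambda u]_(x in rfib gr u) (cabs (b (gmul gr (ginv gr y) x)))%:E =
      (fiber_L1 (gsrc gr y) b)%:E)%E.
    have := haar_invariant lambda_haar (ginv gr y) (Cc_absf Cb).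
    rewrite gsrc_inv grng_inv ru cint_absf /absf cint_real => /complexI <-.
    by rewrite /Rintegral fineK//; apply: integrable_fin_num; [exact: mr|exact: Iby].
  apply: (@le_trans _ _ ((cabs (a y))%:E * (fiber_L1 (gsrc gr y) b)%:E)%E).
    rewrite -inv -ge0_integralZl//.
    - exact: measurable_int Iby.
    - by move=> x _; rewrite lee_fin cabs_ge0.
    - by rewrite lee_fin cabs_ge0.
  rewrite -EFinM -EFinM lee_fin mulrC; apply: ler_wpM2r; first exact: cabs_ge0.
  by apply: bL; exact: gunits_src.
- have FS : rfib gr u `*` rfib gr u `<=` [set p : G * G | grng gr p.1 = grng gr p.2].
    by move=> [y z] /= [ry rz]; rewrite ry rz.
  have cP := continuous_subspaceW FS (@conv_integrand_pair R G gr a b Ca Cb).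
  apply/subspace_continuousP => p Fp; apply/(@cvgrPdist_lt R R^o) => e e0.
  have /complex_within/(_ p Fp e e0) := cP.
  apply: (@filterS _ (nbhs p)) => q H Fq; apply: le_lt_trans (H Fq).
  by rewrite /from_subspace -!cabsM cabs_dist.
Qed.

End haar_norm.

(** * The reduced norm *)

Section nonmeasurable_integral.
Local Open Scope ereal_scope.
Context d (X : measurableType d) (R : realType) (mu : {measure set X -> \bar R}).
Implicit Types (D : set X) (f g : X -> \bar R).

Lemma subset_integral_ge0 (A B : set X) f : (forall x, B x -> 0 <= f x) -> A `<=` B ->
  \int[mu]_(x in A) f x <= \int[mu]_(x in B) f x.
Proof.
move=> f0 AB; rewrite integral_mkcond [leRHS]integral_mkcond.
apply: le_integral_ge0 => x _; rewrite !patchE.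
  by case: ifPn => // /set_mem/AB; exact: f0.
case: ifPn => [/set_mem/AB/mem_set -> //|_].
by case: ifPn => // /set_mem; exact: f0.
Qed.

(** A simple function below [f] on the union is measurable, so it can be cut along the pieces, and
    each part stays below [f] there; then take the supremum. *)
Lemma integral_bigcup_le (F : nat -> set X) f :
  (forall k, measurable (F k)) -> trivIset setT F ->
  (forall x, (\bigcup_k F k) x -> 0 <= f x) ->
  \int[mu]_(x in \bigcup_k F k) f x <= \sum_(k <oo) \int[mu]_(x in F k) f x.
Proof.
move=> mF tF f0; set D := \bigcup_k F k.
have fD0 x : 0 <= (f \_ D) x by apply: erestrict_ge0.
rewrite [leLHS]integral_mkcond ge0_integralTE//; apply: ge_ereal_sup => _ [h hf <-].
have hD : (fun x => (h x)%:E) \_ D = (fun x => (h x)%:E).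
  apply/funext => x; rewrite patchE; case: ifPn => // nDx; apply/eqP.
  have := hf x; rewrite patchE (negbTE nDx) => hx.
  by rewrite eq_le hx lee_fin andbT.
rewrite -integralT_nnsfun -hD -integral_mkcond ge0_integral_bigcup//; last 2 first.
- by apply: measurable_funTS; exact/measurable_EFinP.
- by move=> x _; rewrite lee_fin.
apply: lee_nneseries => [k _ _|k _]; first by apply: integral_ge0 => x _; rewrite lee_fin.
apply: le_integral_ge0 => x Fx; first by rewrite lee_fin.
have Dx : D x by exists k.
by have := hf x; rewrite patchE mem_set.
Qed.

(** Scaling a simple function below [g] gives one below the scaled [g], which is one inequality; the
    other is the same statement for $s^{-1}$. *)
Lemma integral_scale_ge0 D f (s : R) : (0 < s)%R -> (forall x, D x -> 0 <= f x) ->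
  \int[mu]_(x in D) (s%:E * f x) = s%:E * \int[mu]_(x in D) f x.
Proof.
have H (t : R) (g : X -> \bar R) : (0 < t)%R -> (forall x, D x -> 0 <= g x) ->
    t%:E * \int[mu]_(x in D) g x <= \int[mu]_(x in D) (t%:E * g x).
  move=> t0 g0.
  have gD0 x : 0 <= (g \_ D) x by apply: erestrict_ge0.
  have tgD0 x : 0 <= ((fun x => t%:E * g x) \_ D) x.
    by apply: erestrict_ge0 => y Dy; apply: mule_ge0; [rewrite lee_fin ltW|exact: g0].
  rewrite muleC -lee_pdivlMr// [leLHS]integral_mkcond ge0_integralTE//.
  apply: ge_ereal_sup => _ [h hg <-].
  rewrite lee_pdivlMr// muleC -sintegralrM [leRHS]integral_mkcond ge0_integralTE//.
  apply: ereal_sup_ubound; exists (scale_nnsfun h (ltW t0)) => //= x.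
  have := hg x; rewrite !patchE; case: ifPn => _ hx.
    by rewrite EFinM lee_pmul2l.
  have -> : h x = 0%R by apply/eqP; rewrite eq_le -lee_fin hx /=.
  by rewrite mulr0.
move=> s0 f0; apply/eqP; rewrite eq_le H// andbT.
have s'0 : (0 < s^-1)%R by rewrite invr_gt0.
have sf0 x : D x -> 0 <= s%:E * f x by move=> Dx; apply: mule_ge0; [rewrite lee_fin ltW|exact: f0].
have := H s^-1%R _ s'0 sf0.
rewrite [leRHS](eq_integral f); last first.
  by move=> x _; rewrite muleA -EFinM mulVf ?mul1e// gt_eqF.
by rewrite muleC lee_pdivrMr// muleC.
Qed.

Lemma integral_scale D f (s : R) : (0 < s)%R ->
  \int[mu]_(x in D) (s%:E * f x) = s%:E * \int[mu]_(x in D) f x.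
Proof.
move=> s0; rewrite integralE [in RHS]integralE ge0_funeposM ?ltW// ge0_funenegM ?ltW//.
rewrite !integral_scale_ge0//.
have : 0 <= \int[mu]_(x in D) f^\+ x by apply: integral_ge0 => x _; exact: funepos_ge0.
have : 0 <= \int[mu]_(x in D) f^\- x by apply: integral_ge0 => x _; exact: funeneg_ge0.
case: (\int[mu]_(x in D) f^\- x) => [r| |]//; case: (\int[mu]_(x in D) f^\+ x) => [r'| |]// _ _.
- by rewrite -!EFinM -!EFinB mulrBr.
- by rewrite gt0_muley ?lte_fin// addye// gt0_muley ?lte_fin.
- by rewrite gt0_muley ?lte_fin// !addeNy gt0_muleNy ?lte_fin.
- by rewrite gt0_muley ?lte_fin// !addeNy gt0_muleNy ?lte_fin.
Qed.

End nonmeasurable_integral.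

(** Needed to normalise $h$ in $L^2$ when the integrand of $f*h$ is not known to be integrable. If
    the integral of a real or imaginary part is infinite, [Rintegral] reads it as 0 on both
    sides. *)
Lemma cint_scale (R : realType) (T : ptopologicalType)
    (mu : {measure set (borel T) -> \bar R}) (D : set T) (f : T -> R[i]) (s : R) :
  0 < s -> cint mu D (fun x => real_complex R s * f x) = real_complex R s * cint mu D f.
Proof.
move=> s0; have H (g : T -> R) : Rintegral mu D (fun x => s * g x) = s * Rintegral mu D g.
  rewrite /Rintegral; under eq_integral do rewrite EFinM.
  rewrite integral_scale//; case: integral => [r| |]//=.
    by rewrite gt0_muley ?lte_fin// mulr0.
  by rewrite gt0_muleNy ?lte_fin// mulr0.
rewrite /cint; have -> : Rintegral mu D (fun x => complex.Re (real_complex R s * f x)) =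
    s * Rintegral mu D (fun x => complex.Re (f x)).
  by rewrite -H; apply: eq_Rintegral => x _; case: (f x) => a b /=; rewrite mul0r subr0.
have -> : Rintegral mu D (fun x => complex.Im (real_complex R s * f x)) =
    s * Rintegral mu D (fun x => complex.Im (f x)).
  by rewrite -H; apply: eq_Rintegral => x _; case: (f x) => a b /=; rewrite mul0r addr0.
by rewrite /GRing.mul /= !mul0r subr0 addr0.
Qed.

(** * Restriction to $G_e$ in the regular representations *)

Section reduced.
Variables (R : realType) (G : ptopologicalType) (gr : topGroupoid G)
  (lambda : G -> {measure set (borel G) -> \bar R}) (Gam : groupType) (c : G -> Gam).
Hypothesis G_second_countable : @second_countable G.
Hypothesis G_hausdorff : hausdorff_space G.
Hypothesis c_continuous : continuous (c : G -> discrete_topology Gam).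
Hypothesis c_hom : forall x y, gsrc gr x = grng gr y ->
  c (gmul gr x y) = (c x * c y)%g.

Lemma ginv_measurable : measurable_fun (setT : set (borel G)) (ginv gr : borel G -> borel G).
Proof.
apply: (@measurability _ _ (borel G) (borel G) setT (ginv gr) (@open G) erefl).
move=> _ [U oU <-]; rewrite setTI; apply: open_borel.
by apply: (open_comp (f := ginv gr)) => // x _; exact: ginv_continuous.
Qed.

(** [haar_src] is a bare set function; replacing it by an equal bundled measure gives access to
    integration theory. *)
Lemma haar_src_measure u : exists nu : {measure set (borel G) -> \bar R},
  (nu : set (borel G) -> \bar R) = haar_src gr lambda u.
Proof.
by exists (measure_function_pushforward__canonical__measure_function_Measure
  (lambda u) ginv_measurable).
Qed.

(** Every attained grade has an open preimage, which contains a nonempty basic open set; the grade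
    of a point chosen in that set recovers the given grade, so the countable base maps onto the
    range of [c]. *)
Lemma countable_grades : exists e : Gam -> nat, {in range c &, injective e}.
Proof.
apply/countable_injP; have [B cB [oB Bx]] := G_second_countable.
have /choice[p Hp] : forall V : set G, exists x, V !=set0 -> V x.
  by move=> V; have [[x Vx]|nV] := pselect (V !=set0); [exists x|exists point].
apply: (@sub_countable _ _ _ ((c \o p) @` B)); last exact: sub_countable (card_image_le _ _) cB.
apply: subset_card_le => _ [x _ <-].
have nx : nbhs x (c @^-1` [set c x]).
  by apply: open_nbhs_nbhs; split => //; exact: open_grade.
have [V [BV Vx] VU] := Bx x _ nx.
exists V => //; have Vp : V (p V) by apply: Hp; exists x.
exact: VU Vp.
Qed.

(* [e] enumerates the values of c. *)
Lemma conv_restrict (e : Gam -> nat) (f h : G -> R[i]) k x :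
  {in range c &, injective e} -> e (c x) = k ->
  conv gr lambda (restrict_fun (c @^-1` [set 1%g]) f) h x =
  conv gr lambda f (restrict_fun (c @^-1` (e @^-1` [set k])) h) x.
Proof.
move=> einj ek; apply: eq_cint => y ry.
have cyx : c (gmul gr (ginv gr y) x) = ((c y)^-1 * c x)%g by rewrite (c_div c_hom).
(* Since $c(y^{-1}x)=c(y)^{-1}c(x)$, the second factor has the grade of [x] exactly when $c(y)$ is
   the identity. *)
have [cy|cy] := pselect (c y = 1%g).
  by rewrite !restrict_fun_in//= cyx cy invg1 mul1g.
rewrite restrict_fun_out// mul0r restrict_fun_out ?mulr0//= -ek cyx => ee.
have H : ((c y)^-1 * c x)%g = c x.
  apply: einj => //; rewrite inE; last by exists x.
  by exists (gmul gr (ginv gr y) x).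
apply: cy; apply: (mulgI (c y)^-1%g); rewrite mulVg mulg1.
by apply: (mulIg (c x)); rewrite mul1g H.
Qed.

Lemma conv_scale (f h : G -> R[i]) (s : R) x : 0 < s ->
  conv gr lambda f (fun y => real_complex R s * h y) x =
  real_complex R s * conv gr lambda f h x.
Proof.
move=> s0; rewrite /conv -cint_scale//; apply: eq_cint => y _.
by rewrite mulrCA.
Qed.

Definition sqint u (h : G -> R[i]) : \bar R :=
  (\int[haar_src gr lambda u]_(x in sfib gr u) (cabs (h x) ^+ 2)%:E)%E.

Lemma sqint_ge0 u h : (0 <= sqint u h)%E.
Proof.
rewrite /sqint; have [nu <-] := haar_src_measure u.
by apply: integral_ge0 => x _; rewrite lee_fin sqr_ge0.
Qed.

Lemma sqint_scale u h (s : R) : 0 < s ->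
  (sqint u (fun x => (real_complex R s * h x)%R) = (s ^+ 2)%:E * sqint u h)%E.
Proof.
move=> s0; rewrite /sqint; have [nu <-] := haar_src_measure u.
rewrite -integral_scale ?exprn_gt0//; apply: eq_integral => x _.
by rewrite cabsM cabs_real gtr0_norm// exprMn EFinM.
Qed.

Lemma sqrte_le (x : \bar R) (y : R) : (0 <= x)%E -> (0 <= y)%R ->
  (sqrte x <= y%:E)%E = (x <= (y ^+ 2)%:E)%E.
Proof.
move=> x0 y0; rewrite -(@lee_sqrt _ x); last by rewrite lee_fin sqr_ge0.
by congr (_ <= _)%E; rewrite /= sqrtr_sqr ger0_norm.
Qed.

Lemma L2_scale u h (s : R) : 0 < s -> L2 gr lambda u h ->
  L2 gr lambda u (fun x => real_complex R s * h x).
Proof.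
move=> s0 [mr mi hoo]; split.
- rewrite (_ : (fun x => _) = (fun x => s * complex.Re (h x))).
    by apply: measurable_funM => //; exact: measurable_cst.
  by apply/funext => x; case: (h x) => a b /=; rewrite mul0r subr0.
- rewrite (_ : (fun x => _) = (fun x => s * complex.Im (h x))).
    by apply: measurable_funM => //; exact: measurable_cst.
  by apply/funext => x; case: (h x) => a b /=; rewrite mul0r addr0.
- move: hoo; rewrite /L2norm -!/(sqint _ _) sqint_scale//.
  have := sqint_ge0 u h; case: (sqint u h) => // r _ _.
  by rewrite -EFinM /= ltry.
Qed.

Lemma regular_bound u f (n : R) h : 0 <= n ->
  (regular_norm gr lambda u f <= n%:E)%E -> L2 gr lambda u h ->
  (sqint u (conv gr lambda f h) <= (n ^+ 2)%:E * sqint u h)%E.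
Proof.
move=> n0 fn Lh.
have hfin : sqint u h \is a fin_num.
  have [_ _ hoo] := Lh; rewrite -(sqrte_fin_num (sqint_ge0 u h)).
  by rewrite ge0_fin_numE ?sqrte_ge0.
pose t := fine (sqint u h).
have tE : sqint u h = t%:E by rewrite fineK.
have t0 : 0 <= t by rewrite -lee_fin -tE sqint_ge0.
rewrite tE -EFinM.
(* The operator norm is a supremum over the unit ball. Normalising by $\sqrt{t+d}$ rather than
   $\sqrt t$ covers an [h] of norm zero; [d] is sent to 0 at the end. *)
have key (d : R) : 0 < d -> (sqint u (conv gr lambda f h) <= (n ^+ 2 * (t + d))%:E)%E.
  move=> d0; have td0 : 0 < t + d by rewrite ltr_wpDl.
  pose s := (Num.sqrt (t + d))^-1.
  have s0 : 0 < s by rewrite invr_gt0 sqrtr_gt0.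
  have s2 : s ^+ 2 = (t + d)^-1 by rewrite exprVn sqr_sqrtr// ltW.
  have : (L2norm gr lambda u (conv gr lambda f (fun x => (real_complex R s * h x)%R)) <= n%:E)%E.
    apply: le_trans fn; apply: ereal_sup_ubound.
    exists (fun x => real_complex R s * h x) => //; split; first exact: L2_scale.
    rewrite /L2norm -/(sqint _ _) sqrte_le ?sqint_ge0// sqint_scale// tE -EFinM lee_fin.
    by rewrite expr1n s2 mulrC ler_pdivrMr// mul1r lerDl ltW.
  rewrite /L2norm -/(sqint _ _) sqrte_le ?sqint_ge0//.
  rewrite (_ : conv _ _ _ _ = fun x => real_complex R s * conv gr lambda f h x); last first.
    by apply/funext => x; exact: conv_scale.
  rewrite sqint_scale// s2 muleC.
  have := sqint_ge0 u (conv gr lambda f h).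
  case: (sqint u (conv gr lambda f h)) => [r _| |]//.
    by rewrite -EFinM !lee_fin ler_pdivrMr.
  by rewrite gt0_mulye ?lte_fin ?invr_gt0.
have n21 : 0 < n ^+ 2 + 1 by rewrite ltr_wpDl ?sqr_ge0.
apply/lee_addgt0Pr => d d0.
apply: le_trans (key (d / (n ^+ 2 + 1)) (divr_gt0 d0 n21)) _.
rewrite -EFinD lee_fin mulrDr lerD2l mulrA ler_pdivrMr// mulrC ler_pM2l//.
by rewrite lerDl.
Qed.

Lemma red_contraction f :
  (red_norm gr lambda (restrict_fun (c @^-1` [set 1%g]) f) <= red_norm gr lambda f)%E.
Proof.
apply: ge_ereal_sup => _ [u u1 <-].
apply: (@le_trans _ _ (regular_norm gr lambda u f)); last first.
  by apply: ereal_sup_ubound; exists u.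
have L20 : L2 gr lambda u (fun=> 0).
  split; [exact: measurable_cst|exact: measurable_cst|].
  rewrite /L2norm -/(sqint _ _); have -> : sqint u (fun=> 0) = 0%E.
    rewrite /sqint; have [nu <-] := haar_src_measure u.
    by under eq_integral do rewrite cabs0 expr0n; exact: integral0.
  by rewrite sqrte0.
have L2n0 : L2norm gr lambda u (fun=> 0) = 0%E.
  rewrite /L2norm -/(sqint _ _); have -> : sqint u (fun=> 0) = 0%E.
    rewrite /sqint; have [nu <-] := haar_src_measure u.
    by under eq_integral do rewrite cabs0 expr0n; exact: integral0.
  by rewrite sqrte0.
have N0 : (0 <= regular_norm gr lambda u f)%E.
  apply: (@le_trans _ _ (L2norm gr lambda u (conv gr lambda f (fun=> 0)))).
    exact: sqrte_ge0.
  by apply: ereal_sup_ubound; exists (fun=> 0) => //; split; rewrite ?L2n0.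
(* For an infinite norm there is nothing to prove; nonnegativity, tested on the zero vector,
   excludes minus infinity. *)
case E : (regular_norm gr lambda u f) N0 => [n| |] // N0; last by rewrite leey.
rewrite lee_fin in N0.
apply: ge_ereal_sup => _ [h [Lh h1] <-].
have sh1 : (sqint u h <= 1)%E.
  by move: h1; rewrite /L2norm -/(sqint _ _) sqrte_le ?sqint_ge0// expr1n.
rewrite /L2norm -/(sqint _ _) sqrte_le ?sqint_ge0//.
have [e einj] := countable_grades.
pose D k : set G := c @^-1` (e @^-1` [set k]).
have ms : measurable (sfib gr u : set (borel G)) by apply: closed_borel; exact: closed_sfib.
have mD k : measurable (D k : set (borel G)) by apply: closed_borel; exact: closed_grade.
have msD k : measurable (sfib gr u `&` D k : set (borel G)) by exact: measurableI.
have tD : trivIset setT (fun k => sfib gr u `&` D k).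
  by move=> k l _ _ [x [[_ <-] [_ <-]]].
have UD : sfib gr u = \bigcup_k (sfib gr u `&` D k).
  apply/seteqP; split=> [x ux|x [k _ []//]].
  by exists (e (c x)).
have Lhk k : L2 gr lambda u (restrict_fun (D k) h).
  have [mr mi hoo] := Lh; split.
  - rewrite (_ : (fun x => _) = (fun x => complex.Re (h x)) \_ (D k)).
      by apply/measurable_restrict => //; apply: measurable_funS mr => // x [].
    by apply/funext => x; rewrite restrict_funE patchE; case: ifP.
  - rewrite (_ : (fun x => _) = (fun x => complex.Im (h x)) \_ (D k)).
      by apply/measurable_restrict => //; apply: measurable_funS mi => // x [].
    by apply/funext => x; rewrite restrict_funE patchE; case: ifP.
  - apply: le_lt_trans hoo; rewrite /L2norm lee_sqrt; last exact: sqint_ge0.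
    have [nu <-] := haar_src_measure u; apply: le_integral_ge0 => x _.
      by rewrite lee_fin sqr_ge0.
    by rewrite lee_fin restrict_funE; case: ifP => // _; rewrite cabs0 expr0n sqr_ge0.
have sqk k : (sqint u (restrict_fun (D k) h) =
    \int[haar_src gr lambda u]_(x in sfib gr u `&` D k) (cabs (h x) ^+ 2)%:E)%E.
  rewrite /sqint; have [nu <-] := haar_src_measure u.
  rewrite integral_mkcondr; apply: eq_integral => x _.
  by rewrite restrict_funE patchE; case: ifP => //; rewrite cabs0 expr0n.
(* On the [k]-th piece the convolution is replaced by that of [f] with the [k]-th part of [h]; the
   domain is then enlarged to the whole fibre, where the operator bound applies. *)
have stepk k : (\int[haar_src gr lambda u]_(x in sfib gr u `&` D k)
     (cabs (conv gr lambda (restrict_fun (c @^-1` [set 1%g]) f) h x) ^+ 2)%:E <=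
   (n ^+ 2)%:E * \int[haar_src gr lambda u]_(x in sfib gr u `&` D k) (cabs (h x) ^+ 2)%:E)%E.
  rewrite -sqk; apply: le_trans (@regular_bound u f n _ N0 _ (Lhk k)); last by rewrite E.
  rewrite /sqint; have [nu <-] := haar_src_measure u.
  rewrite (eq_integral (fun x : borel G => (cabs (conv gr lambda f (restrict_fun (D k) h) x) ^+ 2)%:E)).
    by apply: subset_integral_ge0 => [x _|x []//]; rewrite lee_fin sqr_ge0.
  by move=> x; rewrite inE => -[_ xk]; rewrite (@conv_restrict e f h k x einj xk).
have [nu nuE] := haar_src_measure u.
rewrite /sqint {1}UD -nuE.
(* Only this inequality is used for the convolution, whose measurability is unknown. *)
apply: le_trans (integral_bigcup_le nu msD tD _) _.
  by move=> x _; rewrite lee_fin sqr_ge0.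
apply: (@le_trans _ _ (\sum_(k <oo) ((n ^+ 2)%:E *
    \int[nu]_(x in sfib gr u `&` D k) (cabs (h x) ^+ 2)%:E))%E).
  apply: lee_nneseries => [k _ _|k _].
    by apply: integral_ge0 => x _; rewrite lee_fin sqr_ge0.
  by rewrite nuE; exact: stepk.
rewrite nneseriesZl; last by move=> k _; apply: integral_ge0 => x _; rewrite lee_fin sqr_ge0.
rewrite -[leRHS]mule1 lee_wpmul2l ?lee_fin ?sqr_ge0//.
(* For the measurable [h] the pieces add up exactly. *)
apply: le_trans sh1; rewrite /sqint -nuE {2}UD ge0_integral_bigcup//.
- rewrite -UD; apply/measurable_EFinP; apply: measurable_funX.
  have [mr mi _] := Lh.
  have -> : (fun x => cabs (h x)) = (fun x =>
      Num.sqrt (complex.Re (h x) ^+ 2 + complex.Im (h x) ^+ 2)).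
    by apply/funext => x; rewrite /cabs normc_def.
  apply: (@measurableT_comp _ _ _ _ _ _ (@Num.sqrt R)) => //.
    by apply: continuous_measurable_fun; exact: sqrt_continuous.
  by apply: measurable_funD; exact: measurable_funX.
- by move=> x _; rewrite lee_fin sqr_ge0.
Qed.

End reduced.

(** * Semi-inner products and unordered sums *)

Lemma complex_ge0E (R : realType) (z : R[i]) : 0 <= z -> z = real_complex R (complex.Re z).
Proof. by move=> z0; rewrite RRe_real// ger0_real. Qed.

Lemma conjE (R : realType) (a b : R) : Num.conj (Complex a b) = Complex a (- b).
Proof. by []. Qed.

Lemma sqr_cabs (R : realType) (z : R[i]) :
  cabs z ^+ 2 = complex.Re z ^+ 2 + complex.Im z ^+ 2.
Proof. by rewrite /cabs normc_def /= sqr_sqrtr// addr_ge0 ?sqr_ge0. Qed.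

Section semi_inner_product.
Variables (R : realType) (U : lmodType R[i]) (f : U -> U -> R[i]).
Hypothesis f_lin : forall k u w v, f (k *: u + w) v = k * f u v + f w v.
Hypothesis f_herm : forall u v, f u v = Num.conj (f v u).
Hypothesis f_ge0 : forall u, 0 <= f u u.

(** In general only a seminorm: it is applied to inner products of finitely many coordinates, which
    ignore all others, as well as to the inner product of $\ell^2$. *)
Definition fnorm u : R := Num.sqrt (complex.Re (f u u)).

Lemma Re_f_ge0 u : 0 <= complex.Re (f u u).
Proof. by rewrite -ler0c -complex_ge0E. Qed.

Lemma fnorm_ge0 u : 0 <= fnorm u.
Proof. exact: sqrtr_ge0. Qed.

Lemma sqr_fnorm u : fnorm u ^+ 2 = complex.Re (f u u).
Proof. by rewrite sqr_sqrtr// Re_f_ge0. Qed.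

Lemma f_sqr u : f u u = real_complex R (fnorm u ^+ 2).
Proof. by rewrite sqr_fnorm -complex_ge0E. Qed.

Lemma f_linr k u w v : f v (k *: u + w) = Num.conj k * f v u + f v w.
Proof.
by rewrite (f_herm v (k *: u + w)) f_lin rmorphD rmorphM (f_herm v u) (f_herm v w).
Qed.

Lemma f_expand k u v : complex.Re (f (k *: u + v) (k *: u + v)) =
  cabs k ^+ 2 * fnorm u ^+ 2 + 2 * complex.Re (k * f u v) + fnorm v ^+ 2.
Proof.
rewrite f_lin !f_linr !f_sqr (f_herm v u) sqr_cabs.
case: k => k1 k2; case: (f u v) => a1 a2; rewrite !conjE /=.
by ring.
Qed.

Lemma cauchy_schwarz u v : cabs (f u v) ^+ 2 <= fnorm u ^+ 2 * fnorm v ^+ 2.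
Proof.
(* Positivity at $v-s\,\overline{f(u,v)}\,u$, whose phase makes the cross term real. *)
have P (s : R) : 0 <= fnorm v ^+ 2 - 2 * s * cabs (f u v) ^+ 2 +
    s ^+ 2 * cabs (f u v) ^+ 2 * fnorm u ^+ 2.
  have := Re_f_ge0 ((real_complex R (- s) * Num.conj (f u v)) *: u + v).
  rewrite f_expand cabsM cabs_real cabs_conj exprMn real_normK ?num_real// sqrrN.
  have -> : complex.Re (real_complex R (- s) * Num.conj (f u v) * f u v) =
      - s * cabs (f u v) ^+ 2.
    by rewrite sqr_cabs; case: (f u v) => a b; rewrite conjE /=; ring.
  by move=> H; apply: le_trans H _; rewrite le_eqVlt; apply/orP; left; apply/eqP; ring.
set d := cabs (f u v) ^+ 2 in P *; set a := fnorm u ^+ 2 in P *; set b := fnorm v ^+ 2 in P *.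
have d0 : 0 <= d by rewrite sqr_ge0.
have a0 : 0 <= a by rewrite sqr_ge0.
have b0 : 0 <= b by rewrite sqr_ge0.
have [a00|an0] := eqVneq a 0.
  rewrite a00 mul0r leNgt; apply/negP => dp.
  (* When [u] has seminorm zero the expression is affine in [s], and this value of [s] would make it
     equal to $-1$. *)
  have := P ((b + 1) / (2 * d)); rewrite a00 mulr0 addr0.
  have -> : 2 * ((b + 1) / (2 * d)) * d = b + 1 by field; rewrite gt_eqF.
  by rewrite opprD addrA subrr add0r oppr_ge0 ler10.
have ap : 0 < a by rewrite lt_def an0.
have := P a^-1.
have -> : b - 2 * a^-1 * d + a^-1 ^+ 2 * d * a = b - d / a by field.
by rewrite subr_ge0 ler_pdivrMr// mulrC.
Qed.

Lemma cauchy_schwarz_sqrt u v : cabs (f u v) <= fnorm u * fnorm v.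
Proof.
rewrite -(@ler_pXn2r _ 2) ?nnegrE ?cabs_ge0 ?mulr_ge0 ?fnorm_ge0// exprMn.
exact: cauchy_schwarz.
Qed.

Lemma fnormD u v : fnorm (u + v) <= fnorm u + fnorm v.
Proof.
rewrite -(@ler_pXn2r _ 2) ?nnegrE ?addr_ge0 ?fnorm_ge0//.
rewrite sqr_fnorm; have cabs1 : cabs (1 : R[i]) = 1 by rewrite /cabs normr1.
have := f_expand 1 u v; rewrite scale1r cabs1 expr1n !mul1r => ->.
rewrite sqrrD lerD2r lerD2l -[leRHS]mulr_natl ler_pM2l//.
by apply: le_trans (cauchy_schwarz_sqrt u v); apply: le_trans (Re_cabs_le _); exact: ler_norm.
Qed.

Lemma fnormZ k u : fnorm (k *: u) = cabs k * fnorm u.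
Proof.
apply/eqP; rewrite -(@eqrXn2 _ 2) ?mulr_ge0 ?fnorm_ge0 ?cabs_ge0//; apply/eqP.
have f0 v : f 0 v = 0.
  by have := f_lin 1 0 0 v; rewrite scaler0 addr0 mul1r => /eqP; rewrite -subr_eq0 opprD addrA subrr sub0r oppr_eq0 => /eqP.
have n0 : fnorm 0 = 0 by rewrite /fnorm f0 sqrtr0.
rewrite sqr_fnorm -[k *: u]addr0 f_expand n0 (f_herm u 0) f0 rmorph0 mulr0 /=.
by rewrite mulr0 addr0 expr0n addr0 exprMn.
Qed.

End semi_inner_product.

Section hilbert_inner.
Variables (R : realType) (H : hilbertType R).

Lemma hinner_lin k (x y z : H) : hinner H (k *: x + y) z = k * hinner H x z + hinner H y z.
Proof. by rewrite linearDl linearZl_LR. Qed.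

Lemma hinner_herm (x y : H) : hinner H x y = Num.conj (hinner H y x).
Proof. by rewrite hermC mul1r. Qed.

Lemma hinnerE (x : H) : hinner H x x = real_complex R (rnorm x ^+ 2).
Proof. by rewrite -hnormE rnormE rmorphXn. Qed.

Lemma hinner_ge0 (x : H) : 0 <= hinner H x x.
Proof. by rewrite hinnerE ler0c sqr_ge0. Qed.

Lemma hinner_quad (k : R[i]) (x y : H) :
  hinner H (k *: y + x) (k *: y + x) = k * Num.conj k * hinner H y y +
    k * hinner H y x + Num.conj k * hinner H x y + hinner H x x.
Proof.
have L := @f_linr R H (hinner H) hinner_lin hinner_herm.
by rewrite hinner_lin !L; ring.
Qed.

(** Polarization. The nesting and the explicit coefficients match what iterating [has_sum_lin]
    produces. *)
Lemma hinner_polar (x y : H) : 4 * hinner H x y =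
  1 * hinner H (1 *: y + x) (1 *: y + x) +
  (- 1 * hinner H (- 1 *: y + x) (- 1 *: y + x) +
  ('i * hinner H ('i *: y + x) ('i *: y + x) +
   - 'i * hinner H (- 'i *: y + x) (- 'i *: y + x))).
Proof.
rewrite !hinner_quad.
have c1 : Num.conj (1 : R[i]) = 1 by rewrite rmorph1.
have cN1 : Num.conj (- 1 : R[i]) = -1 by rewrite rmorphN rmorph1.
have ci : Num.conj ('i : R[i]) = - 'i by rewrite conjCi.
have cNi : Num.conj (- 'i : R[i]) = 'i by rewrite rmorphN -[RHS]opprK -ci.
have i2 : 'i * 'i = -1 :> R[i] by rewrite -expr2 sqrCi.
rewrite c1 cN1 ci cNi.
set a := hinner H x x; set b := hinner H x y; set c := hinner H y x; set d := hinner H y y.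
set j : R[i] := 'i in i2 *.
by ring: i2.
Qed.

End hilbert_inner.

(** * Unordered sums over an arbitrary index set *)

Section has_sum.
Variables (R : realType) (I : choiceType).
Implicit Types (f g : I -> R[i]) (s : seq I).

(** Convergence along the net of finite subsets, which are represented by duplicate-free lists. *)
Definition has_sum f (l : R[i]) := forall e : R, 0 < e -> exists s0 : seq I,
  forall s, uniq s -> {subset s0 <= s} -> cabs (l - \sum_(i <- s) f i) < e.

Lemma has_sum_uniq f l l' : has_sum f l -> has_sum f l' -> l = l'.
Proof.
move=> fl fl'; apply: (@rnorm_eq R R[i]^o) => e e0.
have [s0 H0] := fl _ (divr_gt0 e0 (ltr0Sn R 1)).
have [s1 H1] := fl' _ (divr_gt0 e0 (ltr0Sn R 1)).
pose s := undup (s0 ++ s1).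
have h0 := H0 s (undup_uniq _) _; have h1 := H1 s (undup_uniq _) _.
apply: le_trans (@rnormB_le R R[i]^o (\sum_(i <- s) f i) _ _) _; rewrite [e]splitr.
apply: lerD; first by apply/ltW/h0 => i; rewrite mem_undup mem_cat => ->.
by rewrite rnormC; apply/ltW/h1 => i; rewrite mem_undup mem_cat orbC => ->.
Qed.

Lemma has_sum_lin k f g l m : has_sum f l -> has_sum g m ->
  has_sum (fun i => k * f i + g i) (k * l + m).
Proof.
move=> fl gm e e0; have e2 : 0 < e / 2 by rewrite divr_gt0.
have [s0 H0] := fl _ (divr_gt0 e2 (cabs1_gt0 k)); have [s1 H1] := gm _ e2.
exists (s0 ++ s1) => s us ss.
have h0 : cabs (l - \sum_(i <- s) f i) < e / 2 / (cabs k + 1).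
  by apply: H0 => // i i0; apply: ss; rewrite mem_cat i0.
have h1 : cabs (m - \sum_(i <- s) g i) < e / 2.
  by apply: H1 => // i i0; apply: ss; rewrite mem_cat i0 orbT.
rewrite big_split /= -mulr_sumr opprD addrACA -mulrBr.
apply: le_lt_trans (cabsD _ _) _; rewrite [e]splitr; apply: ler_ltD => //.
rewrite cabsM; apply: le_trans (_ : (cabs k + 1) * cabs (l - \sum_(i <- s) f i) <= _).
  by apply: ler_wpM2r; [exact: cabs_ge0|rewrite lerDl].
by rewrite mulrC -ler_pdivlMr ?ltW//; exact: cabs1_gt0.
Qed.

Lemma has_sum_conj f l : has_sum f l -> has_sum (fun i => Num.conj (f i)) (Num.conj l).
Proof.
move=> fl e e0; have [s0 H0] := fl e e0; exists s0 => s us ss.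
by rewrite -rmorph_sum -rmorphB cabs_conj H0.
Qed.

Lemma le_sum_subset (f : I -> R) s0 s : (forall i, 0 <= f i) -> uniq s0 ->
  {subset s0 <= s} -> uniq s -> \sum_(i <- s0) f i <= \sum_(i <- s) f i.
Proof.
move=> f0 us0 ss us; rewrite [leRHS](bigID (mem s0)) /= -[leLHS]addr0 lerD//.
  rewrite -[leRHS]big_filter [leRHS](perm_big s0) //=; apply: uniq_perm => //.
    exact: filter_uniq.
  by move=> i; rewrite mem_filter andb_idr//; exact: ss.
exact: sumr_ge0.
Qed.

Lemma has_sum_ge0 (f : I -> R) (M : R) : (forall i, 0 <= f i) ->
  (forall s, uniq s -> \sum_(i <- s) f i <= M) ->
  exists l, has_sum (fun i => real_complex R (f i)) (real_complex R l).
Proof.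
move=> f0 fM; pose A := [set \sum_(i <- s) f i | s in [set s | uniq s]].
have sA : has_sup A.
  split; first by exists 0, [::] => //; rewrite big_nil.
  by exists M => _ [s us <-]; exact: fM.
exists (sup A) => e e0; have [_ [s0 us0 <-] s0e] := sup_adherent e0 sA.
exists s0 => s us ss; rewrite -rmorph_sum -rmorphB cabs_real ger0_norm.
  by rewrite ltrBlDl -ltrBlDr; apply: lt_le_trans s0e _; exact: le_sum_subset.
by rewrite subr_ge0; apply: sup_upper_bound => //; exists s.
Qed.

Lemma has_sum_ge (f : I -> R) l s : (forall i, 0 <= f i) -> uniq s ->
  has_sum (fun i => real_complex R (f i)) (real_complex R l) ->
  \sum_(i <- s) f i <= l.
Proof.
move=> f0 us fl; apply: le_eps => e e0; have [s0 H0] := fl e e0.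
pose s1 := undup (s ++ s0).
have h : cabs (real_complex R l - \sum_(i <- s1) real_complex R (f i)) < e.
  by apply: H0; [exact: undup_uniq|move=> i i0; rewrite mem_undup mem_cat i0 orbT].
apply: (@le_trans _ _ (\sum_(i <- s1) f i)).
  by apply: le_sum_subset; rewrite ?undup_uniq// => i i0; rewrite mem_undup mem_cat i0.
rewrite -lerBlDl; move: h; rewrite -rmorph_sum -rmorphB cabs_real => /ltW; apply: le_trans.
by rewrite distrC ler_norm.
Qed.

Lemma has_sum_le (f : I -> R) l M :
  has_sum (fun i => real_complex R (f i)) (real_complex R l) ->
  (forall s, uniq s -> \sum_(i <- s) f i <= M) -> l <= M.
Proof.
move=> fl fM; apply: le_eps => e e0; have [s0 H0] := fl e e0.
have := H0 (undup s0) (undup_uniq _); rewrite -rmorph_sum -rmorphB cabs_real.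
move=> /(_ _)/ltW h; rewrite -lerBlDl.
apply: le_trans (_ : `|l - \sum_(i <- undup s0) f i| <= _).
  by apply: le_trans (ler_norm _); rewrite lerD2l lerN2 fM// undup_uniq.
by apply: h => i; rewrite mem_undup.
Qed.

End has_sum.

(** * The Hilbert space of square-summable families *)

Section cauchy_filter.
Variables (R : realType) (V : normedModType R[i]).

(** Completeness of $\ell^2$ is proved with sequences, while the structure asks for filters. A
    sequence is picked from members of the filter whose diameters tend to 0. *)
Lemma cauchy_filter_cvg :
  (forall u : nat -> V,
    (forall e : R, 0 < e -> exists N, forall n m, (N <= n)%N -> (N <= m)%N ->
      rnorm (u n - u m) < e) ->
    exists l, forall e : R, 0 < e -> exists N, forall n, (N <= n)%N -> rnorm (l - u n) < e) ->
  forall F : set_system V, ProperFilter F -> cauchy F -> cvg F.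
Proof.
move=> seqcv F FF /cauchy_ballP cF.
have /choice[P HP] : forall n : nat, exists P : set V, F P /\
    forall x y, P x -> P y -> rnorm (x - y) < n.+1%:R^-1.
  move=> n; have n0 : 0 < real_complex R n.+1%:R^-1 by rewrite ltcR invr_gt0.
  have [[A B] /= [FA FB] AB] := cF _ n0.
  exists (A `&` B); split; first exact: filterI.
  move=> x y [Ax _] [_ By]; have := AB (x, y) (conj Ax By).
  by rewrite -ball_normE /= rnormE ltcR.
(* Intersecting makes the sets decrease, so every later point of the sequence lies in each earlier
   small set. *)
pose Q := fix Q n := if n is m.+1 then Q m `&` P m.+1 else P 0%N.
have FQ n : F (Q n) by elim: n => [|n IH] /=; [have [] := HP 0%N|apply: filterI => //; have [] := HP n.+1].
have QP n m x : (n <= m)%N -> Q m x -> P n x.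
  elim: m => [|m IH]; first by rewrite leqn0 => /eqP ->.
  rewrite leq_eqVlt => /orP[/eqP -> [_]//|nm [Qm _]].
  exact: IH.
have /choice[u Hu] : forall n, exists x, Q n x by move=> n; have [x Qx] := filter_ex (FQ n); exists x.
have small (e : R) : 0 < e -> exists M, forall n, (M <= n)%N -> n.+1%:R^-1 < e.
  move=> e0; exists (Num.truncn e^-1) => n Mn.
  rewrite invf_plt ?posrE//; apply: lt_le_trans (truncnS_gt _) _.
  by rewrite ler_nat ltnS.
have [e e0|l Hl] := seqcv u.
  have [M HM] := small e e0; exists M => n m Mn Mm.
  apply: lt_trans (HM M (leqnn M)).
  by apply: (HP M).2; [exact: (QP M n)|exact: (QP M m)].
apply/cvg_ex; exists l => A /nbhs_rnormP[e e0 eA].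
have [M HM] := small _ (divr_gt0 e0 (ltr0Sn R 1)).
have [N HN] := Hl _ (divr_gt0 e0 (ltr0Sn R 1)).
apply: filterS (HP M).1 => y Py; apply: eA.
pose n := maxn M N.
apply: le_lt_trans (rnormB_le (u n) _ _) _; rewrite [e]splitr; apply: ltrD.
  by apply: HN; rewrite leq_maxr.
apply: lt_trans (HM M (leqnn M)); apply: (HP M).2 => //.
by apply: (QP M n) => //; rewrite leq_maxl.
Qed.

End cauchy_filter.

Section l2_space.
Variables (R : realType) (I : choiceType) (H : hilbertType R).
Implicit Types (x y : I -> H) (s : seq I).

Definition l2 x := exists M : R, forall s, uniq s -> \sum_(i <- s) rnorm (x i) ^+ 2 <= M.

Definition partial_inner s x y : R[i] := \sum_(i <- s) hinner H (x i) (y i).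

Lemma partial_inner_lin s k x x' y :
  partial_inner s (k *: x + x') y = k * partial_inner s x y + partial_inner s x' y.
Proof.
rewrite /partial_inner mulr_sumr -big_split; apply: eq_bigr => i _.
exact: hinner_lin.
Qed.

Lemma partial_inner_herm s x y : partial_inner s x y = Num.conj (partial_inner s y x).
Proof.
by rewrite /partial_inner rmorph_sum; apply: eq_bigr => i _; exact: hinner_herm.
Qed.

Lemma partial_inner_ge0 s x : 0 <= partial_inner s x x.
Proof. by apply: sumr_ge0 => i _; exact: hinner_ge0. Qed.

Lemma partial_innerE s x : partial_inner s x x =
  real_complex R (\sum_(i <- s) rnorm (x i) ^+ 2).
Proof. by rewrite rmorph_sum; apply: eq_bigr => i _; exact: hinnerE. Qed.

Lemma sqr_partial_norm s x :
  fnorm (partial_inner s) x ^+ 2 = \sum_(i <- s) rnorm (x i) ^+ 2.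
Proof. by rewrite sqr_fnorm; [rewrite partial_innerE|exact: partial_inner_ge0]. Qed.

Lemma partial_normD s x y : fnorm (partial_inner s) (x + y) <=
  fnorm (partial_inner s) x + fnorm (partial_inner s) y.
Proof.
by apply: fnormD; [exact: partial_inner_lin|exact: partial_inner_herm|exact: partial_inner_ge0].
Qed.

Lemma partial_normZ s k x : fnorm (partial_inner s) (k *: x) =
  cabs k * fnorm (partial_inner s) x.
Proof.
by apply: fnormZ; [exact: partial_inner_lin|exact: partial_inner_herm|exact: partial_inner_ge0].
Qed.

Lemma l2P x : l2 x <-> exists2 M : R, 0 <= M &
  forall s, uniq s -> fnorm (partial_inner s) x <= M.
Proof.
split=> [[M HM]|[M M0 HM]].
  exists (Num.sqrt M) => [|s us]; first exact: sqrtr_ge0.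
  have M0 : 0 <= M by apply: le_trans (HM [::] _) => //; rewrite big_nil.
  rewrite -(@ler_pXn2r _ 2) ?nnegrE ?fnorm_ge0 ?sqrtr_ge0// sqr_partial_norm sqr_sqrtr//.
  exact: HM.
exists (M ^+ 2) => s us; rewrite -sqr_partial_norm.
by rewrite ler_pXn2r ?nnegrE ?fnorm_ge0// HM.
Qed.

Lemma l2_lin k x y : l2 x -> l2 y -> l2 (k *: x + y).
Proof.
move=> /l2P[M M0 HM] /l2P[N N0 HN]; apply/l2P; exists (cabs k * M + N).
  by rewrite addr_ge0// mulr_ge0// cabs_ge0.
move=> s us; apply: le_trans (partial_normD _ _ _) _; rewrite partial_normZ.
by apply: lerD; [apply: ler_wpM2l; [exact: cabs_ge0|exact: HM]|exact: HN].
Qed.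

Lemma l2_0 : l2 0.
Proof.
exists 0 => s _; rewrite big1// => i _.
by rewrite rnorm0 expr0n.
Qed.

Definition l2_pred : {pred I -> H} := fun x => `[< l2 x >].

Lemma l2_submod : GRing.submod_closed l2_pred.
Proof.
split; first exact/asboolP/l2_0.
by move=> k x y /asboolP lx /asboolP ly; apply/asboolP; exact: l2_lin.
Qed.

HB.instance Definition _ := GRing.isSubmodClosed.Build R[i] (I -> H) l2_pred l2_submod.

Record l2_type := L2Type { l2_val :> I -> H; l2_valP : l2_val \in l2_pred }.

HB.instance Definition _ := [isSub for l2_val].
HB.instance Definition _ := [Choice of l2_type by <:].
HB.instance Definition _ := [SubChoice_isSubLmodule of l2_type by <:].

Implicit Types u v w : l2_type.

Lemma l2_type_l2 (u : l2_type) : l2 u.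
Proof. by apply/asboolP; exact: l2_valP. Qed.

Lemma has_sum_sqr x : l2 x ->
  exists l : R[i], has_sum (fun i => hinner H (x i) (x i)) l.
Proof.
move=> [M HM]; have [l Hl] := has_sum_ge0 (fun i => sqr_ge0 (rnorm (x i))) HM.
exists (real_complex R l); rewrite (_ : (fun i => _) = (fun i => real_complex R (rnorm (x i) ^+ 2)))//.
by apply/funext => i; exact: hinnerE.
Qed.

Lemma eq_has_sum (f g : I -> R[i]) l : f =1 g -> has_sum f l -> has_sum g l.
Proof. by move=> /funext ->. Qed.

(** Polarization writes the terms as a combination of four square-summable families, for which
    bounded partial sums suffice. *)
Lemma has_sum_hinner x y : l2 x -> l2 y ->
  exists l : R[i], has_sum (fun i => hinner H (x i) (y i)) l.
Proof.
move=> lx ly.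
have [l1 H1] := has_sum_sqr (l2_lin 1 ly lx).
have [l2' H2] := has_sum_sqr (l2_lin (- 1) ly lx).
have [l3 H3] := has_sum_sqr (l2_lin 'i ly lx).
have [l4 H4] := has_sum_sqr (l2_lin (- 'i) ly lx).
have H0 : has_sum (fun i : I => 0 : R[i]) 0.
  by move=> e e0; exists [::] => s _ _; rewrite big1// subrr cabs0.
have HH := has_sum_lin 4^-1 (has_sum_lin 1 H1 (has_sum_lin (- 1) H2
  (has_sum_lin 'i H3 (has_sum_lin (- 'i) H4 H0)))) H0.
eexists; apply: eq_has_sum HH => i /=.
by rewrite !addr0 -hinner_polar mulKf// pnatr_eq0.
Qed.

(** The default 0 is never taken, since the sum exists for any two elements. *)
Definition l2_inner (u v : l2_type) : R[i] :=
  xget 0 [set l | has_sum (fun i => hinner H (u i) (v i)) l].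

Lemma l2_innerP (u v : l2_type) : has_sum (fun i => hinner H (u i) (v i)) (l2_inner u v).
Proof.
have [l Hl] := has_sum_hinner (l2_type_l2 u) (l2_type_l2 v).
by apply: (@xgetPex _ 0 [set l | has_sum (fun i => hinner H (u i) (v i)) l]); exists l.
Qed.

Lemma l2_inner_lin k u w v : l2_inner (k *: u + w) v = k * l2_inner u v + l2_inner w v.
Proof.
apply: has_sum_uniq (l2_innerP _ _) _.
apply: eq_has_sum (has_sum_lin k (l2_innerP u v) (l2_innerP w v)) => i.
by rewrite -hinner_lin.
Qed.

Lemma l2_inner_herm u v : l2_inner u v = Num.conj (l2_inner v u).
Proof.
apply: has_sum_uniq (l2_innerP _ _) _.
by apply: eq_has_sum (has_sum_conj (l2_innerP v u)) => i; rewrite -hinner_herm.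
Qed.

Lemma l2_inner_real u : exists2 l : R, l2_inner u u = real_complex R l &
  has_sum (fun i => real_complex R (rnorm (u i) ^+ 2)) (real_complex R l).
Proof.
have [M HM] := l2_type_l2 u.
have [l Hl] := has_sum_ge0 (fun i => sqr_ge0 (rnorm (u i))) HM.
exists l => //; apply: has_sum_uniq (l2_innerP _ _) _.
by apply: eq_has_sum Hl => i; rewrite hinnerE.
Qed.

Lemma l2_inner_ge0 u : 0 <= l2_inner u u.
Proof.
have [l -> Hl] := l2_inner_real u; rewrite ler0c.
have := @has_sum_ge _ _ _ _ [::] (fun i => sqr_ge0 (rnorm (u i))) isT Hl.
by rewrite big_nil.
Qed.

Definition l2_norm (u : l2_type) : R[i] := real_complex R (fnorm l2_inner u).

Lemma sum_le_l2_norm s u : uniq s ->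
  \sum_(i <- s) rnorm (u i) ^+ 2 <= fnorm l2_inner u ^+ 2.
Proof.
move=> us; rewrite sqr_fnorm; last exact: l2_inner_ge0.
have [l -> Hl] := l2_inner_real u.
exact: (has_sum_ge (fun i => sqr_ge0 (rnorm (u i))) us Hl).
Qed.

Lemma l2_norm_le u (M : R) : 0 <= M ->
  (forall s, uniq s -> \sum_(i <- s) rnorm (u i) ^+ 2 <= M ^+ 2) -> fnorm l2_inner u <= M.
Proof.
move=> M0 HM; rewrite -(@ler_pXn2r _ 2) ?nnegrE ?fnorm_ge0//.
rewrite sqr_fnorm; last exact: l2_inner_ge0.
have [l -> Hl] := l2_inner_real u.
exact: has_sum_le Hl HM.
Qed.

Lemma l2_norm_coord u i : rnorm (u i) <= fnorm l2_inner u.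
Proof.
rewrite -(@ler_pXn2r _ 2) ?nnegrE ?fnorm_ge0 ?rnorm_ge0//.
by have := @sum_le_l2_norm [:: i] u isT; rewrite big_seq1.
Qed.

Lemma l2_normD u v : l2_norm (u + v) <= l2_norm u + l2_norm v.
Proof.
rewrite /l2_norm -rmorphD lecR; apply: fnormD.
- exact: l2_inner_lin.
- exact: l2_inner_herm.
- exact: l2_inner_ge0.
Qed.

Lemma l2_normZ k u : l2_norm (k *: u) = `|k| * l2_norm u.
Proof.
rewrite /l2_norm cabsE -rmorphM; congr (real_complex R _); apply: fnormZ.
- exact: l2_inner_lin.
- exact: l2_inner_herm.
- exact: l2_inner_ge0.
Qed.

Lemma l2_norm_eq0 u : l2_norm u = 0 -> u = 0.
Proof.
move=> /(@complexI R) u0; apply: val_inj; apply/funext => i.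
apply: rnorm0_eq0; apply/eqP; rewrite eq_le rnorm_ge0 andbT.
by rewrite -u0; exact: l2_norm_coord.
Qed.

HB.instance Definition _ := @Lmodule_isNormed.Build R[i] l2_type l2_norm
  l2_normD l2_normZ l2_norm_eq0.

Lemma rnorm_l2 (u : l2_type) : rnorm u = fnorm l2_inner u.
Proof. by []. Qed.

(** Coordinates are contractive, so a limit exists coordinatewise. It is then shown to be
    square-summable and to be a limit in norm, using estimates uniform over finite sets of
    coordinates. *)
Lemma l2_complete (F : set_system l2_type) : ProperFilter F -> cauchy F -> cvg F.
Proof.
apply: cauchy_filter_cvg => u cu.
have /choice[x Hx] : forall i, exists l : H, forall e : R, 0 < e ->
    exists N, forall n, (N <= n)%N -> rnorm (l - u n i) < e.
  move=> i; apply: rnorm_cauchy_cvg => e e0; have [N HN] := cu e e0.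
  exists N => n m Nn Nm; apply: le_lt_trans (HN n m Nn Nm).
  exact: (l2_norm_coord (u n - u m) i).
have conv_s s (e : R) : 0 < e -> exists N, forall n, (N <= n)%N ->
    fnorm (partial_inner s) ((u n : I -> H) - x) <= e.
  move=> e0; suff [N HN] : exists N, forall n, (N <= n)%N ->
      \sum_(i <- s) rnorm (u n i - x i) ^+ 2 <= e ^+ 2.
    exists N => n Nn; rewrite -(@ler_pXn2r _ 2) ?nnegrE ?fnorm_ge0 ?(ltW e0)//.
    by rewrite sqr_partial_norm; exact: HN.
  have : 0 < e ^+ 2 by rewrite exprn_gt0.
  move: (e ^+ 2) => {e e0}; elim: s => [|i s IH] d d0.
    by exists 0%N => n _; rewrite big_nil ltW.
  have d2 : 0 < d / 2 by rewrite divr_gt0.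
  have [N HN] := IH _ d2.
  have sd : 0 < Num.sqrt (d / 2) by rewrite sqrtr_gt0.
  have [N' HN'] := Hx i _ sd.
  exists (maxn N N') => n Mn.
  have Nn : (N <= n)%N by apply: leq_trans Mn; rewrite leq_maxl.
  have N'n : (N' <= n)%N by apply: leq_trans Mn; rewrite leq_maxr.
  rewrite big_cons [d]splitr; apply: lerD; last exact: HN.
  rewrite -(sqr_sqrtr (ltW d2)) ler_pXn2r ?nnegrE ?rnorm_ge0 ?sqrtr_ge0//.
  by rewrite rnormC ltW// HN'.
(* [N] comes from the Cauchy condition and is independent of [s]; only the auxiliary index [m], for
   which [u m] is close to the limit on [s], depends on [s]. *)
have bound (e : R) : 0 < e -> exists N, forall n s, (N <= n)%N -> uniq s ->
    fnorm (partial_inner s) ((u n : I -> H) - x) <= e.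
  move=> e0; have [N HN] := cu e e0; exists N => n s Nn us.
  apply: le_eps => d d0; have [M HM] := conv_s s d d0.
  pose m := maxn N M.
  have -> : (u n : I -> H) - x = ((u n : I -> H) - u m) + ((u m : I -> H) - x).
    by rewrite addrA subrK.
  apply: le_trans (partial_normD _ _ _) _; apply: lerD.
    apply: le_trans (_ : rnorm (u n - u m) <= _); last first.
      by apply/ltW/HN; rewrite ?leq_maxl.
    rewrite -(@ler_pXn2r _ 2) ?nnegrE ?fnorm_ge0 ?rnorm_ge0// sqr_partial_norm.
    exact: (sum_le_l2_norm (u n - u m) us).
  by apply: HM; rewrite leq_maxr.
have lx : l2 x.
  have [N HN] := bound 1 ltr01.
  have lux : l2 ((u N : I -> H) - x).
    by apply/l2P; exists 1 => // s us; exact: HN.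
  have -> : x = (- 1) *: ((u N : I -> H) - x) + u N.
    by rewrite scaleN1r opprB subrK.
  by apply: l2_lin => //; exact: l2_type_l2.
exists (L2Type (asboolT lx)) => e e0.
have [N HN] := bound (e / 2) (divr_gt0 e0 (ltr0Sn R 1)).
exists N => n Nn; apply: (@le_lt_trans _ _ (e / 2)); last first.
  by rewrite ltr_pdivrMr// ltr_pMr// ltr1n.
rewrite rnormC; apply: l2_norm_le; first by rewrite divr_ge0// ltW.
move=> s us; rewrite -[leLHS]/(\sum_(i <- s) rnorm (((u n : I -> H) - x) i) ^+ 2).
rewrite -sqr_partial_norm ler_pXn2r ?nnegrE ?fnorm_ge0//; first exact: HN.
by rewrite divr_ge0// ltW.
Qed.

HB.instance Definition _ := Uniform_isComplete.Build l2_type l2_complete.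

Lemma l2_inner_bilinear : bilinear_for
  (GRing.Scale.Law.clone _ _ *%R _) (GRing.Scale.Law.clone _ _ (Num.conj \; *%R) _)
  l2_inner.
Proof.
split=> [v|v] k u w; first exact: l2_inner_lin.
apply: f_linr; first exact: l2_inner_lin.
exact: l2_inner_herm.
Qed.

HB.instance Definition _ := @bilinear_isBilinear.Build R[i] l2_type l2_type R[i] _ _
  l2_inner l2_inner_bilinear.

Lemma l2_inner_hermitian (u v : l2_type) :
  l2_inner u v = (-1) ^+ false * Num.conj (l2_inner v u).
Proof. by rewrite mul1r; exact: l2_inner_herm. Qed.

HB.instance Definition _ := @isHermitianSesquilinear.Build R[i] l2_type false Num.conj
  l2_inner l2_inner_hermitian.

Lemma l2_inner_gt0 (u : l2_type) : u != 0 -> 0 < l2_inner u u.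
Proof.
move=> u0; rewrite lt_def l2_inner_ge0 andbT; apply: contra u0 => /eqP uu.
by apply/eqP; apply: l2_norm_eq0; rewrite /l2_norm /fnorm uu /= sqrtr0.
Qed.

HB.instance Definition _ := isDotProduct.Build R[i] l2_type l2_inner l2_inner_gt0.

Lemma l2_normE (u : l2_type) : `|u| ^+ 2 = l2_inner u u.
Proof.
rewrite rnormE rnorm_l2 -rmorphXn /= sqr_fnorm; last exact: l2_inner_ge0.
by have [l ->] := l2_inner_real u.
Qed.

Definition l2_hilbert : hilbertType R := @HilbertType R l2_type l2_inner l2_normE.

End l2_space.

(** * A Schur test for matrices over C_c(G) *)

(** Iterating gives $(q_0/N)^{2^k}\le q_k/N\le C L^{2^k}$; if $q_0/N$ exceeded $L$, the quotient of
    the two powers would be unbounded in $k$. *)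
Lemma pow2_limit (R : realType) (q : nat -> R) (N C L : R) :
  0 <= N -> 0 <= C -> 0 <= L -> (forall k, 0 <= q k) ->
  (forall k, q k ^+ 2 <= q k.+1 * N) ->
  (forall k, q k <= C * L ^+ (2 ^ k) * N) -> q 0%N <= L * N.
Proof.
move=> N0 C0 L0 q0 qq qC.
have [NE|NN0] := eqVneq N 0.
  by have := qC 0%N; rewrite NE !mulr0.
have Np : 0 < N by rewrite lt_def NN0.
have qk k : (q 0%N / N) ^+ (2 ^ k) <= q k / N.
  elim: k => [|k IH]; first by rewrite expn0 expr1.
  rewrite expnS mulnC exprM; apply: (@le_trans _ _ ((q k / N) ^+ 2)).
    by rewrite ler_pXn2r ?nnegrE ?exprn_ge0 ?divr_ge0.
  rewrite expr_div_n ler_pdivrMr ?exprn_gt0// expr2 mulrA divfK//.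
  exact: qq.
rewrite -ler_pdivrMr//; set r := q 0%N / N in qk *.
have r0 : 0 <= r by rewrite divr_ge0.
have rC k : r ^+ (2 ^ k) <= C * L ^+ (2 ^ k).
  by apply: le_trans (qk k) _; rewrite ler_pdivrMr.
rewrite leNgt; apply/negP => Lr.
have [LE|LN0] := eqVneq L 0.
  by have := rC 0%N; rewrite LE expn0 expr1 mulr0 leNgt -LE Lr.
have Lp : 0 < L by rewrite lt_def LN0.
pose d := r / L - 1.
have d0 : 0 < d by rewrite subr_gt0 ltr_pdivlMr// mul1r.
(* Bernoulli's inequality gives the unbounded growth without taking roots. *)
have bern m : 1 + m%:R * d <= (r / L) ^+ m.
  elim: m => [|m IH]; first by rewrite mul0r addr0 expr0.
  have rL : r / L = 1 + d by rewrite /d addrC subrK.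
  have h1 : 1 <= (r / L) ^+ m by apply: exprn_ege1; rewrite ler_pdivlMr// mul1r ltW.
  rewrite exprS {1}rL mulrDl mul1r -natr1 mulrDl mul1r addrA; apply: lerD => //.
  by rewrite ler_peMr// ltW.
have [k Ck] : exists k : nat, C < k%:R * d.
  exists (Num.truncn (C / d)).+1; rewrite -ltr_pdivrMr//; exact: truncnS_gt.
have : C < C.
  apply: (lt_le_trans Ck); apply: (@le_trans _ _ ((r / L) ^+ (2 ^ k))).
    apply: le_trans (bern _); apply: (@le_trans _ _ ((2 ^ k)%:R * d)).
      by rewrite ler_pM2r// ler_nat ltnW// ltn_expl.
    by rewrite lerDr.
  by rewrite expr_div_n ler_pdivrMr ?exprn_gt0.
by rewrite ltxx.
Qed.

(** * The I-norm in terms of fibre $L^1$ norms *)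

Section I_norm_theory.
Variables (R : realType) (G : ptopologicalType) (gr : topGroupoid G)
  (lambda : G -> {measure set (borel G) -> \bar R}).
Hypothesis G_second_countable : @second_countable G.
Hypothesis G_locally_compact : locally_compact [set: G].
Hypothesis G_hausdorff : hausdorff_space G.
Hypothesis lambda_haar : haar_system gr lambda.
Implicit Types a b f : G -> R[i].

Local Notation fiber_L1 := (fiber_L1 gr lambda).

(** Inversion turns the source half of the I-norm into the range half for the adjoint, so both
    halves are handled by [fiber_L1]. *)
Lemma src_integral u a : Cc a ->
  (\int[haar_src gr lambda u]_(x in sfib gr u) (cabs (a x))%:E =
   \int[lambda u]_(x in rfib gr u) (cabs (invol gr a x))%:E)%E.
Proof.
move=> Ca; rewrite /haar_src (ge0_integral_pushforward (@ginv_measurable G gr)).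
- have -> : ginv gr @^-1` sfib gr u = rfib gr u.
    by apply/seteqP; split=> x; rewrite /sfib /rfib /= gsrc_inv.
  by apply: eq_integral => x _; rewrite /= /invol cabs_conj.
- by apply: closed_borel; exact: closed_sfib.
- apply/measurable_EFinP; apply: within_measurable; first exact: closed_sfib.
  apply: continuous_subspaceT => x; apply/(@cvgrPdist_lt R R^o) => e e0.
  have := (complex_continuousP _).1 Ca.1 x e e0; apply: filterS => y.
  by apply: le_lt_trans; exact: cabs_dist.
- by move=> x _; rewrite lee_fin cabs_ge0.
Qed.

Lemma fiber_L1_le_I a u : gunits gr u -> Cc a -> ((fiber_L1 u a)%:E <= I_norm gr lambda a)%E.
Proof.
move=> u1 Ca; rewrite fiber_L1E// /I_norm le_max; apply/orP; left.
by apply: ereal_sup_ubound; exists u.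
Qed.

Lemma fiber_L1_invol_le_I a u : gunits gr u -> Cc a ->
  ((fiber_L1 u (invol gr a))%:E <= I_norm gr lambda a)%E.
Proof.
move=> u1 Ca; rewrite fiber_L1E//; last exact: Cc_invol.
rewrite /I_norm le_max; apply/orP; right.
by rewrite -src_integral//; apply: ereal_sup_ubound; exists u.
Qed.

Lemma I_norm_le a (K : R) : Cc a -> (forall u, gunits gr u -> fiber_L1 u a <= K) ->
  (forall u, gunits gr u -> fiber_L1 u (invol gr a) <= K) -> (I_norm gr lambda a <= K%:E)%E.
Proof.
move=> Ca aK aK'; rewrite /I_norm ge_max; apply/andP; split.
  by apply: ge_ereal_sup => _ [u u1 <-]; rewrite -fiber_L1E// lee_fin aK.
apply: ge_ereal_sup => _ [u u1 <-]; rewrite src_integral// -fiber_L1E ?lee_fin ?aK'//.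
exact: Cc_invol.
Qed.

(** The fibre norm depends continuously on the unit by the Haar axiom for $|a|$, so it is bounded
    over the ranges of the compact support; over all other units it is zero. *)
Lemma fiber_L1_bounded a : Cc a -> exists K : R, forall u, gunits gr u -> fiber_L1 u a <= K.
Proof.
move=> Ca; have Cna := Cc_absf Ca.
have cg : continuous (fun x => fiber_L1 (grng gr x) a).
  move=> x; apply/(@cvgrPdist_lt R R^o) => e e0.
  have := (complex_continuousP _).1 (haar_within lambda_haar Cna) x e e0.
  by apply: filterS => y; rewrite !cint_absf -rmorphB cabs_real.
have cK : compact ((fun x => fiber_L1 (grng gr x) a) @` fsupp a).
  by apply: continuous_compact; [exact: continuous_subspaceT|exact: Ca.2].
have [M [Mr HM]] := @compact_bounded R R^o _ cK.
exists (`|M| + 1) => u u1.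
have [[x ax xu]|nx] := pselect (exists2 x, fsupp a x & grng gr x = u).
  apply: le_trans (ler_norm _) _; apply: HM; first by rewrite ltr_pwDr// ler_norm.
  by exists x => //; rewrite xu.
have -> : fiber_L1 u a = 0; last by rewrite addr_ge0.
transitivity (Rintegral (lambda u) (rfib gr u) (fun=> 0)); last by rewrite /Rintegral integral0.
apply: eq_Rintegral => x; rewrite inE => xu; have -> : a x = 0; last by rewrite cabs0.
by apply: fsupp_eq0 => ax; apply: nx; exists x.
Qed.

Lemma I_norm_fin a : Cc a -> exists2 K : R, 0 <= K & I_norm gr lambda a = K%:E.
Proof.
move=> Ca; have [K HK] := fiber_L1_bounded Ca.
have [K' HK'] := fiber_L1_bounded (Cc_invol gr G_hausdorff Ca).
have IK : (I_norm gr lambda a <= (Num.max K K')%:E)%E.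
  by apply: I_norm_le => // u u1; rewrite le_max ?HK// HK'// orbT.
(* The range of [point] is a unit, so the suprema are not over the empty set. *)
have I0 : (0 <= I_norm gr lambda a)%E.
  apply: le_trans (fiber_L1_le_I (grng_rng gr point) Ca).
  by rewrite lee_fin; exact: fiber_L1_ge0.
move: IK I0; case: (I_norm gr lambda a) => [r| |]//.
by move=> _ r0; exists r.
Qed.

Lemma conv_absf_real a b : absf (conv gr lambda (absf a) (absf b)) = conv gr lambda (absf a) (absf b).
Proof.
apply/funext => x; have -> : conv gr lambda (absf a) (absf b) x = real_complex R
   (Rintegral (lambda (grng gr x)) (rfib gr (grng gr x))
     (fun y => cabs (a y) * cabs (b (gmul gr (ginv gr y) x)))).
  by rewrite -cint_real; apply: eq_cint => y _; rewrite /absf -rmorphM.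
rewrite /absf; congr (real_complex R _).
have -> : conv gr lambda (fun x0 => real_complex R (cabs (a x0))) (fun x0 => real_complex R (cabs (b x0))) x = real_complex R
   (Rintegral (lambda (grng gr x)) (rfib gr (grng gr x))
     (fun y => cabs (a y) * cabs (b (gmul gr (ginv gr y) x)))).
  by rewrite -cint_real; apply: eq_cint => y _; rewrite -rmorphM.
rewrite cabs_real ger0_norm//; apply: Rintegral_ge0 => y _.
by rewrite mulr_ge0 ?cabs_ge0.
Qed.

Lemma fiber_L1_absf u a : fiber_L1 u (absf a) = fiber_L1 u a.
Proof.
by apply: eq_Rintegral => x _; rewrite /absf cabs_real ger0_norm// cabs_ge0.
Qed.

Let CcC a b : Cc a -> Cc b -> Cc (conv gr lambda a b).
Proof. exact: Cc_conv. Qed.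

(** Absolute values turn the sum into a single convolution of $|a|$ with $\sum_j|b_j|$. The bound
    [L] on the whole sum is thus kept, without a factor for the number of terms. *)
Lemma sum_fiber_L1_conv (J : Type) (s : seq J) (b : J -> G -> R[i]) a u (L : R) :
  gunits gr u -> Cc a -> (forall j, Cc (b j)) ->
  (forall v, gunits gr v -> \sum_(j <- s) fiber_L1 v (b j) <= L) ->
  \sum_(j <- s) fiber_L1 u (conv gr lambda a (b j)) <= L * fiber_L1 u a.
Proof.
move=> u1 Ca Cb bL.
have Cna := Cc_absf Ca; have Cnb j := Cc_absf (Cb j).
apply: (@le_trans _ _ (\sum_(j <- s) fiber_L1 u (conv gr lambda (absf a) (absf (b j))))).
  apply: ler_sum => j _; apply: le_fiber_L1 => //; [exact: CcC|exact: CcC|].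
  by move=> x _; exact: cabs_conv_absf.
rewrite -fiber_L1_sum//; last by move=> j; exact: CcC.
rewrite (_ : (fun x => _) = conv gr lambda (absf a) (fun x => \sum_(j <- s) absf (b j) x)).
  rewrite -(fiber_L1_absf u a); apply: fiber_L1_conv => //; first exact: Cc_sum.
  by move=> v v1; rewrite fiber_L1_sum//; exact: bL.
rewrite (conv_sumr G_hausdorff lambda_haar)//.
by apply/funext => x; apply: eq_bigr => j _; rewrite conv_absf_real.
Qed.

(** * Matrices over $C_c(G)$ and their action on finite sums of $H$ *)

Section matrices.
Variable n : nat.
Implicit Types A B : 'I_n -> 'I_n -> G -> R[i].

Definition mxCc A := forall i j, Cc (A i j).

Definition mxconv A B : 'I_n -> 'I_n -> G -> R[i] :=
  fun i j x => \sum_(k < n) conv gr lambda (A i k) (B k j) x.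

Definition mxadj A : 'I_n -> 'I_n -> G -> R[i] := fun i j => invol gr (A j i).

(** The matrix analogue of the range half of the I-norm; the source half is the same bound for
    [mxadj A]. *)
Definition row_bound A (K : R) := forall u i, gunits gr u ->
  \sum_(j < n) fiber_L1 u (A i j) <= K.

Lemma mxCc_conv A B : mxCc A -> mxCc B -> mxCc (mxconv A B).
Proof. by move=> CA CB i j; apply: Cc_sum => k; exact: CcC. Qed.

Lemma mxCc_adj A : mxCc A -> mxCc (mxadj A).
Proof. by move=> CA i j; exact: Cc_invol. Qed.

Lemma mxadjK A : mxadj (mxadj A) = A.
Proof. by apply/funext => i; apply/funext => j; exact: involK. Qed.

Lemma mxadj_conv A B : mxCc A -> mxCc B ->
  mxadj (mxconv A B) = mxconv (mxadj B) (mxadj A).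
Proof.
move=> CA CB; apply/funext => i; apply/funext => j; apply/funext => x.
rewrite /mxadj /mxconv {1}/invol rmorph_sum; apply: eq_bigr => k _.
rewrite -(invol_conv G_locally_compact G_hausdorff lambda_haar)//.
Qed.

(** Submultiplicative like the maximal row sum of scalar matrices: summing over the columns first
    bounds each row of [B] by [L], and what is left is a row of [A]. *)
Lemma row_bound_conv A B (K L : R) : mxCc A -> mxCc B -> 0 <= L ->
  row_bound A K -> row_bound B L -> row_bound (mxconv A B) (L * K).
Proof.
move=> CA CB L0 AK BL u i u1.
apply: (@le_trans _ _ (\sum_(j < n) \sum_(k < n) fiber_L1 u (conv gr lambda (A i k) (B k j)))).
  by apply: ler_sum => j _; apply: fiber_L1_sum_le => // k; exact: CcC.
rewrite exchange_big /=; apply: (@le_trans _ _ (\sum_(k < n) L * fiber_L1 u (A i k))).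
  by apply: ler_sum => k _; apply: sum_fiber_L1_conv => // v v1; exact: BL.
by rewrite -mulr_sumr ler_wpM2l// AK.
Qed.

Lemma fiber_L1_entry A (K : R) u i j : row_bound A K -> gunits gr u -> fiber_L1 u (A i j) <= K.
Proof.
move=> AK u1; apply: le_trans (AK u i u1); rewrite (bigD1 j)//= lerDl.
by apply: sumr_ge0 => k _; exact: fiber_L1_ge0.
Qed.

(** In a self-adjoint matrix the adjoint of an entry is again an entry, so one row bound controls
    both halves of the I-norm. *)
Lemma I_norm_entry A (K : R) i j : mxCc A -> mxadj A = A -> row_bound A K ->
  (I_norm gr lambda (A i j) <= K%:E)%E.
Proof.
move=> CA AA AK; apply: I_norm_le => // u u1; first exact: fiber_L1_entry.
by rewrite -[invol gr (A i j)]/(mxadj A j i) AA; exact: fiber_L1_entry.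
Qed.

Section representation.
Variables (H : hilbertType R) (pi : (G -> R[i]) -> H -> H).
Hypothesis pi_rep : I_star_rep gr lambda pi.

Lemma rep0 xi : pi (fun=> 0) xi = 0.
Proof.
have := rep_add pi_rep 1 xi (@Cc0 R G) (@Cc0 R G).
under eq_fun do rewrite mulr0 addr0.
by rewrite scale1r -{1}[pi _ xi]addr0 => /addrI.
Qed.

Lemma rep_sum (J : Type) (s : seq J) (F : J -> G -> R[i]) xi : (forall j, Cc (F j)) ->
  pi (fun x => \sum_(j <- s) F j x) xi = \sum_(j <- s) pi (F j) xi.
Proof.
move=> CF; elim: s => [|j s IH].
  by rewrite big_nil -[RHS](rep0 xi); congr (pi _ xi); apply/funext => x; rewrite big_nil.
rewrite big_cons -IH -[pi (F j) xi]scale1r -(rep_add pi_rep)//; last exact: Cc_sum.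
by congr (pi _ xi); apply/funext => x; rewrite big_cons mul1r.
Qed.

Lemma rep0r a : Cc a -> pi a 0 = 0.
Proof.
move=> Ca; have := rep_linear pi_rep Ca 1 0 0.
by rewrite !scale1r addr0 -{1}[pi a 0]addr0 => /addrI.
Qed.

Lemma rep_sumr (J : Type) (s : seq J) a (xi : J -> H) : Cc a ->
  pi a (\sum_(j <- s) xi j) = \sum_(j <- s) pi a (xi j).
Proof.
move=> Ca; have pl := rep_linear pi_rep Ca.
elim: s => [|j s IH].
  by rewrite !big_nil rep0r.
by rewrite !big_cons -IH -[xi j]scale1r pl !scale1r.
Qed.

Lemma rep_norm_le a (K : R) xi : Cc a -> (I_norm gr lambda a <= K%:E)%E ->
  rnorm (pi a xi) <= K * rnorm xi.
Proof.
move=> Ca aK; have opK := le_trans (rep_I_decr pi_rep Ca) aK.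
have pl := rep_linear pi_rep Ca.
have pZ k x : pi a (k *: x) = k *: pi a x.
  by have := pl k x 0; rewrite rep0r// !addr0.
have [x0|x0] := eqVneq (rnorm xi) 0.
  rewrite (rnorm0_eq0 x0); have := pZ 0 0; rewrite !scale0r => ->.
  by rewrite !rnorm0 mulr0.
have xp : 0 < rnorm xi by rewrite lt_def x0 rnorm_ge0.
have : ((rnorm (pi a (real_complex R (rnorm xi)^-1 *: xi)))%:E <= K%:E)%E.
  apply: le_trans opK; apply: ereal_sup_ubound.
  exists (real_complex R (rnorm xi)^-1 *: xi) => //=.
  by rewrite rnormZ cabs_real ger0_norm ?invr_ge0 ?rnorm_ge0// mulVf.
by rewrite lee_fin pZ rnormZ cabs_real ger0_norm ?invr_ge0 ?rnorm_ge0// ler_pdivrMl// mulrC.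
Qed.

Definition mxrep A (xi : 'I_n -> H) : 'I_n -> H := fun i => \sum_(j < n) pi (A i j) (xi j).

Lemma mxrep_conv A B xi : mxCc A -> mxCc B ->
  mxrep (mxconv A B) xi = mxrep A (mxrep B xi).
Proof.
move=> CA CB; apply/funext => i; rewrite /mxrep.
under eq_bigr => j _.
  rewrite rep_sum; last by move=> k; exact: CcC.
  under eq_bigr => k _ do rewrite (rep_mul pi_rep)//.
  over.
rewrite exchange_big; apply: eq_bigr => k _.
by rewrite rep_sumr.
Qed.

Local Notation inner := (@partial_inner R 'I_n H (index_enum 'I_n)).
Local Notation N := (fnorm inner).

Let il := @partial_inner_lin R 'I_n H (index_enum 'I_n).
Let ih := @partial_inner_herm R 'I_n H (index_enum 'I_n).
Let ip := @partial_inner_ge0 R 'I_n H (index_enum 'I_n).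

Lemma mxrep_adj A xi eta : mxCc A ->
  inner (mxrep A xi) eta = inner xi (mxrep (mxadj A) eta).
Proof.
move=> CA; rewrite /partial_inner /mxrep.
have hsum (s : seq 'I_n) (x : 'I_n -> H) y :
    hinner H (\sum_(j <- s) x j) y = \sum_(j <- s) hinner H (x j) y.
  elim: s => [|j s IH]; first by rewrite !big_nil linear0l.
  by rewrite !big_cons -IH -[x j]scale1r hinner_lin scale1r mul1r.
have hsumr (s : seq 'I_n) (x : 'I_n -> H) y :
    hinner H y (\sum_(j <- s) x j) = \sum_(j <- s) hinner H y (x j).
  by rewrite hinner_herm hsum rmorph_sum; apply: eq_bigr => j _; rewrite [RHS]hinner_herm.
under eq_bigr do rewrite hsum.
under [RHS]eq_bigr do rewrite hsumr.
rewrite exchange_big; apply: eq_bigr => j _; apply: eq_bigr => i _.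
exact: (rep_star pi_rep).
Qed.

(** Each entry acts with norm at most [K]. The [n] summands in a coordinate give one factor [n], the
    [n] coordinates give $\sqrt n$, which is rounded up to [n]. *)
Lemma mxrep_crude A (K : R) xi : mxCc A -> mxadj A = A -> 0 <= K -> row_bound A K ->
  N (mxrep A xi) <= (n%:R * n%:R) * K * N xi.
Proof.
move=> CA AA K0 AK.
have coord (eta : 'I_n -> H) j : rnorm (eta j) <= N eta.
  rewrite -(@ler_pXn2r _ 2) ?nnegrE ?fnorm_ge0 ?rnorm_ge0// sqr_partial_norm.
  by rewrite (bigD1 j)//= lerDl; apply: sumr_ge0 => k _; exact: sqr_ge0.
have entry i : rnorm (mxrep A xi i) <= n%:R * (K * N xi).
  have sumle (s : seq 'I_n) : rnorm (\sum_(j <- s) pi (A i j) (xi j)) <= \sum_(j <- s) (K * N xi).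
    elim: s => [|j s IH]; first by rewrite !big_nil rnorm0.
    rewrite !big_cons; apply: le_trans (rnormD _ _) _; apply: lerD => //.
    apply: le_trans (rep_norm_le _ (CA i j) (I_norm_entry i j CA AA AK)) _.
    by rewrite ler_wpM2l.
  apply: le_trans (sumle _) _.
  by rewrite sumr_const cardT size_enum_ord mulr_natl.
have KN : 0 <= K * N xi by rewrite mulr_ge0// fnorm_ge0.
rewrite -(@ler_pXn2r _ 2) ?nnegrE ?fnorm_ge0 ?mulr_ge0 ?ler0n//; last exact: fnorm_ge0.
rewrite sqr_partial_norm.
apply: (@le_trans _ _ (\sum_(i < n) (n%:R * (K * N xi)) ^+ 2)).
  by apply: ler_sum => i _; rewrite !expr2; apply: ler_pM; rewrite ?rnorm_ge0 ?entry.
rewrite sumr_const cardT size_enum_ord -[leLHS]mulr_natl.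
rewrite -[X in _ <= X ^+ 2]mulrA [in leRHS]exprMn exprMn mulrA; apply: ler_wpM2r; first exact: sqr_ge0.
(* What remains is $n^3\le n^4$; the proof by exponents needs $n\ge 1$. *)
case: (n) => [|m]; first by rewrite mulr0n mul0r sqr_ge0.
by rewrite -expr2 -exprM -exprS; apply: ler_weXn2l => //; rewrite ler1n.
Qed.

(* The crude bound loses a factor n^2. It is applied to the powers
   (A^* A)^(2^k), whose row bounds are K^(2^(k+1)), and the factor disappears
   when the 2^k-th roots are taken. *)
Lemma mxrep_le A (K : R) xi : mxCc A -> 0 <= K -> row_bound A K ->
  row_bound (mxadj A) K -> N (mxrep A xi) <= K * N xi.
Proof.
move=> CA K0 AK AK'.
pose S := fix S k := if k is k'.+1 then mxconv (S k') (S k') else mxconv (mxadj A) A.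
have CS k : mxCc (S k).
  by elim: k => [|k IH] /=; apply: mxCc_conv => //; exact: mxCc_adj.
have SS k : mxadj (S k) = S k.
  elim: k => [|k IH] /=; last by rewrite mxadj_conv// IH.
  by rewrite mxadj_conv ?mxadjK//; exact: mxCc_adj.
have SK k : row_bound (S k) ((K ^+ 2) ^+ (2 ^ k)).
  elim: k => [|k IH] /=.
    by rewrite expn0 expr1 expr2; apply: row_bound_conv => //; exact: mxCc_adj.
  rewrite expnS mul2n -addnn exprD; apply: row_bound_conv => //.
  by rewrite exprn_ge0// sqr_ge0.
(* Moving one factor across the inner product gives $\langle
   B\eta,B\eta\rangle=\langle\eta,B^*B\eta\rangle$, and Cauchy-Schwarz does the rest. *)
have key B eta : mxCc B -> N (mxrep B eta) ^+ 2 <= N (mxrep (mxconv (mxadj B) B) eta) * N eta.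
  move=> CB; rewrite sqr_fnorm; last exact: ip.
  rewrite -{2}[B]mxadjK -mxrep_adj; last exact: mxCc_adj.
  rewrite -mxrep_conv//; last exact: mxCc_adj.
  apply: le_trans (ler_norm _) _; apply: le_trans (Re_cabs_le _) _.
  by apply: cauchy_schwarz_sqrt; [exact: il|exact: ih|exact: ip].
have q0 : N (mxrep (S 0%N) xi) <= K ^+ 2 * N xi.
  apply: (@pow2_limit R (fun k => N (mxrep (S k) xi)) (N xi) (n%:R * n%:R) (K ^+ 2)).
  - exact: fnorm_ge0.
  - by rewrite mulr_ge0.
  - exact: sqr_ge0.
  - by move=> k; exact: fnorm_ge0.
  - by move=> k; have := key (S k) xi (CS k); rewrite SS.
  - by move=> k; apply: mxrep_crude => //; rewrite exprn_ge0// sqr_ge0.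
rewrite -(@ler_pXn2r _ 2) ?nnegrE ?mulr_ge0 ?fnorm_ge0//.
apply: le_trans (key A xi CA) _.
rewrite exprMn [N xi ^+ 2]expr2 mulrA; apply: ler_wpM2r; first exact: fnorm_ge0.
exact: q0.
Qed.

End representation.
End matrices.
End I_norm_theory.

(** * The full norm *)

Lemma has_sum_reindex (R : realType) (I : choiceType) (h h' : I -> I) (f : I -> R[i]) l :
  cancel h h' -> cancel h' h -> has_sum f l -> has_sum (f \o h) l.
Proof.
move=> hK h'K fl e e0; have [s0 H0] := fl e e0; exists (map h' s0) => s us ss.
rewrite -(big_map h xpredT f); apply: H0.
  by rewrite (map_inj_uniq (can_inj hK)).
move=> i i0; rewrite -(h'K i); apply: map_f; apply: ss; exact: map_f.
Qed.

Section graded_induction.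
Variables (R : realType) (T : ptopologicalType) (Gam : groupType) (c : T -> Gam).
Hypothesis c_continuous : continuous (c : T -> discrete_topology Gam).

(** Identities additive in [f] need checking only on homogeneous functions, where the induced action
    is a plain translation. *)
Lemma Cc_graded_ind (P : (T -> R[i]) -> Prop) :
  (forall f g, Cc f -> Cc g -> P f -> P g -> P (fun x => f x + g x)) ->
  (forall f g, Cc f -> fsupp f `<=` c @^-1` [set g] -> P f) ->
  forall f, Cc f -> P f.
Proof.
move=> PD Ph f Cf; have [s us fs] := grade_support c_continuous Cf.
rewrite (restrict_decomp us fs); have Cr g := Cc_restrict c_continuous [set g] Cf.
elim: s {us fs} => [|g s IH].
  under eq_fun do rewrite big_nil.
  (* The zero function has empty support, so it is homogeneous of any degree. *)
  apply: (Ph _ 1%g); first exact: Cc0.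
  by move=> x; rewrite /fsupp (_ : [set _ | _] = set0) ?closure0// predeqE => y /=; rewrite eqxx.
under eq_fun do rewrite big_cons.
apply: PD => //; first exact: Cc_sum.
by apply: (Ph _ g) => //; exact: fsupp_restrict.
Qed.

End graded_induction.

(** * The induced representation on $\ell^2(\Gamma,H)$ *)

Section induced_representation.
Variables (R : realType) (G : ptopologicalType) (gr : topGroupoid G)
  (lambda : G -> {measure set (borel G) -> \bar R}) (Gam : groupType) (c : G -> Gam).
Hypothesis G_second_countable : @second_countable G.
Hypothesis G_locally_compact : locally_compact [set: G].
Hypothesis G_hausdorff : hausdorff_space G.
Hypothesis lambda_haar : haar_system gr lambda.
Hypothesis c_continuous : continuous (c : G -> discrete_topology Gam).
Hypothesis c_hom : forall x y, gsrc gr x = grng gr y ->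
  c (gmul gr x y) = (c x * c y)%g.
Implicit Types (a f : G -> R[i]) (g : Gam).

Local Notation fiber_L1 := (fiber_L1 gr lambda).
Local Notation comp g a := (restrict_fun (c @^-1` [set g]) a).

Let Cc_comp g a : Cc a -> Cc (comp g a).
Proof. exact: Cc_restrict. Qed.

(** At each point at most one component is nonzero, so the absolute values of the components add up
    to at most $|a|$. *)
Lemma sum_fiber_L1_grades (s : seq Gam) u a : uniq s -> gunits gr u -> Cc a ->
  \sum_(g <- s) fiber_L1 u (comp g a) <= fiber_L1 u a.
Proof.
move=> us u1 Ca; rewrite -(fiber_L1_sum G_hausdorff lambda_haar)//; last by move=> g; exact: Cc_comp.
apply: (le_fiber_L1 G_hausdorff lambda_haar) => //.
  by apply: Cc_sum => g; apply: Cc_absf; exact: Cc_comp.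
move=> x _; have [cs|cs] := boolP (c x \in s).
  rewrite (bigD1_seq (c x))//= big1 ?addr0.
    by rewrite /absf cabs_real restrict_fun_in// ger0_norm// cabs_ge0.
  move=> g gx; rewrite /absf restrict_fun_out ?cabs0// => /= xg.
  by rewrite -xg eqxx in gx.
rewrite big_seq big1 ?cabs0 ?cabs_ge0// => g gs.
rewrite /absf restrict_fun_out ?cabs0// => /= xg.
by rewrite xg gs in cs.
Qed.

Lemma comp_invol g a : invol gr (comp g a) = comp g^-1%g (invol gr a).
Proof.
apply/funext => x; rewrite /invol; have [cx|cx] := pselect (c x = g^-1%g).
  by rewrite !restrict_fun_in//= (c_inv c_hom) cx invgK.
rewrite !restrict_fun_out ?conjC0//= (c_inv c_hom) => H; apply: cx.
by rewrite -H invgK.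
Qed.

Variables (H : hilbertType R) (pi : (G -> R[i]) -> H -> H).
Hypothesis pi_rep : I_star_rep gr lambda pi.
Implicit Types xi : Gam -> H.

(* A function supported on G_g acts as pi(a) tensored with translation by g. *)
Definition graded_action a xi : Gam -> H :=
  fun b => \sum_(g \in [set: Gam]) pi (comp g a) (xi (g^-1 * b)%g).

(** Any list containing the grades of [a] computes the sum; this allows one list for two functions,
    or a list adapted to [b]. *)
Lemma graded_action_seq (s : seq Gam) a xi b : uniq s ->
  (forall x, a x != 0 -> c x \in s) ->
  graded_action a xi b = \sum_(g <- s) pi (comp g a) (xi (g^-1 * b)%g).
Proof.
move=> us sa; rewrite /graded_action (fsbigE s)//.
  by apply: eq_bigl => g; rewrite in_setT.
move=> g _ gs; rewrite (_ : comp g a = fun=> 0) ?(rep0 pi_rep)//; apply/funext => x.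
have [xg|xg] := pselect ((c @^-1` [set g]) x); last by rewrite restrict_fun_out.
rewrite restrict_fun_in//; apply/eqP; apply: contraNT gs => /sa.
by rewrite xg.
Qed.

(* On a finite set of grades the action is the matrix (pi(a_(g h^-1)))_(g,h). The
   functions a_g have disjoint supports, so the I-norm of a bounds its row sums
   and those of its adjoint. *)
Lemma graded_action_bound (s : seq Gam) a (K M : R) xi : Cc a -> 0 <= K -> 0 <= M ->
  (I_norm gr lambda a <= K%:E)%E ->
  (forall t, uniq t -> \sum_(b <- t) rnorm (xi b) ^+ 2 <= M ^+ 2) -> uniq s ->
  \sum_(b <- s) rnorm (graded_action a xi b) ^+ 2 <= (K * M) ^+ 2.
Proof.
move=> Ca K0 M0 aK xiM us; have [s0 us0 as0] := grade_support c_continuous Ca.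
(* [t] contains every coordinate of [xi] that contributes to a coordinate in [s], and [s] itself, so
   a square matrix indexed by [t] suffices. *)
pose t := undup (s ++ [seq (g^-1 * b)%g | b <- s, g <- s0]).
have ut : uniq t := undup_uniq _.
pose F b := \sum_(g <- t) pi (comp (b * g^-1)%g a) (xi g).
have quot_uniq b : uniq [seq (b * g^-1)%g | g <- t].
  by rewrite map_inj_uniq// => g h /mulgI/invg_inj.
(* The truncated action [F] is compared with the full one only on [s]; at the other indices of [t]
   it may differ, and there only nonnegativity of the squares is used. *)
have sF b : b \in s -> graded_action a xi b = F b.
  move=> bs; rewrite (@graded_action_seq [seq (b * g^-1)%g | g <- t])//.
    by rewrite big_map; apply: eq_bigr => g _; rewrite invgM invgK mulgVK.
  move=> x /as0 xs0; apply/mapP; exists ((c x)^-1 * b)%g.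
    by rewrite mem_undup mem_cat; apply/orP; right; apply/allpairsP; exists (b, c x).
  by rewrite invgM invgK mulVKg.
pose gam (i : 'I_(size t)) := tnth (in_tuple t) i.
pose A (i j : 'I_(size t)) := comp (gam i * (gam j)^-1)%g a.
have sum_gam (V : nmodType) (f : Gam -> V) : \sum_(g <- t) f g = \sum_i f (gam i).
  by rewrite (big_tnth _ _ t).
have CA : mxCc A by move=> i j; exact: Cc_comp.
(* For fixed [i] the grades of the entries in a row are pairwise distinct, so the row consists of
   different components of one function. *)
have rowE f u i : gunits gr u -> Cc f ->
    \sum_j fiber_L1 u (comp (gam i * (gam j)^-1)%g f) <= fiber_L1 u f.
  move=> u1 Cf; rewrite -(sum_gam _ (fun g => fiber_L1 u (comp (gam i * g^-1)%g f))).
  rewrite -(big_map (fun g => (gam i * g^-1)%g) xpredT (fun g => fiber_L1 u (comp g f))).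
  exact: sum_fiber_L1_grades.
have AK : row_bound gr lambda A K.
  move=> u i u1; rewrite -lee_fin; apply: le_trans aK.
  apply: le_trans (fiber_L1_le_I G_hausdorff lambda_haar u1 Ca).
  by rewrite lee_fin rowE.
(* The adjoint matrix has the same shape with [invol gr a] in place of [a], so its rows see the
   source half of the I-norm. *)
have AK' : row_bound gr lambda (mxadj gr A) K.
  move=> u i u1; rewrite -lee_fin; apply: le_trans aK.
  apply: le_trans (fiber_L1_invol_le_I G_hausdorff lambda_haar u1 Ca).
  rewrite lee_fin; apply: le_trans (rowE _ _ i u1 (Cc_invol gr G_hausdorff Ca)).
  apply: ler_sum => j _; rewrite /mxadj /A comp_invol invgM invgK.
  exact: lexx.
have mxF i : mxrep pi A (xi \o gam) i = F (gam i) by rewrite /F sum_gam.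
have NF : \sum_(b <- t) rnorm (F b) ^+ 2 =
    fnorm (partial_inner (index_enum _)) (mxrep pi A (xi \o gam)) ^+ 2.
  by rewrite sqr_partial_norm sum_gam; apply: eq_bigr => i _; rewrite mxF.
have Nxi : fnorm (partial_inner (index_enum _)) (xi \o gam) <= M.
  rewrite -(@ler_pXn2r _ 2) ?nnegrE ?fnorm_ge0// sqr_partial_norm.
  by rewrite -(sum_gam _ (fun g => rnorm (xi g) ^+ 2)) xiM.
rewrite big_seq; under eq_bigr => b bs do rewrite sF//.
rewrite -big_seq; apply: (@le_trans _ _ (\sum_(b <- t) rnorm (F b) ^+ 2)).
  apply: le_sum_subset => // [b|b bs]; first exact: sqr_ge0.
  by rewrite mem_undup mem_cat bs.
rewrite NF ler_pXn2r ?nnegrE ?fnorm_ge0 ?mulr_ge0//.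
apply: le_trans (mxrep_le G_second_countable G_locally_compact G_hausdorff
  lambda_haar pi_rep (xi \o gam) CA K0 AK AK') _.
by rewrite ler_wpM2l.
Qed.

Local Notation L := (l2_type Gam H).

Lemma graded_action_l2 a (u : L) : Cc a -> graded_action a u \in @l2_pred R Gam H.
Proof.
move=> Ca; apply/asboolP.
have [K K0 aK] := I_norm_fin G_hausdorff lambda_haar Ca.
exists ((K * rnorm u) ^+ 2) => s us; apply: graded_action_bound => //.
- exact: rnorm_ge0.
- by rewrite aK.
- by move=> t ut; rewrite rnorm_l2; exact: sum_le_l2_norm.
Qed.

(** For [a] in $C_c(G)$ the default is not taken, by [graded_action_l2]. *)
Definition induced_rep a (u : L) : L := insubd (0 : L) (graded_action a u).

Lemma induced_repE a (u : L) b : Cc a -> induced_rep a u b = graded_action a u b.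
Proof.
move=> Ca; rewrite -[induced_rep a u b]/(val (induced_rep a u) b).
by rewrite val_insubd graded_action_l2.
Qed.

Lemma induced_rep_norm a (K : R) (u : L) : Cc a -> 0 <= K ->
  (I_norm gr lambda a <= K%:E)%E -> rnorm (induced_rep a u) <= K * rnorm u.
Proof.
move=> Ca K0 aK; rewrite rnorm_l2; apply: l2_norm_le.
  by rewrite mulr_ge0// rnorm_ge0.
move=> s us; under eq_bigr do rewrite induced_repE//.
apply: graded_action_bound => //; first exact: rnorm_ge0.
by move=> t ut; rewrite rnorm_l2; exact: sum_le_l2_norm.
Qed.

Lemma induced_rep_homog a g (u : L) b : Cc a -> fsupp a `<=` c @^-1` [set g] ->
  induced_rep a u b = pi a (u (g^-1 * b)%g).
Proof.
move=> Ca ag; rewrite induced_repE// (@graded_action_seq [:: g])//.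
  by rewrite big_seq1 restrict_id.
by move=> x /fsupp_neq0/ag; rewrite inE => ->.
Qed.

Lemma l2_ext (u v : L) : (forall b, u b = v b) -> u = v.
Proof. by move=> uv; apply: val_inj; apply/funext. Qed.

Lemma induced_rep_linear a : Cc a -> linear (induced_rep a).
Proof.
move=> Ca k u v; apply: l2_ext => b.
have [s us sa] := grade_support c_continuous Ca.
rewrite [RHS]/= -[RHS]/(k *: induced_rep a u b + induced_rep a v b).
rewrite !induced_repE// !(graded_action_seq _ _ us sa) scaler_sumr -big_split.
apply: eq_bigr => g _; exact: (rep_linear pi_rep (Cc_comp g Ca)).
Qed.

Lemma induced_rep_add a b (k : R[i]) (u : L) : Cc a -> Cc b ->
  induced_rep (fun x => k * a x + b x) u = k *: induced_rep a u + induced_rep b u.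
Proof.
move=> Ca Cb; apply: l2_ext => d.
have [s us sa] := grade_support c_continuous Ca.
have [t ut tb] := grade_support c_continuous Cb.
have us' : uniq (undup (s ++ t)) := undup_uniq _.
have sa' x : a x != 0 -> c x \in undup (s ++ t).
  by move=> /sa; rewrite mem_undup mem_cat => ->.
have sb' x : b x != 0 -> c x \in undup (s ++ t).
  by move=> /tb; rewrite mem_undup mem_cat orbC => ->.
have sab' x : k * a x + b x != 0 -> c x \in undup (s ++ t).
  have [a0|a0] := eqVneq (a x) 0; last by move=> _; exact: sa'.
  by rewrite a0 mulr0 add0r; exact: sb'.
rewrite -[RHS]/(k *: induced_rep a u d + induced_rep b u d).
rewrite !induced_repE//; last exact: Cc_lin.
rewrite (graded_action_seq _ _ us' sab') (graded_action_seq _ _ us' sa').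
rewrite (graded_action_seq _ _ us' sb') scaler_sumr -big_split.
apply: eq_bigr => g _; rewrite restrict_lin.
by apply: (rep_add pi_rep); exact: Cc_comp.
Qed.

Lemma induced_repD a b (u : L) : Cc a -> Cc b ->
  induced_rep (fun x => a x + b x) u = induced_rep a u + induced_rep b u.
Proof.
move=> Ca Cb; have := induced_rep_add 1 u Ca Cb; rewrite scale1r => <-.
by congr (induced_rep _ u); apply/funext => x; rewrite mul1r.
Qed.

(** Both sides are additive in each function. For homogeneous ones of degrees $g$ and $h$ the
    convolution has degree $gh$, and the two translations compose accordingly. *)
Lemma induced_rep_mul a b (u : L) : Cc a -> Cc b ->
  induced_rep (conv gr lambda a b) u = induced_rep a (induced_rep b u).
Proof.
have CcC f f' : Cc f -> Cc f' -> Cc (conv gr lambda f f').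
  exact: Cc_conv G_locally_compact G_hausdorff lambda_haar _ _.
move=> Ca; move: a Ca b; apply: (Cc_graded_ind c_continuous).
  move=> f g Cf Cg IHf IHg b Cb; rewrite induced_repD// -IHf// -IHg// -induced_repD//; try exact: CcC.
  congr (induced_rep _ u).
  have := conv_linl G_hausdorff lambda_haar 1 Cf Cg Cb.
  under eq_fun do rewrite mul1r.
  by move=> ->; under eq_fun do rewrite mul1r.
move=> a g Ca ag; apply: (Cc_graded_ind c_continuous).
  move=> b b' Cb Cb' IHb IHb'; rewrite induced_repD//.
  have := induced_rep_linear Ca 1 (induced_rep b u) (induced_rep b' u).
  rewrite !scale1r => ->; rewrite -IHb -IHb' -induced_repD//; try exact: CcC.
  congr (induced_rep _ u).
  have := conv_linr G_hausdorff lambda_haar 1 Ca Cb Cb'.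
  under eq_fun do rewrite mul1r.
  by move=> ->; under eq_fun do rewrite mul1r.
move=> b h Cb bh; apply: l2_ext => d.
rewrite (induced_rep_homog _ _ _ ag)// (induced_rep_homog _ _ _ bh)//.
rewrite (@induced_rep_homog _ (g * h)%g).
- by rewrite (rep_mul pi_rep)// invgM mulgA.
- exact: CcC.
- exact: fsupp_conv.
Qed.

(** For [a] of degree $g$, reindexing the unordered sum by $b\mapsto gb$ moves the translation from
    one argument to the other; the rest is the adjoint relation for [pi] in each coordinate. *)
Lemma induced_rep_star a (u v : L) : Cc a ->
  l2_inner (induced_rep a u) v = l2_inner u (induced_rep (invol gr a) v).
Proof.
move=> Ca; move: a Ca u v; apply: (Cc_graded_ind c_continuous).
  move=> f g Cf Cg IHf IHg u v; rewrite induced_repD// -[induced_rep f u]scale1r.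
  rewrite l2_inner_lin mul1r IHf IHg.
  have -> : invol gr (fun x => f x + g x) = fun x => invol gr f x + invol gr g x.
    by apply/funext => x; rewrite /invol rmorphD.
  rewrite induced_repD; try exact: Cc_invol.
  rewrite [RHS]l2_inner_herm -[induced_rep (invol gr f) v]scale1r l2_inner_lin mul1r.
  rewrite rmorphD scale1r; congr (_ + _); exact: l2_inner_herm.
move=> a g Ca ag u v; apply: has_sum_uniq (l2_innerP _ _).
have := has_sum_reindex (mulKg g) (mulVKg g) (l2_innerP (induced_rep a u) v).
apply: eq_has_sum => b /=.
rewrite (induced_rep_homog u _ Ca ag).
rewrite (induced_rep_homog v _ (Cc_invol gr G_hausdorff Ca) (fsupp_invol c_continuous c_hom ag)).
by rewrite mulKg invgK (rep_star pi_rep).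
Qed.

Lemma induced_star_rep : @I_star_rep R G gr lambda (l2_hilbert Gam H) induced_rep.
Proof.
have IN a : Cc a -> (opnorm (induced_rep a) <= I_norm gr lambda a)%E.
  move=> Ca; have [K K0 aK] := I_norm_fin G_hausdorff lambda_haar Ca.
  rewrite aK; apply: ge_ereal_sup => _ [u /= u1 <-]; rewrite lee_fin.
  apply: le_trans (induced_rep_norm u Ca K0 _) _; first by rewrite aK.
  by rewrite -[leRHS]mulr1; apply: ler_wpM2l.
split.
- exact: induced_rep_linear.
- move=> a Ca; apply: le_lt_trans (IN a Ca) _.
  by have [K K0 ->] := I_norm_fin G_hausdorff lambda_haar Ca; exact: ltry.
- by move=> a b k u; exact: induced_rep_add.
- by move=> a b u; exact: induced_rep_mul.
- by move=> a u v; exact: induced_rep_star.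
- exact: IN.
Qed.

Lemma l2_single (x : H) : (fun b : Gam => if b == 1%g then x else 0) \in @l2_pred R Gam H.
Proof.
apply/asboolP; exists (rnorm x ^+ 2) => s us; have [s1|s1] := boolP (1%g \in s).
  rewrite (bigD1_seq 1%g)//= eqxx big1 ?addr0// => b /negbTE ->.
  by rewrite rnorm0 expr0n.
rewrite big_seq big1 ?sqr_ge0// => b bs; case: eqP => [b1|_]; last by rewrite rnorm0 expr0n.
by rewrite -b1 bs in s1.
Qed.

Lemma opnorm_restrict_le f : Cc f ->
  (opnorm (pi (comp 1%g f)) <= full_norm gr lambda f)%E.
Proof.
move=> Cf; apply: ge_ereal_sup => _ [x /= x1 <-].
pose u : L := L2Type (l2_single x).
have u1 : rnorm u <= 1.
  rewrite rnorm_l2; apply: l2_norm_le => // s us; rewrite expr1n.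
  have [s1|s1] := boolP (1%g \in s).
    rewrite (bigD1_seq 1%g)//= eqxx big1 ?addr0; first by rewrite expr_le1// rnorm_ge0.
    by move=> b /negbTE ->; rewrite rnorm0 expr0n.
  rewrite big_seq big1 ?ler01// => b bs /=; case: eqP => [b1|_]; last by rewrite rnorm0 expr0n.
  by rewrite -b1 bs in s1.
(* In the coordinate at the identity, grade [g] sees $u(g^{-1})$, which vanishes unless [g] is the
   identity. *)
have -> : pi (comp 1%g f) x = induced_rep f u 1%g.
  have [s us fs] := grade_support c_continuous Cf.
  rewrite induced_repE// (@graded_action_seq (undup (1%g :: s))) ?undup_uniq//; last first.
    by move=> y /fs ys; rewrite mem_undup in_cons ys orbT.
  rewrite (bigD1_seq 1%g) ?undup_uniq ?mem_undup ?mem_head//= mulg1 invg1 eqxx.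
  rewrite big1 ?addr0// => g /negbTE g1.
  by rewrite mulg1 invg_eq1 g1 (rep0r pi_rep)//; exact: Cc_comp.
apply: (@le_trans _ _ (rnorm (induced_rep f u))%:E).
  by rewrite lee_fin rnorm_l2; exact: l2_norm_coord.
apply: (@le_trans _ _ (opnorm (induced_rep f : l2_hilbert Gam H -> l2_hilbert Gam H))).
  by apply: ereal_sup_ubound; exists u.
by apply: ereal_sup_ubound; exists (l2_hilbert Gam H), induced_rep; split => //; exact: induced_star_rep.
Qed.

End induced_representation.

Lemma full_contraction (R : realType) (G : ptopologicalType) (gr : topGroupoid G)
  (lambda : G -> {measure set (borel G) -> \bar R}) (Gam : groupType) (c : G -> Gam) :
  @second_countable G -> locally_compact [set: G] -> hausdorff_space G ->
  haar_system gr lambda -> continuous (c : G -> discrete_topology Gam) ->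
  (forall x y, gsrc gr x = grng gr y -> c (gmul gr x y) = (c x * c y)%g) ->
  forall f : G -> R[i], Cc f ->
  (full_norm gr lambda (restrict_fun (c @^-1` [set 1%g]) f) <= full_norm gr lambda f)%E.
Proof.
move=> sc lc hG hl cc ch f Cf; apply: ge_ereal_sup => _ [H [pi [pi_rep ->]]].
exact: opnorm_restrict_le.
Qed.

Theorem corollary3p1 (R : realType) (G : ptopologicalType)
  (gr : topGroupoid G)
  (lambda : G -> {measure set (borel G) -> \bar R})
  (Gam : groupType) (c : G -> Gam)
  (G_second_countable : @second_countable G)
  (G_locally_compact : locally_compact [set: G])
  (G_hausdorff : hausdorff_space G)
  (lambda_haar : haar_system gr lambda)
  (c_continuous : continuous (c : G -> discrete_topology Gam))
  (c_hom : forall x y, gsrc gr x = grng gr y -> c (gmul gr x y) = (c x * c y)%g) :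
  (forall (A : cstarType R) (iota : (G -> R[i]) -> A),
    reduced_cstar gr lambda iota ->
    topologically_graded (grading_subspace c iota) /\
    forall P : {linear A -> A},
      implements_grading (grading_subspace c iota) P ->
      conditional_expectation (grading_subspace c iota 1%g) P /\
      forall f : G -> R[i], Cc f ->
        Cc (restrict_fun (c @^-1` [set 1%g]) f) /\
        P (iota f) = iota (restrict_fun (c @^-1` [set 1%g]) f)) /\
  (forall (B : cstarType R) (iota : (G -> R[i]) -> B),
    full_cstar gr lambda iota ->
    topologically_graded (grading_subspace c iota) /\
    forall P : {linear B -> B},
      implements_grading (grading_subspace c iota) P ->
      conditional_expectation (grading_subspace c iota 1%g) P /\
      forall f : G -> R[i], Cc f ->
        Cc (restrict_fun (c @^-1` [set 1%g]) f) /\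
        P (iota f) = iota (restrict_fun (c @^-1` [set 1%g]) f)).
Proof.
have CcC a b : Cc a -> Cc b -> Cc (conv gr lambda a b).
  exact: Cc_conv G_locally_compact G_hausdorff lambda_haar _ _.
have red f (_ : Cc f) := red_contraction lambda G_second_countable G_hausdorff
  c_continuous c_hom f.
have full := full_contraction G_second_countable G_locally_compact G_hausdorff
  lambda_haar c_continuous c_hom.
split=> A iota compl; split.
- exact: (gs_graded G_hausdorff c_continuous c_hom CcC compl red).
- by move=> P PA; exact: (gs_implements c_continuous c_hom CcC compl red PA).
- exact: (gs_graded G_hausdorff c_continuous c_hom CcC compl full).
- by move=> P PA; exact: (gs_implements c_continuous c_hom CcC compl full PA).
Qed.
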